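(* Let $(g,J^{ni})\in\mathcal C^{ni}$ be an $\mathrm{SU}(3)$-invariant almost Hermitian structure on $\mathbb F_2=\mathrm{SU}(3)/T^2$ compatible with $J^{ni}$. Then either: (i) there is a root $r$ together with an irreducible $\mathrm{SU}(3)$-invariant DT-instanton on $P_r$; or (ii) $g=g^{nk}$ is, up to scaling, the nearly Kähler metric, and there is a reducible pHYM connection on all the bundles $P_r$ ($r$ an integral weight). In this case the corresponding connection is reducible to $L_r\hookrightarrow P_r$.
   Context: Flag manifold: $\mathbb F_2=\mathrm{SU}(3)/T^2$, with $T^2$ the diagonal maximal torus. Write the Maurer–Cartan form of $\mathrm{SU}(3)$ as $$g^{-1}dg=\begin{pmatrix} i\beta_1&\theta_3+i\eta_3&-\theta_2+i\eta_2\\ -\theta_3+i\eta_3&i\beta_2&\theta_1+i\eta_1\\ \theta_2+i\eta_2&-\theta_1+i\eta_1&i\beta_3\end{pmatrix},\qquad \beta_1+\beta_2+\beta_3=0,$$ with real left-invariant 1-forms $\beta_i,\eta_i,\theta_i$. $\mathcal C^{ni}$: for $A_1,A_2,A_3>0$ set $\alpha_j=A_j(\eta_j+i\theta_j)$. $J^{ni}$ is the invariant (non-integrable) almost complex structure whose $(1,0)$-forms, pulled back to $\mathrm{SU}(3)$, are spanned by $\alpha_1,\alpha_2,\alpha_3$. $\mathcal C^{ni}$ is the set of $\mathrm{SU}(3)$-invariant almost Hermitian structures $(g,J^{ni})$ with $\omega=g(J\cdot,\cdot)=\frac i2\sum_j\alpha_j\wedge\bar\alpha_j$, parametrized by $(A_1,A_2,A_3)$.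 The nearly Kähler metric $g^{nk}$ corresponds to $A_1=A_2=A_3=1$. Weights and bundles: an integral weight is $\beta=k\beta_1+l\beta_2$, $k,l\in\mathbb Z$, with homomorphism $e^{i\beta}:T^2\to \mathrm U(1)$, $\mathrm{diag}(e^{is_1},e^{is_2},e^{-i(s_1+s_2)})\mapsto e^{i(ks_1+ls_2)}$. The roots are $\pm r_1,\pm r_2,\pm r_3$, where $r_1=\beta_1+2\beta_2$, $r_2=-2\beta_1-\beta_2$, $r_3=\beta_1-\beta_2$. Let $\lambda_\beta=\mathrm{diag}(e^{i\beta/2},e^{-i\beta/2}):T^2\to \mathrm{SU}(2)/\mathbb Z_2=\mathrm{SO}(3)$ and $P_\beta=\mathrm{SU}(3)\times_{(T^2,\lambda_\beta)}\mathrm{SO}(3)$. $P_\beta$ reduces to the $\mathrm U(1)$-bundle $L_\beta$ associated with $e^{i\beta}$ via the embedding of $\mathrm U(1)$ as maximal torus of $\mathrm{SO}(3)$. DT-instantons and pHYM: for a principal $G$-bundle $P$ ($G$ compact semisimple) over an almost Hermitian 6-manifold, a DT-instanton is a pair $(A,u)$ of a connection $A$ and $u\in\Omega^{0,3}(X,\mathfrak g_P^{\mathbb C})$ with $F_A^{0,2}=\bar\partial_A^*u$ and $\Lambda F_A=*[u\wedge\bar u]$, where $\bar\partial_A^*=-*\partial_A*$, $*$ is the $\mathbb C$-linear Hodge star, and $\Lambda F_A=*(F_A\wedge\omega^2)$. It is irreducible if $A$ is an irreducible connection (does not reduce to a principal subbundle with structure group a proper closed subgroup) and $\bar\partial_A^*u\neq0$.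 A connection $A$ is pHYM if $F_A^{0,2}=0$ and $\Lambda F_A=0$. *)

(* Defs.v *)
(* Everything on F_2 = SU(3)/T^2 is described by its pull-back to SU(3).
   With P = SU(3) x_(T^2,lambda) SO(3), so that [g h, k] = [g, lambda(h) k],
   and iota : SU(3) -> P, g |-> [g, 1]:
   - a connection on P is the same thing as its pull-back A along iota, an
     so(3)-valued 1-form on SU(3) with A = d lambda on t and
     R_h^* A = Ad(lambda(h)^-1) A for h in T^2;
   - a form on F_2 with values in g_P^C is the same thing as a horizontal
     T^2-equivariant so(3)^C-valued form on SU(3).
   Tangent vectors at g are written g X by left translation, so a form on
   SU(3) is a function of g and of matrices X.  Forms are extended
   C-multilinearly from su(3) to its complexification inside M_3(C), and
   SO(3), so(3), so(3)^C are also realised inside M_3(C). *)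

From HB Require Import structures.
From mathcomp Require Import all_boot all_order all_algebra all_fingroup complex.
From mathcomp Require Import all_classical all_reals all_analysis.

Set Implicit Arguments.
Unset Strict Implicit.
Unset Printing Implicit Defensive.

Import Order.TTheory GRing.Theory Num.Theory numFieldNormedType.Exports.

Local Open Scope classical_set_scope.
Local Open Scope ring_scope.
Local Open Scope complex_scope.

Section Defs.
Variable R : realType.

(* R[i] viewed as a [numFieldType], through which it and its matrices get
   their usual topology. *)
Definition Cx : numFieldType := R[i].
Notation M := 'M[R[i]]_3.

Definition conjmx (X : M) : M := map_mx (@conjc R) X.
Definition dag (X : M) : M := (conjmx X)^T.
Definition lieb (X Y : M) : M := X *m Y - Y *m X.

Definition SU3 : set M := [set g | g *m dag g = 1%:M /\ \det g = 1].
Definition su3 : set M := [set X | dag X = - X /\ \tr X = 0].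
Definition torus : set M := [set h | SU3 h /\ is_diag_mx h].
Definition SO3 : set M :=
  [set k | [/\ conjmx k = k, k *m k^T = 1%:M & \det k = 1]].
Definition so3 : set M := [set Y | conjmx Y = Y /\ Y^T = - Y].

Definition expm (X : M) : M :=
  lim (series (fun n => (n`!%:R^-1 : Cx) *: ((X ^+ n : M) : 'M[Cx]_3)) @ \oo).

Definition derivable_C (f : R -> R[i]) (t : R) : Prop :=
  derivable (fun s => complex.Re (f s)) t 1 /\
  derivable (fun s => complex.Im (f s)) t 1.

Definition derive_C (f : R -> R[i]) (t : R) : R[i] :=
  derive1 (fun s => complex.Re (f s)) t +i* derive1 (fun s => complex.Im (f s)) t.

Definition velocity (c : R -> M) (V : M) : Prop :=
  forall i j, derivable_C (fun t => c t i j) 0 /\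
              derive_C (fun t => c t i j) 0 = V i j.

(* Derivative along the left-invariant field generated by X in su(3). *)
Definition lieR (X : M) (f : M -> R[i]) (g : M) : R[i] :=
  derive_C (fun t => f (g *m expm (t%:C *: X))) 0.

(* C-linear extension of [lieR] in X = X' + i X'' with X', X'' in su(3). *)
Definition lieC (X : M) (f : M -> R[i]) (g : M) : R[i] :=
  lieR (2^-1 *: (X - dag X)) f g
  + 'i * lieR (- 'i / 2 *: (X + dag X)) f g.

Definition lieM (X : M) (f : M -> M) (g : M) : M :=
  \matrix_(i, j) lieC X (fun g' => f g' i j) g.

(* Smoothness on an open subset U of SU(3): all iterated derivatives along
   left-invariant fields exist and are continuous. *)
Fixpoint Cn (n : nat) (U : set M) (f : M -> R[i]) : Prop :=
  {within (U : set 'M[Cx]_3), continuous (f : 'M[Cx]_3 -> Cx)} /\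
  match n with
  | 0 => True
  | m.+1 => forall X, su3 X ->
      (forall g, U g ->
         derivable_C (fun t => f (g *m expm (t%:C *: X))) 0) /\
      Cn m U (lieR X f)
  end.

Definition smooth (U : set M) (f : M -> R[i]) : Prop := forall n, Cn n U f.

(* The Maurer-Cartan components.  With indices in Z/3 starting at 0 instead
   of 1, [eta j] and [theta j] are read off the entries (j+1, j+2), where
   theta_j + i eta_j stands, and (j+2, j+1), where - theta_j + i eta_j does. *)
Definition beta (j : 'I_3) (X : M) : R[i] := - 'i * X j j.
Definition eta (j : 'I_3) (X : M) : R[i] :=
  (X (j + 1) (j + 2) + X (j + 2) (j + 1)) / (2 * 'i).
Definition theta (j : 'I_3) (X : M) : R[i] :=
  (X (j + 1) (j + 2) - X (j + 2) (j + 1)) / 2.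

Definition eta_dual (j : 'I_3) : M :=
  'i *: (delta_mx (j + 1) (j + 2) + delta_mx (j + 2) (j + 1)).
Definition theta_dual (j : 'I_3) : M :=
  delta_mx (j + 1) (j + 2) - delta_mx (j + 2) (j + 1).

(* The invariant almost Hermitian structure (g, J^ni) with (1,0)-forms spanned
   by alpha_j = A_j (eta_j + i theta_j) and omega = g(J^ni ., .)
   = i/2 sum_j alpha_j /\ conj(alpha_j); [a j] stands for A_(j+1), and
   [a = fun=> 1] is the nearly Kaehler structure. *)
Definition metric (a : 'I_3 -> R) (X Y : M) : R[i] :=
  \sum_j (a j)%:C ^+ 2 * (eta j X * eta j Y + theta j X * theta j Y).

Definition alpha (a : 'I_3 -> R) (j : 'I_3) (X : M) : R[i] :=
  (a j)%:C * (eta j X + 'i * theta j X).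
Definition alphab (a : 'I_3 -> R) (j : 'I_3) (X : M) : R[i] :=
  (a j)%:C * (eta j X - 'i * theta j X).

(* The [metric a]-orthonormal horizontal frame dual to the coframe
   A_1 eta_1, A_1 theta_1, A_2 eta_2, A_2 theta_2, A_3 eta_3, A_3 theta_3,
   which is positive for the orientation omega^3. *)
Definition half6 (i : 'I_6) : 'I_3 := inord i./2.
Definition coframe (a : 'I_3 -> R) (i : 'I_6) (X : M) : R[i] :=
  (a (half6 i))%:C * (if odd i then theta (half6 i) X else eta (half6 i) X).
Definition frame (a : 'I_3 -> R) (i : 'I_6) : M :=
  ((a (half6 i))%:C)^-1 *:
    (if odd i then theta_dual (half6 i) else eta_dual (half6 i)).

(* Projections of the complexified Lie algebra onto T^(1,0) and T^(0,1) for
   J^ni, along t^C; they do not depend on [a].  The vector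
   (eta_dual j - i theta_dual j) / 2 is dual to eta_j + i theta_j. *)
Definition proj10 (X : M) : M :=
  \sum_j (eta j X + 'i * theta j X) *: (2^-1 *: (eta_dual j - 'i *: theta_dual j)).
Definition proj01 (X : M) : M :=
  \sum_j (eta j X - 'i * theta j X) *: (2^-1 *: (eta_dual j + 'i *: theta_dual j)).

Definition dform (V : Type) (n : nat) := M -> ('I_n -> M) -> V.

Definition vcat (p q : nat) (v : 'I_p -> M) (w : 'I_q -> M) (i : 'I_(p + q)) : M :=
  match fintype.split i with inl j => v j | inr j => w j end.

Definition wedge (V1 V2 : Type) (V3 : lmodType R[i]) (op : V1 -> V2 -> V3)
    (p q : nat) (phi : dform V1 p) (psi : dform V2 q) : dform V3 (p + q) :=
  fun g v => ((p`! * q`!)%:R : R[i])^-1 *: \sum_(s : 'S_(p + q))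
    (-1) ^+ s *: op (phi g (fun i => v (s (lshift q i))))
                    (psi g (fun j => v (s (rshift p j)))).

Definition omega (a : 'I_3 -> R) : dform R[i]^o 2 := fun _ v =>
  'i / 2 * \sum_j (alpha a j (v 0) * alphab a j (v 1)
                 - alpha a j (v 1) * alphab a j (v 0)).

(* C-linear Hodge star of horizontal forms:
   (star phi)(v) = 1/p! sum_f phi(E_f1, .., E_fp) vol(E_f1, .., E_fp, v). *)
Definition hodge (a : 'I_3 -> R) (V : lmodType R[i]) (p q : nat)
    (pq : (p + q)%N = 6) (phi : dform V p) : dform V q :=
  fun g v => (p`!%:R : R[i])^-1 *: \sum_(f : {ffun 'I_p -> 'I_6})
    (\det (\matrix_(i < p + q, j < p + q)
       coframe a (cast_ord pq i) (vcat (fun l => frame a (f l)) v j)))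
    *: phi g (fun l => frame a (f l)).

(* The (p, n - p)-component of a horizontal n-form. *)
Definition type_part (V : zmodType) (n p : nat) (phi : dform V n) : dform V n :=
  fun g v => \sum_(S : {set 'I_n} | #|S| == p)
    phi g (fun i => if i \in S then proj10 (v i) else proj01 (v i)).

(* X |-> - dag X is the conjugation of the complexified Lie algebra. *)
Definition conj_form (n : nat) (phi : dform M n) : dform M n :=
  fun g v => conjmx (phi g (fun i => - dag (v i))).

(* Koszul's formula; for i < j the bracket [v_i, v_j] is put in the slot of
   v_j rather than in front, which turns (-1)^(i+j) into (-1)^(i+1). *)
Definition dext (n : nat) (phi : dform M n) : dform M n.+1 :=
  fun g v => \sum_(i < n.+1) ((-1) ^+ i : R[i]) *:
    (lieM (v i) (fun g' => phi g' (fun l => v (lift i l))) g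
     - \sum_(j < n.+1 | (i < j)%N)
         phi g (fun l => if lift i l == j then lieb (v i) (v j)
                         else v (lift i l))).

(* An integral weight k beta_1 + l beta_2 is given by (k, l). *)
Definition weight_form (k l : int) (X : M) : R[i] :=
  k%:~R * beta 0 X + l%:~R * beta 1 X.
Definition weight_hom (k l : int) (h : M) : R[i] := h 0 0 ^ k * h 1 1 ^ l.

Definition is_root (k l : int) : Prop :=
  (k, l) \in [:: (1, 2); (-1, -2); (-2, -1); (2, 1); (1, -1); (-1, 1)].

Definition J3 : M := delta_mx 1 0 - delta_mx 0 1.

(* diag(e^(i s/2), e^(-i s/2)) in SU(2)/Z_2 = SO(3) is the rotation of angle s
   about a fixed axis. *)
Definition rot (z : R[i]) : M :=
  (complex.Re z)%:C *: (delta_mx 0 0 + delta_mx 1 1)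
  + (complex.Im z)%:C *: J3 + delta_mx 2 2.

Definition lambda (k l : int) (h : M) : M := rot (weight_hom k l h).

Definition is_connection (k l : int) (A : M -> M -> M) : Prop :=
  [/\ forall g, SU3 g -> forall (c : R[i]) X Y,
        A g (c *: X + Y) = c *: A g X + A g Y,
      forall g X, SU3 g -> su3 X -> so3 (A g X),
      forall g X, SU3 g -> su3 X -> is_diag_mx X ->
        A g X = weight_form k l X *: J3,
      forall g h X, SU3 g -> torus h -> su3 X ->
        A (g *m h) (invmx h *m X *m h)
        = invmx (lambda k l h) *m A g X *m lambda k l h
    & forall X i j, su3 X -> smooth SU3 (fun g => A g X i j)].

(* n-forms on F_2 with values in the complexified adjoint bundle of P. *)
Definition is_adj_form (k l : int) (n : nat) (phi : dform M n) : Prop :=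
  [/\ [/\ forall g, SU3 g -> forall (i : 'I_n) (c : R[i]) v w,
            phi g (fun j => if j == i then c *: v i + w else v j)
            = c *: phi g v + phi g (fun j => if j == i then w else v j)
        & forall g, SU3 g -> forall (i j : 'I_n) v,
            i != j -> v i = v j -> phi g v = 0],
      forall g v, SU3 g -> (phi g v)^T = - phi g v,
      forall g v (i : 'I_n), SU3 g -> is_diag_mx (v i) -> phi g v = 0,
      forall g h v, SU3 g -> torus h ->
        phi (g *m h) (fun i => invmx h *m v i *m h)
        = invmx (lambda k l h) *m phi g v *m lambda k l h
    & forall v i j, smooth SU3 (fun g => phi g v i j)].

Definition form1 (A : M -> M -> M) : dform M 1 := fun g v => A g (v 0).

Definition curvature (A : M -> M -> M) : dform M 2 := fun g v =>
  dext (form1 A) g v + 2^-1 *: wedge (V3 := M) lieb (form1 A) (form1 A) g v.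

Definition dcov (A : M -> M -> M) (n : nat) (phi : dform M n) : dform M n.+1 :=
  fun g v => dext phi g v + wedge (V3 := M) lieb (form1 A) phi g v.

(* - * d_A^(1,0) * on (0,3)-forms; as the star preserves the type (0,3), the
   operator d_A^(1,0) is here the (1,3)-component of d_A. *)
Definition dbar_adj (a : 'I_3 -> R) (A : M -> M -> M) (u : dform M 3) : dform M 2 :=
  fun g v => - hodge a (p := 4) (q := 2) (V := M) erefl
    (type_part 1 (dcov A (hodge a (p := 3) (q := 3) (V := M) erefl u))) g v.

Definition Lambda (a : 'I_3 -> R) (F : dform M 2) : dform M 0 :=
  hodge a (p := 6) (q := 0) erefl
    (wedge (fun (Y : M) (c : R[i]) => c *: Y) F
       (wedge (V3 := R[i]^o) (fun b c : R[i] => b * c) (omega a) (omega a))).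

Definition eq_form (V : Type) (n : nat) (phi psi : dform V n) : Prop :=
  forall g v, SU3 g -> phi g v = psi g v.

Definition DT_instanton (a : 'I_3 -> R) (k l : int) (A : M -> M -> M)
    (u : dform M 3) : Prop :=
  [/\ is_connection k l A,
      is_adj_form k l u /\ eq_form (type_part 0 u) u,
      eq_form (type_part 0 (curvature A)) (dbar_adj a A u)
    & eq_form (Lambda a (curvature A))
        (hodge a (p := 6) (q := 0) erefl
           (wedge (V3 := M) lieb u (conj_form u)))].

Definition pHYM (a : 'I_3 -> R) (k l : int) (A : M -> M -> M) : Prop :=
  [/\ is_connection k l A,
      eq_form (type_part 0 (curvature A)) (fun _ _ => 0)
    & eq_form (Lambda a (curvature A)) (fun _ _ => 0)].

Definition SU3_invariant_connection (A : M -> M -> M) : Prop :=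
  forall x g X, SU3 x -> SU3 g -> su3 X -> A (x *m g) X = A g X.

Definition SU3_invariant_form (n : nat) (phi : dform M n) : Prop :=
  forall x g v, SU3 x -> SU3 g -> phi (x *m g) v = phi g v.

Definition closed_subgroup (K : set M) : Prop :=
  [/\ K `<=` SO3, K 1%:M, forall x y, K x -> K y -> K (x *m invmx y)
    & closed (K : set 'M[Cx]_3)].

(* A subset of P is given by its preimage Q under the quotient map
   SU(3) x SO(3) -> P. *)
Definition principal_subbundle (k l : int) (K : set M) (Q : M -> M -> Prop) : Prop :=
  [/\ forall g x, Q g x -> SU3 g /\ SO3 x,
      forall g h x, SU3 g -> torus h -> SO3 x ->
        (Q (g *m h) x <-> Q g (lambda k l h *m x)),
      forall g x y, Q g x -> SO3 y -> (Q g y <-> K (invmx x *m y))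
    & forall g0, SU3 g0 -> exists (W : set M) (s : M -> M),
        [/\ open (W : set 'M[Cx]_3), W g0,
            forall i j, smooth (W `&` SU3) (fun g => s g i j)
          & forall g, (W `&` SU3) g -> Q g (s g)]].

(* The horizontal spaces of A are tangent to Q.  A curve [c t, y t] in P is
   horizontal iff y' = - A(c') y. *)
Definition horizontal_tangent (A : M -> M -> M) (Q : M -> M -> Prop) : Prop :=
  forall g x X, Q g x -> su3 X -> exists c y : R -> M,
    [/\ forall t, Q (c t) (y t), c 0 = g, y 0 = x,
        velocity c (g *m X) & velocity y (- (A g X *m x))].

Definition reduces_to (k l : int) (A : M -> M -> M) (K : set M)
    (Q : M -> M -> Prop) : Prop :=
  [/\ closed_subgroup K, principal_subbundle k l K Q & horizontal_tangent A Q].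

Definition reducible (k l : int) (A : M -> M -> M) : Prop :=
  exists (K : set M) (Q : M -> M -> Prop), K <> SO3 /\ reduces_to k l A K Q.

Definition irreducible_DT_instanton (a : 'I_3 -> R) (k l : int)
    (A : M -> M -> M) (u : dform M 3) : Prop :=
  [/\ DT_instanton a k l A u, ~ reducible k l A
    & ~ eq_form (dbar_adj a A u) (fun _ _ => 0)].

Definition max_torus : set M := [set rot z | z in [set z : R[i] | z * conjc z = 1]].

(* The image of L_(k,l) = SU(3) x_(T^2, e^(i beta)) U(1) in P_(k,l), as a
   subset of SU(3) x SO(3); it does not depend on (k,l). *)
Definition L_bundle (g x : M) : Prop := SU3 g /\ max_torus x.

End Defs.

(* Main.v *)
From HB Require Import structures.
Require Import Defs.
From mathcomp Require Import all_boot all_order all_algebra all_fingroup complex.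
From mathcomp Require Import all_classical all_reals all_analysis.
From mathcomp Require Import ring lra.
Import Defs.

Set Implicit Arguments.
Unset Strict Implicit.
Unset Printing Implicit Defensive.
Import Order.TTheory GRing.Theory Num.Theory numFieldNormedType.Exports.
Local Open Scope classical_set_scope.
Local Open Scope ring_scope.
Local Open Scope complex_scope.

(** Fix j in Z/3, a weight r = (k, l) and a real number c, and consider the
    left-invariant connection
      A = r J3 + c (theta_j J1 + eta_j J2)
    ([conn]), where J1, J2, J3 is the standard basis of so(3).  It is
    T^2-equivariant when c = 0, and also when r is the root such that T^2 acts
    through e^(ir) and e^(-ir) on the two matrix entries from which eta_j and
    theta_j are read off ([conn_equivariant]).

    The forms in play are invariant, so the instanton equations are algebraic.
    On horizontal vectors the curvature of A is
      sum_m s_m (A_m eta_m /\ A_m theta_m) J3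
        + c' conj(alpha_(j+1)) /\ conj(alpha_(j+2)) Jp
        + c' alpha_(j+1) /\ alpha_(j+2) Jm
    with Jp, Jm = J1 +- i J2 and c' a nonzero multiple of c
    ([curvature_horizontal]).  The last two summands do not contribute to
    Lambda F, which therefore vanishes as soon as the sum of the s_m does; for
    the root r of j this sum is
      (4 - c^2) / A_j^2 - 2 / A_(j+1)^2 - 2 / A_(j+2)^2    ([exists_root]).
    Take u = w conj(alpha_1) /\ conj(alpha_2) /\ conj(alpha_3) J3.  The bracket
    of u and its conjugate is zero because both are multiples of J3, and
    star(u) is a multiple of u.  The (1,3)-part of d star(u) vanishes because
    [T10, T01] lies in the Cartan subalgebra, while the bracket of the
    (1,0)-part of A with J3 is a multiple of alpha_j Jp; so the star of the
    (1,3)-part of d_A star(u) is a nonzero multiple of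
    c w conj(alpha_(j+1)) /\ conj(alpha_(j+2)) Jp ([dbar_adj_conn]).
    This is the form of F^(0,2), and w can be adjusted to make the two equal
    when c is not 0 ([exists_DT_instanton]).

    It remains to solve (4 - c^2) / A_j^2 = 2 / A_(j+1)^2 + 2 / A_(j+2)^2 in
    c <> 0.  For the smallest A_j this is possible unless the three A_m are
    equal ([exists_balancing_scale]).  If they are, the metric is a multiple of
    the nearly Kaehler one; then c = 0 gives a pHYM connection for every weight,
    as the coefficients of dr sum up to 0.  Its values are multiples of J3, so it
    reduces to the maximal torus ([conn0_reduces]).

    For c <> 0 the connection is irreducible ([conn_irreducible]).  A reduction
    is a closed set Q of pairs (g, x) that contains, to first order, the
    horizontal curves through each of its points; by a form of Nagumo's theorem
    it is then stable under the horizontal flows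
    (g, x) |-> (g exp(tX), exp(- t A(X)) x)  ([flow_invariant]).  The connection
    vanishes on the vectors dual to eta_m, theta_m for m <> j, so Q is stable
    under right translation of g by their one-parameter groups, and hence by
    those of eta_j, theta_j, which are conjugate to them by a quarter turn in
    another of these groups.  Undoing by such a translation the displacement of
    g in the horizontal flow of eta_j or theta_j leaves a rotation of x about
    the second or first axis.  These generate SO(3) ([SO3_euler]), so the
    structure group of the reduction is all of SO(3). *)

(** * Small index sets *)

Lemma I3_ind (P : 'I_3 -> Prop) : P 0 -> P 1 -> P 2 -> forall j, P j.
Proof.
move=> P0 P1 P2 [[|[|[|//]]] lt_j].
- by congr (P _): P0; apply/val_inj.
- by congr (P _): P1; apply/val_inj.
- by congr (P _): P2; apply/val_inj.
Qed.

Lemma add3_11 : 1 + 1 = 2 :> 'I_3. Proof. exact/val_inj. Qed.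
Lemma add3_12 : 1 + 2 = 0 :> 'I_3. Proof. exact/val_inj. Qed.
Lemma add3_21 : 2 + 1 = 0 :> 'I_3. Proof. exact/val_inj. Qed.
Lemma add3_22 : 2 + 2 = 1 :> 'I_3. Proof. exact/val_inj. Qed.
Definition add3E := (add3_11, add3_12, add3_21, add3_22, @add0r 'I_3).

Lemma sum3 (V : nmodType) (F : 'I_3 -> V) : \sum_j F j = F 0 + F 1 + F 2.
Proof.
rewrite !big_ord_recl big_ord0 addr0 addrA.
by congr (F _ + F _ + F _); apply/val_inj.
Qed.

Lemma ord2P (m : 'I_2) : m = 0 \/ m = 1.
Proof. by case: m => [[|[|//]] lt_m]; [left|right]; apply/val_inj. Qed.

Lemma sum_S2 (V : nmodType) (F : 'S_2 -> V) : \sum_s F s = F 1%g + F (tperm 0 1).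
Proof.
rewrite (bigD1 1%g) //= (bigD1 (tperm 0 1)) /=; last first.
  by apply/eqP => /permP/(_ 0); rewrite tpermL perm1.
rewrite big1 ?addr0 // => s /andP[/eqP s1 /eqP st].
have [s0|s0] := ord2P (s 0).
  case: s1; apply/permP => i; rewrite perm1; have [->//|->] := ord2P i.
  have [s10|//] := ord2P (s 1); by have := perm_inj (etrans s0 (esym s10)).
case: st; apply/permP => i; have [->|->] := ord2P i; rewrite ?tpermL ?tpermR //.
have [//|s11] := ord2P (s 1); by have := perm_inj (etrans s0 (esym s11)).
Qed.

Lemma det2E (K : comNzRingType) (B : 'M[K]_2) : \det B = B 0 0 * B 1 1 - B 0 1 * B 1 0.
Proof.
rewrite /determinant sum_S2 odd_perm1 odd_tperm /= expr0 expr1 mul1r mulN1r.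
rewrite !big_ord_recl !big_ord0 /= !mulr1 !perm1.
have -> : lift ord0 ord0 = 1 :> 'I_2 by apply/val_inj.
by rewrite -![ord0]/(0 : 'I_2) tpermL tpermR.
Qed.

(** * Determinants of stacked matrices *)

Section ExteriorAlgebra.
Variable K : comNzRingType.

Definition same_block p q (i k : 'I_(p + q)) := (i < p)%N == (k < p)%N.
(** The Young subgroup S_p x S_q of S_(p+q). *)
Definition block_perms p q : {set 'S_(p + q)} :=
  [set s : 'S_(p + q) | [forall i, same_block i (s i)]].

(** Laplace expansion with every shuffle repeated, as in the definition of the
    wedge product.  A product of complementary minors is the determinant of a
    block diagonal matrix, so its Leibniz expansion runs over [block_perms];
    each of these contributes one copy of the whole determinant. *)
Lemma det_shuffle p q (A : 'M[K]_(p, p + q)) (B : 'M[K]_(q, p + q)) :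
  \sum_(s : 'S_(p + q)) (-1) ^+ s *
     (\det (\matrix_(i, l) A i (s (lshift q l))) *
      \det (\matrix_(i, l) B i (s (rshift p l))))
  = #|block_perms p q|%:R * \det (col_mx A B).
Proof.
(* The permutations t that preserve the blocks shift the index of the Leibniz
   expansion of the large determinant. *)
transitivity (\sum_(s : 'S_(p + q)) \sum_(t in block_perms p q)
    (-1) ^+ (t * s)%g * \prod_i col_mx A B i ((t * s)%g i)).
  apply: eq_bigr => s _.
  rewrite -(det_ublock _ 0) mulr_sumr.
  rewrite [RHS]big_mkcond; apply: eq_bigr => t _.
  have blk i k : block_mx (\matrix_(i, l) A i (s (lshift q l))) 0 0
        (\matrix_(i, l) B i (s (rshift p l))) i k
      = if same_block i k then col_mx A B i (s k) else 0.
    rewrite /same_block; case: (split_ordP i) => i' ->; case: (split_ordP k) => k' ->.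
    - by rewrite block_mxEul col_mxEu mxE.
    - by rewrite block_mxEur mxE.
    - by rewrite block_mxEdl mxE.
    - by rewrite block_mxEdr col_mxEd mxE.
  rewrite inE; case: ifPn => [/forallP tb | /forallPn[i ti]].
    rewrite odd_permM addbC signr_addb mulrA; congr (_ * _).
    by apply: eq_bigr => i _; rewrite blk tb permM.
  by rewrite (bigD1 i) //= blk (negPf ti) mul0r !mulr0.
rewrite exchange_big /= mulr_natl -sumr_const; apply: eq_bigr => t _.
by rewrite /determinant [RHS](reindex_inj (mulgI t)).
Qed.

Lemma block_perms_gt0 p q : (0 < #|block_perms p q|)%N.
Proof.
apply/card_gt0P; exists 1%g; rewrite inE; apply/forallP => i.
by rewrite perm1 /same_block.
Qed.

Definition unit_cols p n (f : 'I_p -> 'I_n) : 'M[K]_(n, p) :=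
  \matrix_(i, l) (i == f l)%:R.

(** Laplace expansion along the first p columns, written as the Hodge star is:
    the sum runs over all p-tuples of rows instead of the increasing ones,
    whence the factor p!. *)
Lemma det_unit_cols_sum p q (C : 'M[K]_(p, p + q)) (V : 'M[K]_(p + q, q)) :
  \sum_(f : {ffun 'I_p -> 'I_(p + q)})
     \det (row_mx (unit_cols f) V) * \det (C *m unit_cols f)
  = p`!%:R * \det (row_mx C^T V).
Proof.
have expand : \det (row_mx C^T V) = \sum_(f : {ffun 'I_p -> 'I_(p + q)})
     (\prod_l C l (f l)) * \det (row_mx (unit_cols f) V).
  rewrite -det_tr [LHS]/determinant.
  transitivity (\sum_(s : 'S_(p + q)) \sum_(f : {ffun 'I_p -> 'I_(p + q)})
    (-1) ^+ s * ((\prod_l (C l (f l) * (s (lshift q l) == f l)%:R))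
      * \prod_l V (s (rshift p l)) l)).
    apply: eq_bigr => s _; rewrite -mulr_sumr; congr (_ * _).
    rewrite -mulr_suml big_split_ord /=; congr (_ * _); last first.
      by apply: eq_bigr => l _; rewrite mxE row_mxEr.
    rewrite (bigD1 [ffun l => s (lshift q l)]) //= [X in _ = _ + X]big1 ?addr0.
      by apply: eq_bigr => l _; rewrite !ffunE mxE row_mxEl eqxx mulr1 mxE.
    move=> f /eqP fs; have /existsP[l fl] : [exists l, s (lshift q l) != f l].
      rewrite -negb_forall; apply/negP => /forallP fE; apply: fs.
      by apply/ffunP => l; rewrite ffunE; apply/esym/eqP.
    by rewrite (bigD1 l) //= (negPf fl) mulr0 mul0r.
  rewrite exchange_big /=; apply: eq_bigr => f _.
  rewrite -det_tr mulr_sumr; apply: eq_bigr => s _.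
  rewrite [RHS]mulrCA big_split /= big_split_ord /= -!mulrA.
  congr (_ * (_ * (_ * _))); apply: eq_bigr => l _.
    by rewrite mxE row_mxEl mxE.
  by rewrite mxE row_mxEr.
have det_perm_cols (f : {ffun 'I_p -> 'I_(p + q)}) (t : 'S_p) :
    \det (row_mx (unit_cols (f \o t)) V)
    = (-1) ^+ t * \det (row_mx (unit_cols f) V).
  have -> : row_mx (unit_cols (f \o t)) V
      = row_mx (unit_cols f) V *m block_mx (perm_mx t^-1%g) 0 0 1%:M.
    rewrite mul_row_block !mulmx0 mulmx1 add0r addr0; congr row_mx.
    by apply/matrixP => i l; rewrite -col_permE !mxE.
  by rewrite det_mulmx det_ublock det_perm det1 mulr1 odd_permV mulrC.
transitivity (\sum_(t : 'S_p) \sum_(f : {ffun 'I_p -> 'I_(p + q)})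
    (\prod_l C l (f (t l))) * \det (row_mx (unit_cols (f \o t)) V)).
  rewrite exchange_big /=; apply: eq_bigr => f _.
  rewrite mulr_sumr; apply: eq_bigr => t _.
  rewrite det_perm_cols [RHS]mulrC mulrCA -mulrA; congr (_ * (_ * _)).
  apply: eq_bigr => l _; rewrite mxE (bigD1 (f (t l))) //= mxE eqxx mulr1.
  by rewrite big1 ?addr0 // => k /negPf kf; rewrite mxE kf mulr0.
rewrite (eq_bigr (fun=> \det (row_mx C^T V))).
  by rewrite sumr_const card_Sn mulr_natl.
move=> t _; rewrite expand.
rewrite (reindex (fun f : {ffun 'I_p -> 'I_(p + q)} => [ffun l => f (t^-1%g l)])) /=.
  apply: eq_bigr => f _; congr (_ * _).
    by apply: eq_bigr => l _; rewrite ffunE permK.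
  by congr (\det (row_mx _ _)); apply/matrixP => i l; rewrite !mxE /= ffunE permK.
exists (fun f : {ffun 'I_p -> 'I_(p + q)} => [ffun l => f (t l)]) => f _;
  by apply/ffunP => l; rewrite !ffunE ?permK ?permKV.
Qed.

End ExteriorAlgebra.

Section BlockDet.
Variable K : fieldType.

Definition det3 p q r n (e : (p + (q + r))%N = n) (A : 'M[K]_(p, n))
    (B : 'M[K]_(q, n)) (D : 'M[K]_(r, n)) : K :=
  \det (castmx (erefl, esym e) (col_mx A (col_mx B D))).

Lemma det3_eq0 p q r n (e : (p + (q + r))%N = n) A B D
    (x : 'rV[K]_p) (y : 'rV[K]_q) (z : 'rV[K]_r) :
  (x != 0) || (y != 0) -> x *m A + (y *m B + z *m D) = 0 -> det3 e A B D = 0.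
Proof.
rewrite /det3; case: n / e A B D => A B D xy0 xyz; rewrite castmx_id.
apply/eqP/det0P; exists (row_mx x (row_mx y z)); last by rewrite !mul_row_col.
apply: contraTN xy0 => /eqP; rewrite -row_mx0 -row_mx0.
by case/eq_row_mx => -> /eq_row_mx[-> _]; rewrite !eqxx.
Qed.

(** Exchanging two blocks of p rows has sign (-1)^(p * p). *)
Lemma det3_swap12 p r n (e : (p + (p + r))%N = n) A B D :
  ~~ odd p -> det3 e B A D = det3 e A B D.
Proof.
move=> evp; rewrite /det3; case: n / e A B D => A B D; rewrite !castmx_id.
have shearU (X Y : 'M[K]_(p, p + (p + r))) (Z : 'M[K]_(r, p + (p + r))) :
    \det (col_mx (X + Y) (col_mx Y Z)) = \det (col_mx X (col_mx Y Z)).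
  rewrite -[RHS]mul1r.
  have <- : \det (block_mx 1%:M (row_mx 1%:M 0) 0 1%:M : 'M[K]_(p + (p + r))) = 1.
    by rewrite det_ublock !det1 mul1r.
  rewrite -det_mulmx mul_block_col !mul1mx mul0mx add0r mul_row_col.
  by rewrite mul1mx mul0mx addr0.
have shearL (X Y : 'M[K]_(p, p + (p + r))) (Z : 'M[K]_(r, p + (p + r))) :
    \det (col_mx X (col_mx (Y - X) Z)) = \det (col_mx X (col_mx Y Z)).
  rewrite -[RHS]mul1r.
  have <- : \det (block_mx 1%:M 0 (col_mx (- 1%:M) 0) 1%:M : 'M[K]_(p + (p + r))) = 1.
    by rewrite det_lblock !det1 mul1r.
  rewrite -det_mulmx mul_block_col !mul1mx mul0mx addr0 mul_col_mx.
  by rewrite mulNmx mul1mx mul0mx add_col_mx add0r addrC.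
(* (A, B) -> (A + B, B) -> (A + B, - A) -> (B, - A). *)
rewrite -[RHS]shearU -[RHS]shearL opprD [B + (_ - _)]addrC subrK.
rewrite -[RHS]shearU [A + B]addrC addrK.
have -> : col_mx B (col_mx (- A) D)
    = block_mx 1%:M 0 0 (block_mx (- 1%:M) 0 0 1%:M) *m col_mx B (col_mx A D).
  by rewrite !mul_block_col !mul1mx !mul0mx !addr0 !add0r mulNmx mul1mx.
rewrite det_mulmx !det_ublock !det1 mul1r mulr1 -scaleN1r detZ det1 mulr1.
by rewrite -signr_odd (negPf evp) expr0 mul1r.
Qed.

Lemma det3_swap23 p r n (e : (p + (r + r))%N = n) A B D :
  ~~ odd r -> det3 e A D B = det3 e A B D.
Proof.
move=> evr; rewrite /det3; case: n / e A B D => A B D; rewrite !castmx_id.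
have -> : col_mx A (col_mx D B)
    = block_mx 1%:M 0 0 (block_mx 0 1%:M 1%:M 0) *m col_mx A (col_mx B D).
  by rewrite !mul_block_col !mul1mx !mul0mx !addr0 !add0r.
rewrite det_mulmx det_ublock det1 mul1r.
suff -> : \det (block_mx 0 1%:M 1%:M 0 : 'M[K]_(r + r)) = 1 by rewrite mul1r.
pose U := block_mx 1%:M 1%:M 0 1%:M : 'M[K]_(r + r).
pose L := block_mx 1%:M 0 (- 1%:M) 1%:M : 'M[K]_(r + r).
have -> : block_mx 0 1%:M 1%:M 0
    = block_mx 1%:M 0 0 (- 1%:M) *m (U *m (L *m U)) :> 'M[K]_(r + r).
  rewrite /U /L !(mulmx_block, mul1mx, mulmx1, mul0mx, mulNmx, addr0, add0r, addNr, addrN).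
  by rewrite opprK oppr0.
rewrite !det_mulmx !det_ublock !det_lblock !det1 !mulr1 mul1r -scaleN1r detZ det1 mulr1.
by rewrite -signr_odd (negPf evr).
Qed.
End BlockDet.

(** * Decomposable forms in the orthonormal coframe *)

Section Frames.
Variable R : realType.
Notation C := R[i].
Notation M := 'M[C]_3.
Implicit Types (X Y Z : M) (a : 'I_3 -> R).

Lemma mul_ii : 'i * 'i = -1 :> C. Proof. by rewrite -expr2 sqrCi. Qed.
Lemma i_neq0 : 'i != 0 :> C. Proof. exact: neq0Ci. Qed.
Lemma two_neq0 : 2 != 0 :> C. Proof. by rewrite pnatr_eq0. Qed.

Lemma eta_eta (m n : 'I_3) : eta m (eta_dual R n) = (m == n)%:R.
Proof.
rewrite /eta /eta_dual !mxE; move: m n; have := i_neq0; have := two_neq0 => two i0.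
by do 2![apply: I3_ind]; rewrite !add3E !eqE /= ?mulr0n ?mulr1n; field.
Qed.

Lemma eta_theta (m n : 'I_3) : eta m (theta_dual R n) = 0.
Proof.
rewrite /eta /theta_dual !mxE; move: m n; have := i_neq0; have := two_neq0 => two i0.
by do 2![apply: I3_ind]; rewrite !add3E !eqE /= ?mulr0n ?mulr1n; field.
Qed.

Lemma theta_eta (m n : 'I_3) : theta m (eta_dual R n) = 0.
Proof.
rewrite /theta /eta_dual !mxE; move: m n; have := i_neq0; have := two_neq0 => two i0.
by do 2![apply: I3_ind]; rewrite !add3E !eqE /= ?mulr0n ?mulr1n; field.
Qed.

Lemma theta_theta (m n : 'I_3) : theta m (theta_dual R n) = (m == n)%:R.
Proof.
rewrite /theta /theta_dual !mxE; move: m n; have := i_neq0; have := two_neq0 => two i0.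
by do 2![apply: I3_ind]; rewrite !add3E !eqE /= ?mulr0n ?mulr1n; field.
Qed.

Lemma etaZ j (c : C) X : eta j (c *: X) = c * eta j X.
Proof. by rewrite /eta !mxE -mulrDr mulrA. Qed.

Lemma thetaZ j (c : C) X : theta j (c *: X) = c * theta j X.
Proof. by rewrite /theta !mxE -mulrBr mulrA. Qed.

Definition ev (m : 'I_3) : 'I_6 := inord m.*2.
Definition od (m : 'I_3) : 'I_6 := inord m.*2.+1.

Lemma val_ev m : ev m = m.*2 :> nat.
Proof. by rewrite inordK //; case: m => [[|[|[|]]]]. Qed.
Lemma val_od m : od m = m.*2.+1 :> nat.
Proof. by rewrite inordK //; case: m => [[|[|[|]]]]. Qed.
Lemma half_ev m : half6 (ev m) = m.
Proof. by apply/val_inj; rewrite /half6 val_ev doubleK inord_val. Qed.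
Lemma half_od m : half6 (od m) = m.
Proof. by apply/val_inj; rewrite /half6 val_od /= uphalf_double inord_val. Qed.
Lemma odd_ev m : odd (ev m) = false. Proof. by rewrite val_ev odd_double. Qed.
Lemma odd_od m : odd (od m) = true. Proof. by rewrite val_od /= odd_double. Qed.

Lemma ev_inj m n : (ev m == ev n) = (m == n).
Proof. by apply/eqP/eqP => [/(congr1 half6)|-> //]; rewrite !half_ev. Qed.
Lemma od_inj m n : (od m == od n) = (m == n).
Proof. by apply/eqP/eqP => [/(congr1 half6)|-> //]; rewrite !half_od. Qed.
Lemma ev_od m n : (ev m == od n) = false.
Proof. by apply/eqP => /(congr1 (fun k : 'I_6 => odd k)); rewrite odd_ev odd_od. Qed.
Lemma od_ev m n : (od m == ev n) = false.
Proof. by rewrite eq_sym ev_od. Qed.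

Lemma I6_ind (P : 'I_6 -> Prop) :
  (forall m, P (ev m)) -> (forall m, P (od m)) -> forall k, P k.
Proof.
move=> Pe Po k; have e : k = (odd k + k./2.*2)%N :> nat by rewrite odd_double_half.
have hk : (k./2 < 3)%N by case: k {e} => [[|[|[|[|[|[|]]]]]]].
case: (odd k) e => e.
  by have -> : k = od (Ordinal hk) by apply/val_inj => /=; rewrite val_od; exact: e.
by have -> : k = ev (Ordinal hk) by apply/val_inj => /=; rewrite val_ev; exact: e.
Qed.

Section Coframe.
Variable a : 'I_3 -> R.
Hypothesis a_gt0 : forall j, 0 < a j.

Lemma aC_neq0 j : (a j)%:C != 0.
Proof. by rewrite eq_complex /= eqxx andbT gt_eqF. Qed.

Lemma coframe_frame (i k : 'I_6) : coframe a i (frame a k) = (i == k)%:R.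
Proof.
rewrite /coframe /frame.
elim/I6_ind: i => m; elim/I6_ind: k => n;
  rewrite ?half_ev ?half_od ?odd_ev ?odd_od /= ?ev_inj ?od_inj ?ev_od ?od_ev
    1?etaZ 1?thetaZ ?eta_eta ?eta_theta ?theta_eta ?theta_theta ?mulr0 //;
  by case: eqVneq => [->|_]; rewrite ?mulr0 ?mulr1 ?mulfV ?aC_neq0.
Qed.

Definition coords p (v : 'I_p -> M) : 'M[C]_(6, p) := \matrix_(k, l) coframe a k (v l).

(** The form alpha_1 /\ .. /\ alpha_p (x) Y, where the rows of A are the
    coordinates of the alpha_i in the coframe. *)
Definition detform (V : lmodType C) p (A : 'M[C]_(p, 6)) (Y : V) : dform R V p :=
  fun (_ : M) v => \det (A *m coords v) *: Y.

(** The star of alpha_1 /\ .. /\ alpha_p is the volume form with the vectors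
    dual to the alpha_i in its first slots; in the orthonormal frame these have
    the same coordinates as the alpha_i, which are the columns of A^T. *)
Lemma hodge_detform (V : lmodType C) p q (pq : (p + q)%N = 6) (A : 'M[C]_(p, 6)) (Y : V) g v :
  hodge a pq (detform A Y) g v
  = \det (castmx (esym pq, erefl) (row_mx A^T (coords v))) *: Y.
Proof.
have castE n (e : (p + q)%N = n) (B : 'M[C]_(p, n)) (W : 'M[C]_(n, q)) :
    \sum_(f : {ffun 'I_p -> 'I_n})
       \det (castmx (esym e, erefl) (row_mx (unit_cols C f) W)) * \det (B *m unit_cols C f)
    = p`!%:R * \det (castmx (esym e, erefl) (row_mx B^T W)).
  case: n / e B W => B W; rewrite castmx_id -det_unit_cols_sum.
  by apply: eq_bigr => f _; rewrite castmx_id.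
rewrite /hodge /detform.
rewrite (eq_bigr (fun f : {ffun 'I_p -> 'I_6} =>
  (\det (castmx (esym pq, erefl) (row_mx (unit_cols C f) (coords v)))
    * \det (A *m unit_cols C f)) *: Y)); last first.
  move=> f _; rewrite scalerA.
  have -> : coords (fun l => frame a (f l)) = unit_cols C f.
    by apply/matrixP => i l; rewrite !mxE coframe_frame.
  congr ((_ * _) *: _).
  congr (\det _); apply/matrixP => i l; rewrite castmxE cast_ord_id mxE /vcat.
  have -> : cast_ord (esym (esym pq)) i = cast_ord pq i by apply/val_inj.
  by rewrite mxE; case: fintype.split => l'; rewrite mxE ?coframe_frame.
rewrite -scaler_suml castE scalerA mulrA mulVf ?mul1r //.
Qed.

(** The number of shuffled copies of each term of a wedge product, over the
    normalising factor p! q!; its value is 1. *)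
Definition shuffle_const p q : C := ((p`! * q`!)%:R)^-1 * #|block_perms p q|%:R.

Lemma shuffle_const_neq0 p q : shuffle_const p q != 0.
Proof.
rewrite mulf_neq0 ?invr_eq0 ?pnatr_eq0 -?lt0n ?muln_gt0 ?fact_gt0 //.
exact: block_perms_gt0.
Qed.

(** The minors of A and B at the shuffled arguments combine by [det_shuffle]. *)
Lemma wedge_detform (V1 V2 V3 : lmodType C) (op : V1 -> V2 -> V3)
    (opZ : forall (x y : C) (Y : V1) (Z : V2), op (x *: Y) (y *: Z) = (x * y) *: op Y Z)
    p q (A : 'M[C]_(p, 6)) (B : 'M[C]_(q, 6)) (Y : V1) (Z : V2) g v :
  wedge op (detform A Y) (detform B Z) g v
  = detform (col_mx A B) (shuffle_const p q *: op Y Z) g v.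
Proof.
rewrite /wedge /detform; under eq_bigr => s _ do rewrite opZ scalerA.
rewrite -scaler_suml !scalerA mul_col_mx; congr (_ *: _).
rewrite [RHS]mulrCA [X in _ = _ * X]mulrC -det_shuffle; congr (_ * _).
apply: eq_bigr => s _; congr (_ * (_ * _)); congr (\det _).
- by apply/matrixP => i l; rewrite !mxE; apply: eq_bigr => k _; rewrite !mxE.
- by apply/matrixP => i l; rewrite !mxE; apply: eq_bigr => k _; rewrite !mxE.
Qed.

Definition alpha_row (m : 'I_3) : 'rV[C]_6 := delta_mx 0 (ev m) + 'i *: delta_mx 0 (od m).
Definition alphab_row (m : 'I_3) : 'rV[C]_6 := delta_mx 0 (ev m) - 'i *: delta_mx 0 (od m).

Lemma alpha_coords p (v : 'I_p -> M) m l : (alpha_row m *m coords v) 0 l = alpha a m (v l).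
Proof.
rewrite mulmxDl -scalemxAl -!rowE !mxE /coframe half_ev half_od odd_ev odd_od /alpha.
by rewrite mulrDr; congr (_ + _); rewrite mulrCA.
Qed.

Lemma alphab_coords p (v : 'I_p -> M) m l : (alphab_row m *m coords v) 0 l = alphab a m (v l).
Proof.
rewrite mulmxBl -scalemxAl -!rowE !mxE /coframe half_ev half_od odd_ev odd_od /alphab.
by rewrite mulrBr; congr (_ - _); rewrite mulrCA.
Qed.

End Coframe.

Lemma delta_dot (k l : 'I_6) :
  (delta_mx 0 k : 'rV[C]_6) *m (delta_mx 0 l : 'rV[C]_6)^T = (k == l)%:R%:M.
Proof.
rewrite trmx_delta mul_delta_mx_cond; apply/matrixP => i j; rewrite !ord1 !mxE.
by case: eqP => _; rewrite ?mulr0n ?mulr1n ?mxE.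
Qed.

Lemma tr_alphab_row n : (alphab_row n)^T = (delta_mx 0 (ev n) : 'rV[C]_6)^T - 'i *:
  (delta_mx 0 (od n) : 'rV[C]_6)^T.
Proof. by apply/matrixP => i j; rewrite !mxE. Qed.

(** The (1,0)-forms are isotropic for the C-bilinear extension of the metric,
    and are paired with the (0,1)-forms.  [isotropic_det] evaluates
    determinants with these products. *)
Lemma alpha_dot_alpha m n : alpha_row m *m (alpha_row n)^T = 0.
Proof.
rewrite /alpha_row linearD linearZ /= mulmxDl !mulmxDr -!scalemxAl -!scalemxAr !delta_dot.
rewrite ev_inj od_inj ev_od od_ev scalerA mul_ii scaleN1r !rmorph0 !scaler0 addr0 add0r.
by rewrite addrN.
Qed.

Lemma alphab_dot_alphab m n : alphab_row m *m (alphab_row n)^T = 0.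
Proof.
rewrite tr_alphab_row /alphab_row mulmxBl !mulmxBr -!scalemxAl -!scalemxAr !delta_dot.
rewrite ev_inj od_inj ev_od od_ev scalerA mul_ii scaleN1r !rmorph0 !scaler0 subr0.
by rewrite sub0r opprK addrN.
Qed.

Lemma alpha_dot_alphab m n : alpha_row m *m (alphab_row n)^T = ((m == n)%:R * 2)%:M.
Proof.
rewrite tr_alphab_row /alpha_row mulmxDl !mulmxBr -!scalemxAl -!scalemxAr !delta_dot.
rewrite ev_inj od_inj ev_od od_ev scalerA mul_ii scaleN1r !rmorph0 !scaler0 subr0.
by rewrite sub0r opprK mulr_natr -raddfD mulr2n.
Qed.

Lemma alphab_dot_alpha m n : alphab_row m *m (alpha_row n)^T = ((m == n)%:R * 2)%:M.
Proof. by rewrite -[LHS]trmxK trmx_mul trmxK alpha_dot_alphab tr_scalar_mx eq_sym. Qed.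

End Frames.

(** * The invariant connections *)

Section InvariantConnections.
Variable R : realType.
Notation C := R[i].
Notation M := 'M[C]_3.
Implicit Types (X : M).

(** Up to a factor, [up m] and [lo m] are the m-th (0,1)- and (1,0)-forms; see
    [alphab_up] and [alpha_lo]. *)
Definition up (m : 'I_3) X : C := X (m + 1) (m + 2).
Definition lo (m : 'I_3) X : C := X (m + 2) (m + 1).

Lemma inv_i : ('i : C)^-1 = - 'i.
Proof. by apply: (mulfI (i_neq0 R)); rewrite mulrN mul_ii opprK mulfV ?i_neq0. Qed.

Lemma eta_uplo m X : eta m X = - 'i / 2 * (up m X + lo m X).
Proof. by rewrite /eta invfM inv_i mulrC [2^-1 * _]mulrC. Qed.

Lemma theta_uplo m X : theta m X = (up m X - lo m X) / 2.
Proof. by []. Qed.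

Lemma alpha_lo a m X : alpha a m X = - 'i * (a m)%:C * lo m X.
Proof. by rewrite /alpha eta_uplo theta_uplo; have := two_neq0 R => two; field. Qed.

Lemma alphab_up a m X : alphab a m X = - 'i * (a m)%:C * up m X.
Proof. by rewrite /alphab eta_uplo theta_uplo; have := two_neq0 R => two; field. Qed.

Lemma proj01E X : proj01 X = \sum_m up m X *: delta_mx (m + 1) (m + 2).
Proof.
apply: eq_bigr => m _; rewrite eta_uplo theta_uplo /eta_dual /theta_dual.
apply/matrixP => p q; rewrite !mxE; have := two_neq0 R => two; by field: (mul_ii R).
Qed.

Lemma proj10E X : proj10 X = \sum_m lo m X *: delta_mx (m + 2) (m + 1).
Proof.
apply: eq_bigr => m _; rewrite eta_uplo theta_uplo /eta_dual /theta_dual.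
apply/matrixP => p q; rewrite !mxE; have := two_neq0 R => two; by field: (mul_ii R).
Qed.

Lemma up_proj01 m X : up m (proj01 X) = up m X.
Proof.
rewrite proj01E sum3 /up; move: m.
by apply: I3_ind; rewrite !mxE !add3E !eqE /= ?mulr0 ?mulr1 ?addr0 ?add0r.
Qed.

Lemma lo_proj01 m X : lo m (proj01 X) = 0.
Proof.
rewrite proj01E sum3 /lo; move: m.
by apply: I3_ind; rewrite !mxE !add3E !eqE /= ?mulr0 ?mulr1 ?addr0 ?add0r.
Qed.

Lemma diag_proj01 m X : proj01 X m m = 0.
Proof.
rewrite proj01E sum3; move: m.
by apply: I3_ind; rewrite !mxE !add3E !eqE /= ?mulr0 ?mulr1 ?addr0 ?add0r.
Qed.

Lemma up_proj10 m X : up m (proj10 X) = 0.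
Proof.
rewrite proj10E sum3 /up; move: m.
by apply: I3_ind; rewrite !mxE !add3E !eqE /= ?mulr0 ?mulr1 ?addr0 ?add0r.
Qed.

Lemma lo_proj10 m X : lo m (proj10 X) = lo m X.
Proof.
rewrite proj10E sum3 /lo; move: m.
by apply: I3_ind; rewrite !mxE !add3E !eqE /= ?mulr0 ?mulr1 ?addr0 ?add0r.
Qed.

Lemma diag_proj10 m X : proj10 X m m = 0.
Proof.
rewrite proj10E sum3; move: m.
by apply: I3_ind; rewrite !mxE !add3E !eqE /= ?mulr0 ?mulr1 ?addr0 ?add0r.
Qed.

Lemma lieb_entry X Y p q :
  lieb X Y p q = \sum_r (X p r * Y r q - Y p r * X r q).
Proof. by rewrite !mxE sumrB. Qed.

(** J1, J2, J3 is the standard basis of so(3): [J1, J2] = J3 and its cyclic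
    permutations.  Jp and Jm are eigenvectors of the bracket with J3. *)
Definition J1 : M := delta_mx 2 1 - delta_mx 1 2.
Definition J2 : M := delta_mx 0 2 - delta_mx 2 0.
Definition Jp : M := J1 + 'i *: J2.
Definition Jm : M := J1 - 'i *: J2.

Lemma lieb_J12 : lieb J1 J2 = J3 R.
Proof.
apply/matrixP => p q; rewrite lieb_entry sum3; move: p q.
by do 2!apply: I3_ind; rewrite !mxE !eqE /=; ring.
Qed.

Lemma lieb_J23 : lieb J2 (J3 R) = J1.
Proof.
apply/matrixP => p q; rewrite lieb_entry sum3; move: p q.
by do 2!apply: I3_ind; rewrite !mxE !eqE /=; ring.
Qed.

Lemma lieb_J13 : lieb J1 (J3 R) = - J2.
Proof.
apply/matrixP => p q; rewrite lieb_entry sum3; move: p q.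
by do 2!apply: I3_ind; rewrite !mxE !eqE /=; ring.
Qed.

Lemma lieb_addl X Y Z : lieb (X + Y) Z = lieb X Z + lieb Y Z.
Proof. by rewrite /lieb mulmxDl mulmxDr opprD addrACA. Qed.
Lemma lieb_addr X Y Z : lieb X (Y + Z) = lieb X Y + lieb X Z.
Proof. by rewrite /lieb mulmxDl mulmxDr opprD addrACA. Qed.
Lemma lieb_scalel (c : C) X Y : lieb (c *: X) Y = c *: lieb X Y.
Proof. by rewrite /lieb -scalemxAl -scalemxAr -scalerBr. Qed.
Lemma lieb_scaler (c : C) X Y : lieb X (c *: Y) = c *: lieb X Y.
Proof. by rewrite /lieb -scalemxAl -scalemxAr -scalerBr. Qed.
Lemma lieb_id X : lieb X X = 0. Proof. exact: subrr. Qed.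
Lemma lieb_anti X Y : lieb X Y = - lieb Y X. Proof. by rewrite /lieb opprB. Qed.

(** The canonical connection of the weight (k, l), plus a multiple of the map that
    takes theta_dual j and eta_dual j to J1 and J2 and the rest of the frame to 0. *)
Definition conn (k l : int) (j : 'I_3) (c : C) (X : M) : M :=
  weight_form k l X *: J3 R + c *: (theta j X *: J1 + eta j X *: J2).

Lemma conn_uplo k l j c X : conn k l j c X
  = weight_form k l X *: J3 R + (c / 2) *: (up j X *: Jm - lo j X *: Jp).
Proof.
rewrite /conn /Jp /Jm eta_uplo theta_uplo; move: J1 J2 => P Q.
congr (_ + _); apply/matrixP => p q; rewrite !mxE.
by have := two_neq0 R => two; field: (mul_ii R).
Qed.

Section Connection.
Variables (a : 'I_3 -> R) (k l : int) (j : 'I_3) (c : C).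
Hypothesis a_gt0 : forall m, 0 < a m.

Lemma conn_horizontal X : (forall m, X m m = 0) ->
  conn k l j c X = (c / 2) *: (up j X *: Jm - lo j X *: Jp).
Proof.
by move=> X0; rewrite conn_uplo /weight_form /beta !X0 !mulr0 addr0 scale0r add0r.
Qed.

Lemma lieb_Jp : lieb Jp (J3 R) = 'i *: Jp.
Proof.
rewrite lieb_addl lieb_scalel lieb_J13 lieb_J23 [RHS]scalerDr scalerA mul_ii scaleN1r.
by rewrite addrC.
Qed.

(** Only Jp occurs in the (1,0)-part of the connection. *)
Lemma lieb_proj10 X : lieb (conn k l j c (proj10 X)) (J3 R)
  = (c / (2 * (a j)%:C) * alpha a j X) *: Jp.
Proof.
rewrite conn_horizontal; last by move=> m; rewrite diag_proj10.
rewrite up_proj10 lo_proj10 scale0r sub0r -scaleNr scalerA lieb_scalel lieb_Jp scalerA.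
rewrite alpha_lo; congr (_ *: _).
by have := two_neq0 R; have := aC_neq0 a_gt0 j => aj two; field: (mul_ii R); rewrite aj.
Qed.

(** The connection takes (0,1)-vectors to multiples of Jm, so the bracket of the
    values vanishes.  The bracket of two (0,1)-vectors is of type (1,0), for J^ni
    is as far from integrable as possible; this is the whole of F^(0,2). *)
Lemma curvature_proj01 X Y :
  lieb (conn k l j c (proj01 X)) (conn k l j c (proj01 Y))
    - conn k l j c (lieb (proj01 X) (proj01 Y))
  = (- c / (2 * (a (j + 1))%:C * (a (j + 2))%:C) *
      (alphab a (j + 1) X * alphab a (j + 2) Y
       - alphab a (j + 1) Y * alphab a (j + 2) X)) *: Jp.
Proof.
set X' := proj01 X; set Y' := proj01 Y.
have X0 m : X' m m = 0 by rewrite diag_proj01.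
have Y0 m : Y' m m = 0 by rewrite diag_proj01.
have Xl m : X' (m + 2) (m + 1) = 0 by exact: lo_proj01.
have Yl m : Y' (m + 2) (m + 1) = 0 by exact: lo_proj01.
have [Xu Yu] : (forall m, X' (m + 1) (m + 2) = up m X) /\
               (forall m, Y' (m + 1) (m + 2) = up m Y).
  by split=> m; rewrite -/(up _ _) up_proj01.
rewrite !conn_horizontal //; last first.
  move=> m; rewrite lieb_entry sum3; move: (Xl 0) (Xl 1) (Xl 2) (Yl 0) (Yl 1) (Yl 2).
  rewrite !add3E => x0 x1 x2 y0 y1 y2; move: m.
  by apply: I3_ind; rewrite ?X0 ?Y0 ?x0 ?x1 ?x2 ?y0 ?y1 ?y2; ring.
rewrite ![lo j _]lo_proj01 !scale0r !subr0.
rewrite !lieb_scalel !lieb_scaler lieb_id !scaler0 sub0r.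
have -> : up j (lieb X' Y') = 0.
  rewrite /up lieb_entry sum3; move: (Xl 0) (Xl 1) (Xl 2) (Yl 0) (Yl 1) (Yl 2).
  rewrite !add3E => x0 x1 x2 y0 y1 y2; move: j.
  by apply: I3_ind; rewrite !add3E ?X0 ?Y0 ?x0 ?x1 ?x2 ?y0 ?y1 ?y2; ring.
have -> : lo j (lieb X' Y') = up (j + 1) X * up (j + 2) Y - up (j + 1) Y * up (j + 2) X.
  rewrite -!Xu -!Yu /lo lieb_entry sum3; move: (X0) (Y0) => x0 y0; move: j.
  by apply: I3_ind; rewrite !add3E ?x0 ?y0; ring.
rewrite !alphab_up scale0r sub0r scalerN opprK scalerA; congr (_ *: _).
have := two_neq0 R; have := aC_neq0 a_gt0 (j + 1); have := aC_neq0 a_gt0 (j + 2).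
by move=> aj1 aj2 two; field: (mul_ii R); rewrite aj1 aj2.
Qed.

End Connection.
End InvariantConnections.

(** * The Hodge star in types (0,3) and (1,3) *)

Section TypedStars.
Variable R : realType.
Notation C := R[i].
Notation M := 'M[C]_3.
Implicit Types (X : M).

Lemma mulmx_tr_entry p q n (A : 'M[C]_(p, n)) (B : 'M[C]_(q, n)) i k :
  (A *m B^T) i k = (row i A *m (row k B)^T) 0 0.
Proof. by rewrite !mxE; apply: eq_bigr => l _; rewrite !mxE. Qed.

Definition alpha3 (j : 'I_3) : 'M[C]_(3, 6) := \matrix_(i < 3) alpha_row R (j + i).
Definition alphab3 (j : 'I_3) : 'M[C]_(3, 6) := \matrix_(i < 3) alphab_row R (j + i).

Lemma alpha3_alpha3 j : alpha3 j *m (alpha3 j)^T = 0.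
Proof. by apply/matrixP => i k; rewrite mulmx_tr_entry !rowK alpha_dot_alpha !mxE. Qed.
Lemma alphab3_alphab3 j : alphab3 j *m (alphab3 j)^T = 0.
Proof. by apply/matrixP => i k; rewrite mulmx_tr_entry !rowK alphab_dot_alphab !mxE. Qed.
Lemma alpha3_alphab3 j : alpha3 j *m (alphab3 j)^T = 2%:M.
Proof.
apply/matrixP => i k; rewrite mulmx_tr_entry !rowK alpha_dot_alphab (inj_eq (addrI j)) !mxE.
by rewrite mulr1n; case: eqP; rewrite ?mul1r ?mul0r.
Qed.
Lemma alphab3_alpha3 j : alphab3 j *m (alpha3 j)^T = 2%:M.
Proof. by rewrite -[LHS]trmxK trmx_mul trmxK alpha3_alphab3 tr_scalar_mx. Qed.
Lemma alpha3_alpha_row j m : alpha3 j *m (alpha_row R m)^T = 0.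
Proof.
apply/matrixP => i k; rewrite mulmx_tr_entry rowK.
have -> : row k (alpha_row R m) = alpha_row R m by apply/rowP => l; rewrite !mxE !ord1.
by rewrite alpha_dot_alpha !mxE.
Qed.
Lemma alphab_row_alphab3 j m : alphab_row R m *m (alphab3 j)^T = 0.
Proof.
apply/matrixP => i k; rewrite mulmx_tr_entry rowK.
have -> : row i (alphab_row R m) = alphab_row R m by apply/rowP => l; rewrite !mxE !ord1.
by rewrite alphab_dot_alphab !mxE.
Qed.

(** Multiplied on the left by the rows N1 and N2, which are dual to those of A
    and B, the matrix (A^T, V) becomes block triangular with lower right block
    N2 V. *)
Lemma isotropic_det p q n (e : (p + q)%N = n) (A N1 : 'M[C]_(p, n)) (B N2 : 'M[C]_(q, n)) :
    N1 *m A^T = 2%:M -> N2 *m A^T = 0 -> N1 *m B^T = 0 -> N2 *m B^T = 2%:M ->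
  exists2 r : C, r != 0 & forall V : 'M[C]_(n, q),
    \det (castmx (esym e, erefl) (row_mx A^T V)) = r * \det (N2 *m V).
Proof.
case: n / e A N1 B N2 => A N1 B N2 NA1 NA2 NB1 NB2.
have N0 : \det (col_mx N1 N2) != 0.
  have : col_mx N1 N2 *m row_mx A^T B^T = 2%:M.
    by rewrite mul_col_row NA1 NA2 NB1 NB2 scalar_mx_block.
  move/(congr1 determinant); rewrite det_mulmx det_scalar => NN; apply/eqP => N0.
  by move/eqP: NN; rewrite N0 mul0r eq_sym expf_eq0 (negPf (two_neq0 R)) andbF.
exists (2 ^+ p / \det (col_mx N1 N2)) => [|V].
  by rewrite mulf_neq0 ?invr_eq0 ?expf_neq0 ?two_neq0.
apply: (mulfI N0); rewrite castmx_id -det_mulmx mul_col_row NA1 NA2.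
by rewrite det_ublock det_scalar mulrA mulrCA mulfV ?mulr1.
Qed.

Lemma neq3 (j : 'I_3) : [/\ (j == j + 1) = false, (j == j + 2) = false &
  (j + 1 == j + 2) = false].
Proof. by move: j; apply: I3_ind. Qed.

Lemma col_mx_dot0 p p2 q q2 n (A : 'M[C]_(p, n)) (A' : 'M[C]_(p2, n))
    (B : 'M[C]_(q, n)) (B' : 'M[C]_(q2, n)) :
  A *m B^T = 0 -> A *m B'^T = 0 -> A' *m B^T = 0 -> A' *m B'^T = 0 ->
  col_mx A A' *m (col_mx B B')^T = 0.
Proof. by move=> e1 e2 e3 e4; rewrite tr_col_mx mul_col_row e1 e2 e3 e4 block_mx0. Qed.

Lemma col_mx_dot2 p q n (A : 'M[C]_(p, n)) (A' : 'M[C]_(q, n))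
    (B : 'M[C]_(p, n)) (B' : 'M[C]_(q, n)) :
  A *m B^T = 2%:M -> A *m B'^T = 0 -> A' *m B^T = 0 -> A' *m B'^T = 2%:M ->
  col_mx A A' *m (col_mx B B')^T = 2%:M.
Proof.
by move=> e1 e2 e3 e4; rewrite tr_col_mx mul_col_row e1 e2 e3 e4 scalar_mx_block.
Qed.

Lemma alphab_dot_alpha_neq m n : (m == n) = false -> alphab_row R m *m (alpha_row R n)^T = 0.
Proof. by move=> mn; rewrite alphab_dot_alpha mn mul0r rmorph0. Qed.

Lemma alphab_dot_alpha_eq m : alphab_row R m *m (alpha_row R m)^T = 2%:M.
Proof. by rewrite alphab_dot_alpha eqxx mul1r. Qed.

Section Stars.
Variables (a : 'I_3 -> R) (j : 'I_3).
Hypothesis a_gt0 : forall m, 0 < a m.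

(** Forms of type (0,3) are eigenvectors of the star.  The rows dual to those of
    [alphab3 j] are those of [alpha3 j]. *)
Lemma hodge_030 : exists2 r : C, r != 0 & forall Y : M,
  hodge a (p := 3) (q := 3) (V := M) erefl (detform a (alphab3 j) Y)
  = detform a (alphab3 j) (r *: Y).
Proof.
have [|||//|r r0 rE] := @isotropic_det 3 3 6 erefl (alphab3 j) (alpha3 j) (alpha3 j) (alphab3 j).
- exact: alpha3_alphab3.
- exact: alphab3_alphab3.
- exact: alpha3_alpha3.
- exact: alphab3_alpha3.
exists r => // Y; apply/funext => g; apply/funext => v.
by rewrite hodge_detform // rE /detform scalerA mulrC.
Qed.

(** The star maps the 4-form alpha_j /\ conj(alpha_1 alpha_2 alpha_3) to a multiple of
    the 2-form whose factors are orthogonal to all of alpha_j and the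
    conj(alpha_m). *)
Lemma hodge_130 : exists2 r : C, r != 0 & forall (Y : M) g v,
  hodge a (p := 4) (q := 2) (V := M) erefl
     (detform a (col_mx (alpha_row R j) (alphab3 j)) Y) g v
  = detform a (col_mx (alphab_row R (j + 1)) (alphab_row R (j + 2))) (r *: Y) g v.
Proof.
have [e1 e2 e3] := neq3 j.
have [||||r r0 rE] := @isotropic_det (1 + 3) (1 + 1) 6 erefl
  (col_mx (alpha_row R j) (alphab3 j)) (col_mx (alphab_row R j) (alpha3 j))
  (col_mx (alpha_row R (j + 1)) (alpha_row R (j + 2))) (col_mx (alphab_row R (j + 1))
    (alphab_row R (j + 2))).
- by apply: col_mx_dot2; [exact: alphab_dot_alpha_eq|exact: alphab_row_alphab3|exact:
    alpha3_alpha_row|exact: alpha3_alphab3].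
- by apply: col_mx_dot0; [|exact: alphab_row_alphab3| |exact: alphab_row_alphab3]; apply:
    alphab_dot_alpha_neq; rewrite eq_sym.
- by apply: col_mx_dot0; [| |exact: alpha3_alpha_row|exact: alpha3_alpha_row]; apply:
    alphab_dot_alpha_neq.
- apply: col_mx_dot2; [exact: alphab_dot_alpha_eq| | |exact: alphab_dot_alpha_eq].
    exact: alphab_dot_alpha_neq.
  by apply: alphab_dot_alpha_neq; rewrite eq_sym.
exists r => // Y g v.
by rewrite (@hodge_detform R a a_gt0 _ (1 + 3) (1 + 1)) rE /detform scalerA mulrC.
Qed.

End Stars.

End TypedStars.

(** * Exterior derivatives of left-invariant forms *)

Section InvariantForms.
Variable R : realType.
Notation C := R[i].
Notation M := 'M[C]_3.
Implicit Types (X : M).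

Lemma lieC_cst X (z : C) g : lieC X (fun=> z) g = 0.
Proof.
rewrite /lieC /lieR /derive_C !derive1_cst.
by rewrite -[0 +i* 0]/(0 : C) mulr0 addr0.
Qed.

Lemma lieM_cst X (Y : M) g : lieM X (fun=> Y) g = 0.
Proof. by apply/matrixP => p q; rewrite !mxE lieC_cst. Qed.

Lemma type_part0 n (phi : dform R M n) g v :
  type_part 0 phi g v = phi g (fun i => proj01 (v i)).
Proof.
rewrite /type_part (big_pred1 finset.set0) => [|S]; last by rewrite cards_eq0.
by congr (phi g _); apply/funext => i; rewrite inE.
Qed.

(** The arguments on which the (1, n - 1)-part of a form is evaluated, the i-th being
    the one of type (1,0). *)
Definition mixed n (i : 'I_n) (v : 'I_n -> M) (l : 'I_n) : M :=
  if l == i then proj10 (v l) else proj01 (v l).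

Lemma type_part1 n (phi : dform R M n.+1) g v :
  type_part 1 phi g v = \sum_i phi g (mixed i v).
Proof.
rewrite /type_part (reindex_onto (fun i : 'I_n.+1 => [set i]%SET)
  (fun S => odflt ord0 [pick x in S])) /=.
  apply: eq_big => [i|i _].
    rewrite cards1 eqxx /=; apply/eqP; case: pickP => [x|/(_ i)]; rewrite inE.
      by move/eqP.
    by rewrite eqxx.
  by congr (phi g _); apply/funext => l; rewrite inE.
move=> S /cards1P[x ->]; case: pickP => [y|/(_ x)]; rewrite inE.
  by move/eqP ->.
by rewrite eqxx.
Qed.

(** An invariant form is constant on left-invariant fields, so only the brackets
    remain of Koszul's formula. *)
Lemma dext_invariant n (phi : ('I_n -> M) -> M) g (v : 'I_n.+1 -> M) :
  dext (fun=> phi) g v = - \sum_(i < n.+1) ((-1) ^+ i : C) *: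
    \sum_(j < n.+1 | (i < j)%N)
       phi (fun l => if lift i l == j then lieb (v i) (v j) else v (lift i l)).
Proof.
rewrite /dext -sumrN; apply: eq_bigr => i _.
by rewrite lieM_cst sub0r scalerN.
Qed.

(** The factor 1/2 of the curvature cancels the two shuffles of the wedge product. *)
Lemma curvature_invariant (f : M -> M) g (v : 'I_2 -> M) :
  curvature (fun=> f) g v = lieb (f (v 0)) (f (v 1)) - f (lieb (v 0) (v 1)).
Proof.
rewrite /curvature /wedge.
rewrite -[form1 _]/((fun=> fun w : 'I_1 -> M => f (w 0)) : dform R M 1) dext_invariant.
rewrite (@sum_S2 M) odd_perm1 odd_tperm /= expr0 expr1 scale1r scaleN1r !perm1.
have l0 : lshift 1 (0 : 'I_1) = 0 :> 'I_2 by apply/val_inj.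
have r0 : rshift 1 (0 : 'I_1) = 1 :> 'I_2 by apply/val_inj.
rewrite l0 r0 tpermL tpermR (lieb_anti (f (v 1))) opprK -mulr2n muln1 invr1 scale1r.
rewrite -[X in _ + _ *: X]scaler_nat scalerA mulVf ?two_neq0 // scale1r.
rewrite big_ord_recl big_ord1 /= expr0 scale1r.
rewrite (big_pred1 1) => [|m]; last by have [->|->] := ord2P m.
rewrite [X in _ + _ *: X]big_pred0 => [|m]; last by have [->|->] := ord2P m.
have -> : lift ord0 (0 : 'I_1) = 1 :> 'I_2 by apply/val_inj.
by rewrite eqxx scaler0 addr0 addrC.
Qed.

Section VolumeForm.
Variables (a : 'I_3 -> R) (j : 'I_3).
Hypothesis a_gt0 : forall m, 0 < a m.

Lemma alphab3_coords p (v : 'I_p -> M) i l :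
  (alphab3 R j *m coords a v) i l = alphab a (j + i) (v l).
Proof.
rewrite -alphab_coords // [in RHS]mxE [in LHS]mxE.
by apply: eq_bigr => m _; rewrite !mxE.
Qed.

Lemma det_alphab3_eq0 (v : 'I_3 -> M) l : (forall m, up m (v l) = 0) ->
  \det (alphab3 R j *m coords a v) = 0.
Proof.
move=> vl; rewrite (expand_det_col _ l) big1 // => i _.
by rewrite alphab3_coords alphab_up vl mulr0 mul0r.
Qed.

Lemma det_alphab3_up (v w : 'I_3 -> M) : (forall l m, up m (v l) = up m (w l)) ->
  \det (alphab3 R j *m coords a v) = \det (alphab3 R j *m coords a w).
Proof.
move=> vw; congr (\det _); apply/matrixP => i l.
by rewrite !alphab3_coords !alphab_up vw.
Qed.

(** The bracket of vectors of types (1,0) and (0,1) is diagonal. *)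
Lemma up_lieb_1001 m X Y : up m (lieb (proj10 X) (proj01 Y)) = 0.
Proof.
have [xu xd yl yd] : [/\ forall m, up m (proj10 X) = 0, forall m, proj10 X m m = 0,
    forall m, lo m (proj01 Y) = 0 & forall m, proj01 Y m m = 0].
  by split=> q; [exact: up_proj10|exact: diag_proj10|exact: lo_proj01|exact: diag_proj01].
move: (proj10 X) (proj01 Y) xu xd yl yd => {}X {}Y xu xd yl yd.
rewrite /up lieb_entry sum3; move: (xu 0) (xu 1) (xu 2) (yl 0) (yl 1) (yl 2).
rewrite /up /lo !add3E => x0 x1 x2 y0 y1 y2; move: m.
by apply: I3_ind; rewrite !add3E ?x0 ?x1 ?x2 ?y0 ?y1 ?y2 ?xd ?yd; ring.
Qed.

Lemma up_lieb_0110 m X Y : up m (lieb (proj01 X) (proj10 Y)) = 0.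
Proof.
have := up_lieb_1001 m Y X; rewrite lieb_anti /up mxE => /eqP.
by rewrite oppr_eq0 => /eqP.
Qed.

(** The derivative of conj(alpha_1 alpha_2 alpha_3) has no (1,3)-part: one of the
    three arguments of each term of Koszul's formula is either of type (1,0) or a
    bracket of vectors of types (1,0) and (0,1). *)
Lemma dext_detform_mixed Y g (v : 'I_4 -> M) i :
  dext (detform a (alphab3 R j) Y) g (mixed i v) = 0.
Proof.
rewrite -[detform _ _ _]/(fun _ : M => fun w => \det (alphab3 R j *m coords a w) *: Y).
rewrite dext_invariant big1 ?oppr0 // => p _; rewrite big1 ?scaler0 // => q pq.
suff [l lE] : exists l, forall m, up m (if lift p l == q
    then lieb (mixed i v p) (mixed i v q) else mixed i v (lift p l)) = 0.
  by rewrite (@det_alphab3_eq0 _ l) ?scale0r.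
have [l ql|qp] := unliftP p q; last by rewrite qp ltnn in pq.
rewrite {}ql {pq q}.
have [l' ->|->] := unliftP p i; last first.
  exists l => m; rewrite eqxx /mixed eqxx eq_sym (negPf (neq_lift p l)).
  exact: up_lieb_1001.
have [->|ll'] := eqVneq l' l; [exists l|exists l'] => m; rewrite ?eqxx /mixed.
  rewrite eqxx (negPf (neq_lift p l)); exact: up_lieb_0110.
by rewrite (inj_eq lift_inj) (negPf ll') eqxx up_proj10.
Qed.

(** In the (1,3)-part of [A /\ u] the connection takes the (1,0)-vector, because u
    kills it; by [lieb_proj10] the result is a multiple of
    alpha_j /\ conj(alpha_1 alpha_2 alpha_3) Jp. *)
Lemma wedge_detform_mixed k l c (w : C) g (v : 'I_4 -> M) :
  \sum_i wedge (V3 := M) (@lieb R) (form1 (fun=> conn k l j c))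
     (detform a (alphab3 R j) (w *: J3 R)) g (mixed i v : 'I_(1 + 3) -> M)
  = detform a (col_mx (alpha_row R j) (alphab3 R j))
      ((shuffle_const R 1 3 * (c / (2 * (a j)%:C) * w)) *: Jp R) g v.
Proof.
set z := c / (2 * (a j)%:C) * w.
transitivity (wedge (V3 := M) (fun (x : C^o) (Y : M) => x *: Y)
  (detform a (alpha_row R j) (1 : C^o)) (detform a (alphab3 R j) (z *: Jp R)) g (v : 'I_(1 + 3)
    -> M)); last first.
  rewrite wedge_detform ?scale1r ?scalerA // => x y Y Z.
  by rewrite [x *: Y]/(x * Y) !scalerA mulrAC.
rewrite /wedge -scaler_sumr exchange_big /=; congr (_ *: _).
apply: eq_bigr => s _; rewrite -scaler_sumr; congr (_ *: _).
(* The term in which the connection takes the (1,0)-vector. *)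
rewrite /form1 (bigD1 (s (lshift 3 0))) //= [X in _ + X]big1 ?addr0.
  have dE : \det (alphab3 R j *m coords a (fun l => mixed (s (lshift 3 0)) v (s (rshift 1 l))))
      = \det (alphab3 R j *m coords a (fun l => v (s (rshift 1 l)))).
    apply: det_alphab3_up => p m; rewrite /mixed (inj_eq perm_inj).
    by rewrite eq_rlshift up_proj01.
  rewrite {1}/mixed eqxx /detform det_mx11 alpha_coords dE.
  rewrite scalerA lieb_scaler (@lieb_proj10 _ a) // /z !scalerA.
  congr (_ *: _); rewrite [X in _ = X * _ * _](mulr1 (alpha a j (v (s (lshift 3 0))))).
  by move: (alpha _ _ _) (\det _) => x y; ring.
move=> i si; have [p sp] : exists p, s (rshift 1 p) = i.
  have := permKV s i; case: (split_ordP (s^-1%g i)) => p ->; last by exists p.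
  by rewrite ord1 => si'; rewrite si' eqxx in si.
rewrite /detform (@det_alphab3_eq0 _ p) ?scale0r => [|m].
  by rewrite /lieb mulmx0 mul0mx subr0.
by rewrite /mixed sp eqxx up_proj10.
Qed.

End VolumeForm.
End InvariantForms.

(** * The (0,2)-equation *)

Section FirstEquation.
Variable R : realType.
Notation C := R[i].
Notation M := 'M[C]_3.
Implicit Types (X : M).

Section AntiHolomorphic.
Variables (a : 'I_3 -> R) (j : 'I_3).
Hypothesis a_gt0 : forall m, 0 < a m.

Lemma det_col2 (x y : 'rV[C]_6) (v : 'I_2 -> M) (f h : M -> C) :
    (forall l, (x *m coords a v) 0 l = f (v l)) ->
    (forall l, (y *m coords a v) 0 l = h (v l)) ->
  \det ((col_mx x y : 'M[C]_(1 + 1, 6)) *m coords a v)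
  = f (v 0) * h (v 1) - f (v 1) * h (v 0).
Proof.
rewrite mul_col_mx; move: (x *m _) (y *m _) => p q pf qh.
rewrite (@det2E _ (col_mx p q)).
have E0 l : (col_mx p q : 'M[C]_(1 + 1, 2)) 0 l = p 0 l.
  by rewrite -(col_mxEu p q 0 l); congr (col_mx p q _ l); apply/val_inj.
have E1 l : (col_mx p q : 'M[C]_(1 + 1, 2)) 1 l = q 0 l.
  by rewrite -(col_mxEd p q 0 l); congr (col_mx p q _ l); apply/val_inj.
by rewrite !E0 !E1 !pf !qh.
Qed.

Lemma type_part0_curvature k l c g v :
  type_part 0 (curvature (fun=> conn k l j c)) g v
  = detform a (col_mx (alphab_row R (j + 1)) (alphab_row R (j + 2)))
      ((- c / (2 * (a (j + 1))%:C * (a (j + 2))%:C)) *: Jp R) g v.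
Proof.
rewrite type_part0 curvature_invariant (@curvature_proj01 _ a) //.
rewrite /detform (det_col2 (alphab_coords a v (j + 1)) (alphab_coords a v (j + 2))).
by rewrite scalerA [in RHS]mulrC.
Qed.

(** By [hodge_030], [dext_detform_mixed], [wedge_detform_mixed] and [hodge_130].  The
    constant r depends on the metric but neither on the scale c of the
    connection nor on the scale w of the 3-form. *)
Lemma dbar_adj_conn : exists2 r : C, r != 0 & forall k l c (w : C) g v,
  dbar_adj a (fun=> conn k l j c) (detform a (alphab3 R j) (w *: J3 R)) g v
  = detform a (col_mx (alphab_row R (j + 1)) (alphab_row R (j + 2))) ((r * c * w) *: Jp R) g v.
Proof.
have [r1 r10 h1] := hodge_030 j a_gt0.
have [r2 r20 h2] := hodge_130 j a_gt0.
have aj := aC_neq0 a_gt0 j.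
exists (- (r2 * shuffle_const R 1 3 * r1 / (2 * (a j)%:C))).
  have s0 := shuffle_const_neq0 R 1 3; rewrite oppr_eq0; apply: mulf_neq0.
    by apply: mulf_neq0 => //; exact: mulf_neq0.
  by rewrite invr_eq0; apply: mulf_neq0 => //; exact: two_neq0.
move=> k l c w g v; rewrite /dbar_adj h1.
have -> : type_part 1 (dcov (fun=> conn k l j c) (detform a (alphab3 R j) (r1 *: (w *: J3 R))))
    = detform a (col_mx (alpha_row R j) (alphab3 R j))
        ((shuffle_const R 1 3 * (c / (2 * (a j)%:C) * (r1 * w))) *: Jp R).
  apply/funext => g'; apply/funext => w'.
  rewrite type_part1 big_split /= big1 ?add0r => [|i _]; last exact: dext_detform_mixed.
  by rewrite scalerA wedge_detform_mixed.
rewrite h2 /detform !scalerA -scaleNr; congr (_ *: _); field.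
by rewrite aj.
Qed.

End AntiHolomorphic.
End FirstEquation.

(** * The curvature on horizontal vectors *)

Section HorizontalCurvature.
Variable R : realType.
Notation C := R[i].
Notation M := 'M[C]_3.
Implicit Types (X : M).

Lemma lieb_Jm_Jp : lieb (Jm R) (Jp R) = (2 * 'i) *: J3 R.
Proof.
rewrite -lieb_J12 /Jm /Jp; move: (J1 R) (J2 R) => P Q.
rewrite -scaleNr lieb_addl lieb_scalel !lieb_addr !lieb_scaler !lieb_id.
rewrite (lieb_anti Q) scaler0 addr0 add0r.
by rewrite scalerN scaleNr opprK -scalerDl mulr2n mulrDl mul1r.
Qed.

Lemma lieb_comb2 (P Q : M) (u l u' l' : C) :
  lieb (u *: P - l *: Q) (u' *: P - l' *: Q) = (l * u' - u * l') *: lieb P Q.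
Proof.
rewrite -(scaleNr l Q) -(scaleNr l' Q) lieb_addl !lieb_addr !lieb_scalel !lieb_scaler !lieb_id.
rewrite (lieb_anti Q); move: (lieb P Q) => S.
by apply/matrixP => p q; rewrite !mxE; ring.
Qed.

Section KahlerPart.
Variables (a : 'I_3 -> R) (j : 'I_3).
Hypothesis a_gt0 : forall m, 0 < a m.

(** The summands A_m eta_m /\ A_m theta_m of the Kaehler form. *)
Definition kahler2 (m : 'I_3) (X Y : M) : C :=
  coframe a (ev m) X * coframe a (od m) Y - coframe a (ev m) Y * coframe a (od m) X.

Lemma kahler2_uplo m (X Y : M) : kahler2 m X Y
  = 'i / 2 * (a m)%:C ^+ 2 * (up m X * lo m Y - up m Y * lo m X).
Proof.
rewrite /kahler2 /coframe half_ev half_od odd_ev odd_od !eta_uplo !theta_uplo.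
by have := two_neq0 R => two; field: (mul_ii R).
Qed.

(** The coefficients of the Kaehler summands in the curvature.  The terms in k and l
    come from the differentials of beta_1 and beta_2, the one in c from
    [J1, J2] = J3. *)
Definition curv11 (k l : int) (c : C) (m : 'I_3) : C :=
  (2 * (k%:~R * ((m == 2)%:R - (m == 1)%:R) + l%:~R * ((m == 0)%:R - (m == 2)%:R))
   - c ^+ 2 * (m == j)%:R) / (a m)%:C ^+ 2.

(** [conn] has the components Jm on (0,1)-vectors and Jp on (1,0)-vectors, so the
    bracket of its values is a multiple of J3; the remaining terms are the
    components of the connection on the bracket of the two vectors. *)
Lemma curvature_horizontal k l c (X Y : M) : (forall m, X m m = 0) -> (forall m, Y m m = 0) ->
  lieb (conn k l j c X) (conn k l j c Y) - conn k l j c (lieb X Y)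
  = \sum_m (curv11 k l c m * kahler2 m X Y) *: J3 R
  + (- c / (2 * (a (j + 1))%:C * (a (j + 2))%:C) *
      (alphab a (j + 1) X * alphab a (j + 2) Y
       - alphab a (j + 1) Y * alphab a (j + 2) X)) *: Jp R
  + (- c / (2 * (a (j + 1))%:C * (a (j + 2))%:C) *
      (alpha a (j + 1) X * alpha a (j + 2) Y
       - alpha a (j + 1) Y * alpha a (j + 2) X)) *: Jm R.
Proof.
move=> X0 Y0.
have -> : lieb (conn k l j c X) (conn k l j c Y)
  = (- 'i * c ^+ 2 / 2 * (up j X * lo j Y - up j Y * lo j X)) *: J3 R.
  rewrite !conn_horizontal // lieb_scalel lieb_scaler lieb_comb2 lieb_Jm_Jp !scalerA.
  by congr (_ *: _); have := two_neq0 R => two; field.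
rewrite conn_uplo.
have -> : up j (lieb X Y) = lo (j + 2) X * lo (j + 1) Y - lo (j + 2) Y * lo (j + 1) X.
  rewrite /up /lo lieb_entry sum3; move: j.
  by apply: I3_ind; rewrite !add3E ?X0 ?Y0; ring.
have -> : lo j (lieb X Y) = up (j + 1) X * up (j + 2) Y - up (j + 1) Y * up (j + 2) X.
  rewrite /up /lo lieb_entry sum3; move: j.
  by apply: I3_ind; rewrite !add3E ?X0 ?Y0; ring.
have -> : weight_form k l (lieb X Y) = - \sum_m
    (2 * (k%:~R * ((m == 2)%:R - (m == 1)%:R) + l%:~R * ((m == 0)%:R - (m == 2)%:R))
     * ('i / 2 * (up m X * lo m Y - up m Y * lo m X))).
  rewrite /weight_form /beta !lieb_entry !sum3 /up /lo !add3E !eqE /= ?X0 ?Y0.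
  by have := two_neq0 R => two; field.
have -> : \sum_m (curv11 k l c m * kahler2 m X Y) *: J3 R
  = ((\sum_m (2 * (k%:~R * ((m == 2)%:R - (m == 1)%:R) + l%:~R * ((m == 0)%:R - (m == 2)%:R))
     * ('i / 2 * (up m X * lo m Y - up m Y * lo m X))))
     - 'i * c ^+ 2 / 2 * (up j X * lo j Y - up j Y * lo j X)) *: J3 R.
  rewrite -scaler_suml; congr (_ *: _).
  rewrite (eq_bigr (fun m => 
     (2 * (k%:~R * ((m == 2)%:R - (m == 1)%:R) + l%:~R * ((m == 0)%:R - (m == 2)%:R))
     * ('i / 2 * (up m X * lo m Y - up m Y * lo m X)))
     - (m == j)%:R * ('i * c ^+ 2 / 2 * (up m X * lo m Y - up m Y * lo m X)))); last first.
    move=> m _; rewrite /curv11 kahler2_uplo.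
    move: (m == 0)%:R (m == 1)%:R (m == 2)%:R (m == j)%:R => e0 e1 e2 ej.
    by have := two_neq0 R; have := aC_neq0 a_gt0 m => am two; field; rewrite am.
  rewrite big_split /= sumrN; congr (_ - _); rewrite (bigD1 j) //= eqxx mul1r.
  by rewrite big1 ?addr0 // => m /negPf ->; rewrite mul0r.
move: (\sum_m _) => w; rewrite !alphab_up !alpha_lo.
have ta := two_neq0 R; have a1 := aC_neq0 a_gt0 (j + 1); have a2 := aC_neq0 a_gt0 (j + 2).
move: (J3 R) (Jp R) (Jm R) => P Q S; apply/matrixP => p q; rewrite !mxE.
by field: (mul_ii R); rewrite a1 a2.
Qed.

End KahlerPart.
End HorizontalCurvature.

(** * The contraction of the curvature *)

Section SecondEquation.
Variable R : realType.
Notation C := R[i].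
Notation M := 'M[C]_3.
Implicit Types (X : M).

(** The star of a 6-form, as given by [hodge_detform]. *)
Lemma det_row_mx0 p n (e : (p + 0)%N = n) (e' : p = n) (A : 'M[C]_(p, n)) (V : 'M[C]_(n, 0)) :
  \det (castmx (esym e, erefl) (row_mx A^T V)) = \det (castmx (erefl, esym e') A).
Proof.
case: n / e' e A V => e A V; rewrite castmx_id -[RHS]det_tr.
have cast_det m (d : m = p) (B : 'M[C]_(p, m)) :
    \det (castmx (esym d, erefl) B) = \det (castmx (erefl, d) B).
  by case: p / d {e A V} B => B; rewrite !castmx_id.
rewrite cast_det; congr (\det _); apply/matrixP => i k.
rewrite castmxE cast_ord_id.
have -> : cast_ord (esym e) k = lshift 0 k by apply/val_inj.
by rewrite row_mxEl.
Qed.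

Definition plane_rows (m : 'I_3) : 'M[C]_(1 + 1, 6) := col_mx (delta_mx 0 (ev m))
  (delta_mx 0 (od m)).
(** The row of alpha_m for s = i and that of its conjugate for s = -i. *)
Definition twist (s : C) (m : 'I_3) : 'rV[C]_6 := delta_mx 0 (ev m) + s *: delta_mx 0 (od m).

Lemma alpha_row_twist m : alpha_row R m = twist 'i m. Proof. by []. Qed.
Lemma alphab_row_twist m : alphab_row R m = twist (- 'i) m. Proof. by rewrite /twist scaleNr. Qed.

Lemma row_plane (s : C) m : row_mx 1%:M s%:M *m plane_rows m = twist s m.
Proof. by rewrite mul_row_col mul1mx mul_scalar_mx. Qed.

Lemma row1_neq0 (x : 'rV[C]_1) : row_mx 1%:M x != 0.
Proof.
apply/eqP => /(congr1 lsubmx); rewrite row_mxKl linear0 => /(congr1 (fun A : 'M[C]_1 => A 0 0)).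
by rewrite !mxE => /eqP; rewrite oner_eq0.
Qed.
Lemma row0_neq0 (x : 'rV[C]_1) : row_mx x 1%:M != 0.
Proof.
apply/eqP => /(congr1 rsubmx); rewrite row_mxKr linear0 => /(congr1 (fun A : 'M[C]_1 => A 0 0)).
by rewrite !mxE => /eqP; rewrite oner_eq0.
Qed.

Notation D := (@det3 C (1 + 1) (1 + 1) (1 + 1) 6 erefl).

Lemma det3_plane23 (A : 'M[C]_(1 + 1, 6)) m : D A (plane_rows m) (plane_rows m) = 0.
Proof.
apply: (@det3_eq0 _ _ _ _ _ _ _ _ _ 0 (row_mx 1%:M 0) (- row_mx 1%:M 0)).
  by apply/orP; right; exact: row1_neq0.
by rewrite mul0mx add0r mulNmx subrr.
Qed.

Lemma det3_plane12 (A : 'M[C]_(1 + 1, 6)) m : D (plane_rows m) (plane_rows m) A = 0.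
Proof.
apply: (@det3_eq0 _ _ _ _ _ _ _ _ _ (row_mx 1%:M 0) (- row_mx 1%:M 0) 0).
  by rewrite row1_neq0.
by rewrite mul0mx addr0 mulNmx subrr.
Qed.

(** The 2-form with rows twist s m and twist s n has no component along the square
    of the Kaehler form.  Only p <> q matters; then p or q is m or n, and that
    plane contains one of the two rows. *)
Lemma det3_twist s m n p q : m != n -> D (col_mx (twist s m) (twist s n)) (plane_rows p)
  (plane_rows q) = 0.
Proof.
(* A plane q other than m and n, together with p not in {m, n}, forces p = q. *)
move=> mn; wlog pmn : p q / (p == m) || (p == n).
  move=> H; have [/H//|pmn] := boolP ((p == m) || (p == n)).
  have [/H|qmn] := boolP ((q == m) || (q == n)).
    by move/(_ p) => <-; rewrite det3_swap23.
  suff -> : p = q by exact: det3_plane23.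
  apply/eqP; move: mn pmn qmn.
  by move: m n p q {H}; do 4![apply: I3_ind]; rewrite !eqE.
case/orP: pmn => /eqP ->.
  apply: (@det3_eq0 _ _ _ _ _ _ _ _ _ (row_mx 1%:M 0) (- row_mx 1%:M s%:M) 0).
    by rewrite row1_neq0.
  by rewrite mul_row_col mul1mx !mul0mx !addr0 mulNmx row_plane subrr.
apply: (@det3_eq0 _ _ _ _ _ _ _ _ _ (row_mx 0 1%:M) (- row_mx 1%:M s%:M) 0).
  by rewrite row0_neq0.
by rewrite mul_row_col mul1mx !mul0mx add0r addr0 mulNmx row_plane subrr.
Qed.

Lemma sum_symmetric3 (V : nmodType) (G : 'I_3 -> 'I_3 -> 'I_3 -> V) :
    (forall m p, G m m p = 0) -> (forall m p q, G p m q = G m p q) ->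
    (forall m p q, G m q p = G m p q) ->
  forall m, \sum_p \sum_q G m p q = \sum_p \sum_q G 0 p q.
Proof.
move=> G0 G12 G23; have G0' m p : G m p m = 0 by rewrite G23.
have G0'' m p : G m p p = 0 by rewrite G12.
apply: I3_ind => //; rewrite !sum3 !G0 !G0' !G0'' !(addr0, add0r).
  by rewrite (G23 0 1 2) (G23 1 0 2) (G12 0 1 2).
by rewrite (G23 2 0 1) (G12 0 2 1) (G23 0 1 2).
Qed.

(** The triple product of the Kaehler summands is symmetric and vanishes when an index
    is repeated, so all three have the same product with the square of the Kaehler form. *)
Lemma det3_plane_sum m : \sum_p \sum_q D (plane_rows m) (plane_rows p) (plane_rows q) =
  \sum_p \sum_q D (plane_rows 0) (plane_rows p) (plane_rows q).
Proof.
apply: (@sum_symmetric3 _ (fun m p q => D (plane_rows m) (plane_rows p) (plane_rows q))).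
- by move=> p q; exact: det3_plane12.
- by move=> p q r; exact: det3_swap12.
- by move=> p q r; exact: det3_swap23.
Qed.

Section Contraction.
Variables (a : 'I_3 -> R).
Hypothesis a_gt0 : forall m, 0 < a m.

Lemma wedge_sum (V1 V2 V3 : lmodType C) (op : V1 -> V2 -> V3) (I J : finType)
    (op_sum : forall x y, op (\sum_(i : I) x i) (\sum_(j : J) y j) = \sum_i \sum_j op (x i) (y j))
    p q (phi : I -> dform R V1 p) (psi : J -> dform R V2 q) g v :
  wedge op (fun g v => \sum_i phi i g v) (fun g v => \sum_j psi j g v) g v
  = \sum_i \sum_j wedge op (phi i) (psi j) g v.
Proof.
rewrite /wedge; under eq_bigr => s _ do rewrite op_sum scaler_sumr.
rewrite exchange_big scaler_sumr; apply: eq_bigr => i _ /=.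
under eq_bigr => s _ do rewrite scaler_sumr.
by rewrite exchange_big scaler_sumr.
Qed.

(** The frame vectors are horizontal, so the star of a form depends only on its
    values on horizontal vectors. *)
Lemma hodge_ext (V : lmodType C) p q (pq : (p + q)%N = 6) (phi psi : dform R V p) g v :
  (forall f : {ffun 'I_p -> 'I_6}, phi g (fun l => frame a (f l)) =
    psi g (fun l => frame a (f l))) ->
  hodge a pq phi g v = hodge a pq psi g v.
Proof. by move=> phipsi; congr (_ *: _); apply: eq_bigr => f _; rewrite phipsi. Qed.

Lemma hodge_sum (V : lmodType C) p q (pq : (p + q)%N = 6) (I : finType)
    (phi : I -> dform R V p) g v :
  hodge a pq (fun g v => \sum_i phi i g v) g v = \sum_i hodge a pq (phi i) g v.
Proof.
rewrite /hodge; under eq_bigr => f _ do rewrite scaler_sumr.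
by rewrite exchange_big scaler_sumr.
Qed.

Lemma delta_coords p (v : 'I_p -> M) k l :
  ((delta_mx 0 k : 'rV[C]_6) *m coords a v) 0 l = coframe a k (v l).
Proof. by rewrite -rowE !mxE. Qed.

Lemma det_plane m (v : 'I_2 -> M) : \det (plane_rows m *m coords a v) = kahler2 a m (v 0) (v 1).
Proof.
by rewrite (det_col2 (delta_coords v (ev m)) (delta_coords v (od m))).
Qed.

Lemma omega_det : omega a = fun g v => \sum_m detform a (plane_rows m) (1 : C^o) g v.
Proof.
apply/funext => g; apply/funext => v; rewrite /omega mulr_sumr.
apply: eq_bigr => m _; rewrite /detform det_plane [_ *: _]mulr1 kahler2_uplo.
by rewrite !alpha_lo !alphab_up; have := two_neq0 R => two; field: (mul_ii R).
Qed.

Lemma omega2_det : wedge (V3 := C^o) (fun b c : C => b * c) (omega a) (omega a)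
  = fun g v => \sum_(pq : 'I_3 * 'I_3)
      detform a (col_mx (plane_rows pq.1) (plane_rows pq.2)) (shuffle_const R 2 2 : C^o) g v.
Proof.
apply/funext => g; apply/funext => v; rewrite omega_det wedge_sum; last first.
  by move=> x y; rewrite mulr_suml; apply: eq_bigr => i _; rewrite mulr_sumr.
rewrite pair_big /=; apply: eq_bigr => pq _.
rewrite (@wedge_detform _ _ C^o C^o C^o) => [|x y Y Z]; last by rewrite [LHS]mulrACA.
by congr (_ *: _); rewrite mulr1 [LHS]mulr1.
Qed.

Lemma frame_diag k m : frame a k m m = 0.
Proof.
rewrite /frame; case: ifP => _; rewrite /theta_dual /eta_dual !mxE; move: (half6 k) m;
  by do 2![apply: I3_ind]; rewrite !add3E !eqE /= ?addr0 ?subrr ?mulr0.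
Qed.

(** It is enough to expand F on horizontal vectors, and this is where
    [curvature_horizontal] holds. *)
Lemma Lambda_detforms (F : dform R M 2) (T : finType) (B : T -> 'M[C]_(1 + 1, 6)) (Y : T -> M) g v :
    (forall w : 'I_2 -> M, (forall i m, w i m m = 0) -> F g w = \sum_t detform a (B t) (Y t) g w) ->
  Lambda a F g v = \sum_t \sum_p \sum_q
    D (B t) (plane_rows p) (plane_rows q) *: ((shuffle_const R 2 4 * shuffle_const R 2 2) *: Y t).
Proof.
move=> FE; pose z := shuffle_const R 2 4 * shuffle_const R 2 2.
pose G (tpq : T * ('I_3 * 'I_3)) : dform R M (2 + (2 + 2)) :=
  detform a (col_mx (B tpq.1) (col_mx (plane_rows tpq.2.1) (plane_rows tpq.2.2))) (z *: Y tpq.1).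
transitivity (hodge a (p := 2 + (2 + 2)) (q := 0) (V := M) erefl
    (fun g v => \sum_tpq G tpq g v) g v).
  rewrite /Lambda omega2_det; apply: hodge_ext => f.
  set w := fun l => frame a (f l).
  have w0 i m : w i m m = 0 by exact: frame_diag.
  transitivity (wedge (V3 := M) (fun (Y : M) (c : C) => c *: Y)
    (fun g v => \sum_t detform a (B t) (Y t) g v : M)
    (fun g v => \sum_(pq : 'I_3 * 'I_3)
      detform a (col_mx (plane_rows pq.1) (plane_rows pq.2)) (shuffle_const R 2 2 : C^o) g v) g w).
    congr (_ *: _); apply: eq_bigr => s _; congr (_ *: (_ *: _)).
    by apply: FE => i m; exact: w0.
  rewrite wedge_sum; last first.
    move=> x y; rewrite scaler_sumr; apply: eq_bigr => i _.
    by rewrite scaler_suml.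
  rewrite pair_big; apply: eq_bigr => tpq _.
  rewrite (@wedge_detform _ _ M C^o M); last first.
    by move=> x y P Q; rewrite [y *: Q]/(y * Q) !scalerA [X in X *: _]mulrC mulrA.
  by rewrite /G scalerA.
rewrite hodge_sum.
transitivity (\sum_tpq D (B tpq.1) (plane_rows tpq.2.1) (plane_rows tpq.2.2) *: (z *: Y tpq.1)).
  apply: eq_bigr => tpq _.
  rewrite (hodge_detform a_gt0).
  by rewrite (@det_row_mx0 _ _ _ erefl).
under [RHS]eq_bigr => t _ do rewrite pair_bigA /=.
by rewrite pair_bigA.
Qed.

Section Curvature.
Variables (j : 'I_3) (k l : int) (c : C).

Definition curvature_rows (t : 'I_3 + bool) : 'M[C]_(1 + 1, 6) :=
  match t with
  | inl m => plane_rows m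
  | inr b => if b then col_mx (alphab_row R (j + 1)) (alphab_row R (j + 2))
             else col_mx (alpha_row R (j + 1)) (alpha_row R (j + 2))
  end.
Definition curvature_value (t : 'I_3 + bool) : M :=
  match t with
  | inl m => curv11 a j k l c m *: J3 R
  | inr b => (- c / (2 * (a (j + 1))%:C * (a (j + 2))%:C)) *: (if b then Jp R else Jm R)
  end.

Lemma curvature_detforms g (w : 'I_2 -> M) : (forall i m, w i m m = 0) ->
  curvature (fun=> conn k l j c) g w = \sum_t detform a (curvature_rows t) (curvature_value t) g w.
Proof.
move=> w0; rewrite curvature_invariant (@curvature_horizontal _ a) //.
have hb := det_col2 (alphab_coords a w (j + 1)) (alphab_coords a w (j + 2)).
have ha := det_col2 (alpha_coords a w (j + 1)) (alpha_coords a w (j + 2)).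
rewrite big_sumType big_bool /= /detform addrA hb ha.
move: (J3 R) (Jp R) (Jm R) => P Q S.
congr (_ + _ + _); last first.
- by rewrite scalerA mulrC.
- by rewrite scalerA mulrC.
by apply: eq_bigr => m _; rewrite scalerA mulrC det_plane.
Qed.

(** The (2,0)- and (0,2)-parts drop out by [det3_twist]; the rest is the sum of the
    coefficients of the Kaehler summands. *)
Lemma Lambda_curvature_eq0 g v : \sum_m curv11 a j k l c m = 0 ->
  Lambda a (curvature (fun=> conn k l j c)) g v = 0.
Proof.
move=> c0; rewrite (Lambda_detforms _ (@curvature_detforms g)).
rewrite big_sumType /= [X in _ + X]big1 ?addr0 => [|b _]; last first.
  rewrite big1 // => p _; rewrite big1 // => q _.
  have [_ _ e] := neq3 j.
  by case: b; rewrite ?alpha_row_twist ?alphab_row_twist det3_twist ?scale0r ?e.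
set z := _ * _; set T0 := \sum_p \sum_q D (plane_rows 0) (plane_rows p) (plane_rows q).
rewrite (eq_bigr (fun m => curv11 a j k l c m *: (T0 *: (z *: J3 R)))) => [|m _].
  by rewrite -scaler_suml c0 scale0r.
rewrite /T0 -(det3_plane_sum m).
rewrite scaler_suml scaler_sumr; apply: eq_bigr => p _.
rewrite scaler_suml scaler_sumr; apply: eq_bigr => q _.
rewrite !scalerA.
by congr (_ *: _); rewrite mulrA mulrC mulrA.
Qed.

End Curvature.

End Contraction.
End SecondEquation.

(** * Explicit 3 x 3 matrices; SU(3), its torus and SO(3) *)

Section Mx3.
Variable K : comNzRingType.

(** An explicit matrix, on which sums and products compute entry by entry without
    unfolding the matrix operations. *)
Definition mx3 (a b c d e f g h i : K) : 'M[K]_3 :=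
  \matrix_(p, q) nth 0 (nth [::] [:: [:: a; b; c]; [:: d; e; f]; [:: g; h; i]] p) q.

Lemma mx3_eta (A : 'M[K]_3) : A = mx3 (A 0 0) (A 0 1) (A 0 2)
  (A 1 0) (A 1 1) (A 1 2) (A 2 0) (A 2 1) (A 2 2).
Proof. by apply/matrixP; do 2![apply: I3_ind]; rewrite mxE. Qed.

Variables (a b c d e f g h i a' b' c' d' e' f' g' h' i' : K).
Let A := mx3 a b c d e f g h i.
Let A' := mx3 a' b' c' d' e' f' g' h' i'.

Lemma mx3_add : A + A' = mx3 (a + a') (b + b') (c + c') (d + d') (e + e') (f + f')
  (g + g') (h + h') (i + i').
Proof. by apply/matrixP; do 2![apply: I3_ind]; rewrite !mxE. Qed.

Lemma mx3_opp : - A = mx3 (- a) (- b) (- c) (- d) (- e) (- f) (- g) (- h) (- i).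
Proof. by apply/matrixP; do 2![apply: I3_ind]; rewrite !mxE. Qed.

Lemma mx3_scale z : z *: A = mx3 (z * a) (z * b) (z * c) (z * d) (z * e) (z * f)
  (z * g) (z * h) (z * i).
Proof. by apply/matrixP; do 2![apply: I3_ind]; rewrite !mxE. Qed.

Lemma mx3_tr : A^T = mx3 a d g b e h c f i.
Proof. by apply/matrixP; do 2![apply: I3_ind]; rewrite !mxE. Qed.

Lemma mx3_map (phi : K -> K) : map_mx phi A
  = mx3 (phi a) (phi b) (phi c) (phi d) (phi e) (phi f) (phi g) (phi h) (phi i).
Proof. by apply/matrixP; do 2![apply: I3_ind]; rewrite !mxE. Qed.

Lemma mx3_mul : A *m A' = mx3
  (a * a' + b * d' + c * g') (a * b' + b * e' + c * h') (a * c' + b * f' + c * i')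
  (d * a' + e * d' + f * g') (d * b' + e * e' + f * h') (d * c' + e * f' + f * i')
  (g * a' + h * d' + i * g') (g * b' + h * e' + i * h') (g * c' + h * f' + i * i').
Proof. by apply/matrixP; do 2![apply: I3_ind]; rewrite !mxE sum3 !mxE. Qed.

Lemma mx3_1 : 1%:M = mx3 1 0 0 0 1 0 0 0 1 :> 'M[K]_3.
Proof. by apply/matrixP; do 2![apply: I3_ind]; rewrite !mxE. Qed.

Lemma mx3_delta p q : delta_mx p q = mx3
  ((p == 0) && (q == 0))%:R ((p == 0) && (q == 1))%:R ((p == 0) && (q == 2))%:R
  ((p == 1) && (q == 0))%:R ((p == 1) && (q == 1))%:R ((p == 1) && (q == 2))%:R
  ((p == 2) && (q == 0))%:R ((p == 2) && (q == 1))%:R ((p == 2) && (q == 2))%:R :> 'M[K]_3.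
Proof.
by apply/matrixP; do 2![apply: I3_ind]; rewrite !mxE /= ![_ == p]eq_sym ![_ == q]eq_sym.
Qed.

End Mx3.

Section MatrixGroups.
Variable R : realType.
Notation C := R[i].
Notation M := 'M[C]_3.
Implicit Types (X : M).

Lemma derive_C_cst (z : C) t : derive_C (fun=> z) t = 0.
Proof. by rewrite /derive_C !derive1_cst. Qed.

Lemma smooth_cst U (z : C) : smooth U (fun=> z).
Proof.
have cst : {within (U : set 'M[Cx R]_3), continuous ((fun=> z) : 'M[Cx R]_3 -> Cx R)}.
  by apply: continuous_subspaceT; exact: cst_continuous.
move=> n; elim: n z cst => [|n IH] z cst //=; split => // X _; split => [g _|].
  by split; exact: derivable_cst.
have -> : lieR X (fun=> z) = fun=> 0 by apply/funext => g; rewrite /lieR derive_C_cst.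
by apply: IH; apply: continuous_subspaceT; exact: cst_continuous.
Qed.

Lemma su3E X : su3 X -> forall p q, conjc (X q p) = - X p q.
Proof. by move=> [sX _] p q; move/matrixP: sX => /(_ p q); rewrite !mxE. Qed.

Lemma mulmx3E (A : M) (B : M) p q : (A *m B) p q = A p 0 * B 0 q + A p 1 * B 1 q + A p 2 * B 2 q.
Proof. by rewrite mxE sum3. Qed.

Lemma det3E (A : M) : \det A = A 0 0 * (A 1 1 * A 2 2 - A 1 2 * A 2 1)
  - A 0 1 * (A 1 0 * A 2 2 - A 1 2 * A 2 0) + A 0 2 * (A 1 0 * A 2 1 - A 1 1 * A 2 0).
Proof.
rewrite (expand_det_row _ 0) sum3 /cofactor.
have e01 : lift 0 0 = 1 :> 'I_3 by apply/val_inj.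
have e02 : lift 0 1 = 2 :> 'I_3 by apply/val_inj.
have e10 : lift 1 0 = 0 :> 'I_3 by apply/val_inj.
have e11 : lift 1 1 = 2 :> 'I_3 by apply/val_inj.
have e20 : lift 2 0 = 0 :> 'I_3 by apply/val_inj.
have e21 : lift 2 1 = 1 :> 'I_3 by apply/val_inj.
rewrite !det2E !mxE ?(e01, e02, e10, e11, e20, e21) /= expr0 expr1 sqrrN expr1n.
by ring.
Qed.

Lemma conjc_i : conjc ('i : C) = - 'i.
Proof. by apply/eqP; rewrite eq_complex /= oppr0 !eqxx. Qed.

Lemma conjcM (x y : C) : conjc (x * y) = conjc x * conjc y. Proof. exact: rmorphM. Qed.
Lemma conjcD (x y : C) : conjc (x + y) = conjc x + conjc y. Proof. exact: rmorphD. Qed.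
Lemma conjcN (x : C) : conjc (- x) = - conjc x. Proof. exact: rmorphN. Qed.
Lemma conjcV2 : conjc (2^-1 : C) = 2^-1. Proof. by rewrite conjc_inv conjc_nat. Qed.
Lemma conjcZ (k : int) : conjc (k%:~R : C) = k%:~R. Proof. exact: rmorph_int. Qed.

Lemma J1_real : conjmx (J1 R) = J1 R.
Proof. by apply/matrixP => p q; rewrite !mxE rmorphB !rmorph_nat. Qed.
Lemma J2_real : conjmx (J2 R) = J2 R.
Proof. by apply/matrixP => p q; rewrite !mxE rmorphB !rmorph_nat. Qed.
Lemma J3_real : conjmx (J3 R) = J3 R.
Proof. by apply/matrixP => p q; rewrite !mxE rmorphB !rmorph_nat. Qed.
Lemma J1_tr : (J1 R)^T = - J1 R.
Proof. by rewrite /J1 [LHS]raddfB /= !trmx_delta opprB. Qed.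
Lemma J2_tr : (J2 R)^T = - J2 R.
Proof. by rewrite /J2 [LHS]raddfB /= !trmx_delta opprB. Qed.
Lemma J3_tr : (J3 R)^T = - J3 R.
Proof. by rewrite /J3 [LHS]raddfB /= !trmx_delta opprB. Qed.

Lemma conjmx_add (A B : M) : conjmx (A + B) = conjmx A + conjmx B.
Proof. by apply/matrixP => p q; rewrite !mxE rmorphD. Qed.
Lemma conjmx_scale (z : C) (A : M) : conjmx (z *: A) = conjc z *: conjmx A.
Proof. by apply/matrixP => p q; rewrite !mxE rmorphM. Qed.
Lemma conjmx_mul (A B : M) : conjmx (A *m B) = conjmx A *m conjmx B.
Proof. exact: map_mxM. Qed.
Lemma dagM (A B : M) : dag (A *m B) = dag B *m dag A.
Proof. by rewrite /dag conjmx_mul trmx_mul. Qed.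
Lemma dag1 : dag (1%:M : M) = 1%:M.
Proof. by rewrite /dag /conjmx map_mx1 trmx1. Qed.

Lemma SU3_1 : SU3 (1%:M : M).
Proof. by split; [rewrite dag1 mulmx1|exact: det1]. Qed.

Lemma SU3M (g h : M) : SU3 g -> SU3 h -> SU3 (g *m h).
Proof.
move=> [gg gd] [hh hd]; split; last by rewrite det_mulmx gd hd mul1r.
by rewrite dagM mulmxA -(mulmxA g) hh mulmx1.
Qed.

Lemma SU3_invmx (g : M) : SU3 g -> invmx g = dag g.
Proof.
move=> [gg _]; have [gu _] := mulmx1_unit gg.
by rewrite -[LHS]mulmx1 -gg mulmxA mulVmx // mul1mx.
Qed.

Lemma torus_offdiag (h : M) p q : torus h -> p != q -> h p q = 0.
Proof. by move=> [_ /is_diag_mxP hd]; exact: hd. Qed.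

Lemma torus_norm (h : M) p : torus h -> h p p * conjc (h p p) = 1.
Proof.
move=> th; have [[/matrixP/(_ p p) + _] _] := th; rewrite mxE (bigD1 p) //= big1.
  by rewrite addr0 !mxE eqxx.
by move=> q qp; rewrite torus_offdiag ?mul0r // eq_sym.
Qed.

Lemma torus_conj (h X : M) p q : torus h ->
  (invmx h *m X *m h) p q = conjc (h p p) * X p q * h q q.
Proof.
move=> th; have [sh _] := th; rewrite SU3_invmx //.
rewrite mxE (bigD1 q) //= big1 ?addr0 => [|r rq]; last first.
  by rewrite (torus_offdiag th) ?mulr0.
congr (_ * _); rewrite mxE (bigD1 p) //= big1 ?addr0 => [|r rp]; rewrite !mxE //.
by rewrite (torus_offdiag th rp) rmorph0 mul0r.
Qed.

Lemma torus_det (h : M) : torus h -> h 0 0 * h 1 1 * h 2 2 = 1.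
Proof.
move=> th; have [[_ <-] _] := th; have o := torus_offdiag th.
by rewrite det3E (o 0 1) // (o 0 2) // (o 1 2) // !mul0r !subr0 addr0 mulrA.
Qed.

Lemma su3_diag_real X m : su3 X -> conjc (beta m X) = beta m X.
Proof.
move=> sX; rewrite /beta conjcM.
by rewrite conjcN conjc_i (su3E sX) opprK mulrN mulNr.
Qed.

Lemma su3_up_lo X m : su3 X -> conjc (up m X) = - lo m X.
Proof. by move=> sX; exact: su3E. Qed.
Lemma su3_lo_up X m : su3 X -> conjc (lo m X) = - up m X.
Proof. by move=> sX; exact: su3E. Qed.

Lemma su3_eta_real X m : su3 X -> conjc (eta m X) = eta m X.
Proof.
move=> sX; rewrite eta_uplo !conjcM conjcN conjcD conjc_i su3_up_lo // su3_lo_up //.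
by rewrite conjcV2; ring.
Qed.
Lemma su3_theta_real X m : su3 X -> conjc (theta m X) = theta m X.
Proof.
move=> sX; rewrite theta_uplo !conjcM conjcD conjcN su3_up_lo // su3_lo_up //.
by rewrite conjcV2; ring.
Qed.

Lemma weight_form_real k l X : su3 X -> conjc (weight_form k l X) = weight_form k l X.
Proof.
move=> sX; rewrite /weight_form conjcD (conjcM k%:~R) (conjcM l%:~R) !su3_diag_real //.
by rewrite !conjcZ.
Qed.

Lemma trmx3D (A B : M) : (A + B)^T = A^T + B^T. Proof. exact: raddfD. Qed.
Lemma trmx3Z (z : C) (A : M) : (z *: A)^T = z *: A^T. Proof. exact: linearZ. Qed.

Lemma so3_comb (z1 z2 z3 : C) : conjc z1 = z1 -> conjc z2 = z2 -> conjc z3 = z3 ->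
  so3 (z1 *: J1 R + z2 *: J2 R + z3 *: J3 R).
Proof.
move=> e1 e2 e3; split.
  by rewrite 2!conjmx_add !conjmx_scale J1_real J2_real J3_real e1 e2 e3.
by rewrite 2!trmx3D !trmx3Z J1_tr J2_tr J3_tr !scalerN !opprD.
Qed.

(** [rot] with complex parameters, for which the identities below are polynomial. *)
Definition rotC (x y : C) : M :=
  x *: (delta_mx 0 0 + delta_mx 1 1) + y *: J3 R + delta_mx 2 2.

Lemma rotE (z : C) : rot z = rotC (complex.Re z)%:C (complex.Im z)%:C.
Proof. by []. Qed.

Lemma J1E : J1 R = mx3 0 0 0 0 0 (-1) 0 1 0.
Proof. by rewrite /J1 !mx3_delta mx3_opp mx3_add !eqE /=; congr mx3; ring. Qed.
Lemma J2E : J2 R = mx3 0 0 1 0 0 0 (-1) 0 0.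
Proof. by rewrite /J2 !mx3_delta mx3_opp mx3_add !eqE /=; congr mx3; ring. Qed.
Lemma J3E : J3 R = mx3 0 (-1) 0 1 0 0 0 0 0.
Proof. by rewrite /J3 !mx3_delta mx3_opp mx3_add !eqE /=; congr mx3; ring. Qed.
Lemma rotCE x y : rotC x y = mx3 x (- y) 0 y x 0 0 0 1.
Proof.
rewrite /rotC J3E !mx3_delta !(mx3_add, mx3_scale) !eqE /=.
by congr mx3; ring.
Qed.

Lemma rotC_mul x y x' y' :
  rotC x y *m rotC x' y' = rotC (x * x' - y * y') (x * y' + y * x').
Proof. by rewrite !rotCE mx3_mul; congr mx3; ring. Qed.

Lemma rotC_J3 x y : J3 R *m rotC x y = rotC x y *m J3 R.
Proof. by rewrite rotCE J3E !mx3_mul; congr mx3; ring. Qed.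

(** Jm and Jp are the weight vectors of the rotations about the third axis. *)
Lemma rotC_Jm x y : x ^+ 2 + y ^+ 2 = 1 ->
  Jm R *m rotC x y = rotC x y *m ((x - 'i * y) *: Jm R).
Proof.
move=> /eqP; rewrite eq_sym -subr_eq => /eqP/esym xy; rewrite /Jm rotCE J1E J2E !(mx3_scale,
  mx3_opp, mx3_add, mx3_mul).
by congr mx3; ring: (mul_ii R) xy.
Qed.

Lemma rotC_Jp x y : x ^+ 2 + y ^+ 2 = 1 ->
  Jp R *m rotC x y = rotC x y *m ((x + 'i * y) *: Jp R).
Proof.
move=> /eqP; rewrite eq_sym -subr_eq => /eqP/esym xy; rewrite /Jp rotCE J1E J2E !(mx3_scale,
  mx3_opp, mx3_add, mx3_mul).
by congr mx3; ring: (mul_ii R) xy.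
Qed.
End MatrixGroups.

(** * Equivariance of the invariant connections *)

Section Equivariance.
Variable R : realType.
Notation C := R[i].
Notation M := 'M[C]_3.
Implicit Types (X : M).

Lemma unit_circle (z : C) : z * conjc z = 1 ->
  (complex.Re z)%:C ^+ 2 + (complex.Im z)%:C ^+ 2 = 1 :> C.
Proof.
case: z => x y /eqP; rewrite eq_complex /= => /andP[/eqP xy _].
by rewrite -!rmorphXn -rmorphD /= !expr2 -[X in _ = X](rmorph1 (real_complex R)) -xy mulrN opprK.
Qed.

Lemma complexRI (z : C) : z = (complex.Re z)%:C + 'i * (complex.Im z)%:C.
Proof. exact: complexE. Qed.
Lemma conjcRI (z : C) : conjc z = (complex.Re z)%:C - 'i * (complex.Im z)%:C.
Proof.
by case: z => x y; apply/eqP; rewrite eq_complex /= ?(mul0r, mul1r, mulr0, subr0, add0r, oppr0,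
  addr0, sub0r) !eqxx.
Qed.

Lemma conjc_fixed (z : C) : conjc z = z -> z = (complex.Re z)%:C.
Proof.
case: z => x y /eqP; rewrite eq_complex /= => /andP[_ /eqP yy].
by apply/eqP; rewrite eq_complex /= eqxx /=; lra.
Qed.

Lemma rot_conj (z : C) : z * conjc z = 1 -> rot z *m rot (conjc z) = 1%:M.
Proof.
move=> /unit_circle zz; rewrite !rotE rotC_mul.
have -> : complex.Re (conjc z) = complex.Re z by case: z {zz}.
have -> : complex.Im (conjc z) = - complex.Im z by case: z {zz}.
rewrite rmorphN mulrN opprK -!expr2 zz mulrN addrC mulrC addrN rotCE mx3_1.
by rewrite oppr0.
Qed.

Lemma weight_hom_unit k l (h : M) : torus h ->
  weight_hom k l h * conjc (weight_hom k l h) = 1.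
Proof.
move=> th; rewrite /weight_hom conjcM (fmorphXz (@conjc R)) (fmorphXz (@conjc R)).
by rewrite mulrACA -!expfzMl !torus_norm // !exp1rz mul1r.
Qed.

Lemma etaD m (X Y : M) : eta m (X + Y) = eta m X + eta m Y.
Proof. by rewrite /eta !mxE -mulrDl addrACA. Qed.
Lemma thetaD m (X Y : M) : theta m (X + Y) = theta m X + theta m Y.
Proof. by rewrite /theta !mxE -mulrDl opprD addrACA. Qed.

Lemma conn_linear k l j c (z : C) (X Y : M) :
  conn k l j c (z *: X + Y) = z *: conn k l j c X + conn k l j c Y.
Proof.
rewrite /conn etaD thetaD etaZ thetaZ.
have -> : weight_form k l (z *: X + Y) = z * weight_form k l X + weight_form k l Y.
  by rewrite /weight_form /beta !mxE; ring.
move: (J1 R) (J2 R) (J3 R) => P Q S; apply/matrixP => p q; rewrite !mxE.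
by ring.
Qed.

Lemma conn_so3 k l j (c : R) X : su3 X -> so3 (conn k l j c%:C X).
Proof.
move=> sX; rewrite /conn addrC [X in X + _]scalerDr !scalerA.
apply: so3_comb; last exact: weight_form_real.
- by rewrite conjcM conjc_real su3_theta_real.
- by rewrite conjcM conjc_real su3_eta_real.
Qed.

Lemma conn_diag k l j c X : is_diag_mx X -> conn k l j c X = weight_form k l X *: J3 R.
Proof.
move=> /is_diag_mxP X0; have [_ _ ne] := neq3 j.
have [a0 b0] : X (j + 1) (j + 2) = 0 /\ X (j + 2) (j + 1) = 0.
  by split; apply: X0; rewrite -?(inj_eq val_inj) ?[val (j + 2) == _]eq_sym (inj_eq val_inj) ne.
by rewrite /conn /eta /theta a0 b0 subr0 addr0 !mul0r !scale0r addr0 scaler0 addr0.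
Qed.

(** The root by which T^2 acts on the entry (j+1, j+2) of su(3). *)
Definition root_of (k l : int) (j : 'I_3) := forall h : M, torus h ->
  weight_hom k l h = h (j + 1) (j + 1) * conjc (h (j + 2) (j + 2)).

Lemma rot_J (z : C) : z * conjc z = 1 ->
  [/\ J3 R *m rot z = rot z *m J3 R, Jm R *m rot z = rot z *m (conjc z *: Jm R)
    & Jp R *m rot z = rot z *m (z *: Jp R)].
Proof.
move=> /unit_circle zz; rewrite rotE; split; first exact: rotC_J3.
  by rewrite conjcRI; exact: rotC_Jm.
by rewrite [X in X *: Jp R]complexRI; exact: rotC_Jp.
Qed.

(** Conjugation by h multiplies [up j] and [lo j] by conj(z) and z, with z the value
    of the character at h, and conjugation by the rotation z does the same to their
    coefficients Jm and Jp. *)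
Lemma conn_equivariant k l j c (h X : M) : torus h -> c = 0 \/ root_of k l j ->
  conn k l j c (invmx h *m X *m h)
  = invmx (lambda k l h) *m conn k l j c X *m lambda k l h.
Proof.
move=> th cr; set z := weight_hom k l h; rewrite /lambda -/z.
have zz : z * conjc z = 1 by exact: weight_hom_unit.
have rr := rot_conj zz; have [ru _] := mulmx1_unit rr.
apply: (can_inj (mulKmx ru)); rewrite !mulmxA mulmxV // mul1mx.
have xy := unit_circle zz.
have wE : weight_form k l (invmx h *m X *m h) = weight_form k l X.
  rewrite /weight_form /beta !torus_conj //.
  have hh p : conjc (h p p) * X p p * h p p = X p p.
    by rewrite mulrC mulrA torus_norm // mul1r.
  by rewrite !hh.
have key : c = 0 \/ up j (invmx h *m X *m h) = conjc z * up j X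
    /\ lo j (invmx h *m X *m h) = z * lo j X.
  case: cr => [->|rt]; [by left|right]; rewrite /up /lo !torus_conj // /z rt //.
  by rewrite conjcM conjcK; split; ring.
rewrite !conn_uplo wE; move: (weight_form _ _ _) => w.
have [SE PE QE] := rot_J zz.
have -> : rot z *m (w *: J3 R + (c / 2) *: (up j (invmx h *m X *m h) *: Jm R
    - lo j (invmx h *m X *m h) *: Jp R))
  = w *: (rot z *m J3 R) + (c / 2) *: (up j (invmx h *m X *m h) *: (rot z *m Jm R)
    - lo j (invmx h *m X *m h) *: (rot z *m Jp R)).
  move: (rot z) (J3 R) (Jm R) (Jp R) => T S P Q.
  by rewrite mulmxDr -!scalemxAr mulmxBr -!scalemxAr.
have -> : (w *: J3 R + (c / 2) *: (up j X *: Jm R - lo j X *: Jp R)) *m rot z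
  = w *: (rot z *m J3 R) + (c / 2) *: ((conjc z * up j X) *: (rot z *m Jm R)
     - (z * lo j X) *: (rot z *m Jp R)).
  move: SE PE QE; move: (rot z) (J3 R) (Jm R) (Jp R) => T S P Q SE PE QE.
  rewrite mulmxDl -!scalemxAl mulmxBl -!scalemxAl SE PE QE -!scalemxAr !scalerA.
  by rewrite ![_ * z]mulrC [_ * conjc z]mulrC.
by congr (_ + _); case: key => [->|[-> ->]]; rewrite // mul0r !scale0r.
Qed.

End Equivariance.

(** * The invariant DT-instantons *)

Section Instantons.
Variable R : realType.
Notation C := R[i].
Notation M := 'M[C]_3.
Implicit Types (X : M).

Lemma is_connection_conn k l j (c : R) : c = 0 \/ root_of R k l j ->
  is_connection k l (fun=> conn k l j c%:C).
Proof.
move=> cr; split.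
- by move=> g _ z X Y; exact: conn_linear.
- by move=> g X _ sX; exact: conn_so3.
- by move=> g X _ _ dX; exact: conn_diag.
- move=> g h X _ th _; apply: conn_equivariant => //.
  by case: cr => [->|?]; [left|right].
- by move=> X p q _; exact: smooth_cst.
Qed.

(** The roots r_1, r_2, r_3.  The Kaehler coefficients of their canonical
    connections are 4 / A_j^2 on the plane j, and - 2 / A_m^2 on the other two. *)
Lemma exists_root (j : 'I_3) : exists k l : int, [/\ is_root k l, root_of R k l j
  & forall (a : 'I_3 -> R) c, (forall m, 0 < a m) -> \sum_m curv11 a j k l c m =
      (4 - c ^+ 2) / (a j)%:C ^+ 2 - 2 / (a (j + 1))%:C ^+ 2 - 2 / (a (j + 2))%:C ^+ 2].
Proof.
have norm (h : M) p (th : torus h) := torus_norm p th.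
have inv (h : M) p : torus h -> (h p p)^-1 = conjc (h p p).
  move=> th; have hp : h p p != 0.
    by apply: contra_eq_neq (norm h p th) => ->; rewrite mul0r eq_sym oner_eq0.
  by apply: (mulfI hp); rewrite norm // mulfV.
have inv01 (h : M) : torus h -> h 0 0 * h 1 1 = conjc (h 2 2).
  move=> th; rewrite -[RHS]mul1r -(torus_det th) -!mulrA norm // mulr1.
  by [].
move: j; apply: I3_ind.
- exists 1, 2; split=> // [h th|a c /aC_neq0 ap]; last first.
    by rewrite sum3 /curv11 !add3E /=; field; rewrite !ap.
  rewrite /weight_hom !add3E expr1z -inv01 //.
  by rewrite -exprnP expr2 mulrCA.
- exists (-2), (-1); split=> // [h th|a c /aC_neq0 ap]; last first.
    by rewrite sum3 /curv11 !add3E /=; field; rewrite !ap.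
  rewrite /weight_hom !add3E.
  have -> : h 2 2 = conjc (h 0 0 * h 1 1) by rewrite inv01 // conjcK.
  rewrite conjcM -!inv // exprN1 -exprnN mulrAC.
  by rewrite expr2 invfM.
- exists 1, (-1); split=> // [h th|a c /aC_neq0 ap]; last first.
    by rewrite sum3 /curv11 !add3E /=; field; rewrite !ap.
  rewrite /weight_hom !add3E expr1z.
  by rewrite exprN1 inv.
Qed.

Section UForm.
Variables (a : 'I_3 -> R) (j : 'I_3).
Hypothesis a_gt0 : forall m, 0 < a m.

Lemma alphab_linear m (z : C) (X Y : M) :
  alphab a m (z *: X + Y) = z * alphab a m X + alphab a m Y.
Proof. by rewrite /alphab etaD thetaD etaZ thetaZ; ring. Qed.

Lemma det_alphab3 (v : 'I_3 -> M) :
  \det (alphab3 R j *m coords a v) = \det (\matrix_(l, m) alphab a (j + m) (v l)).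
Proof.
by rewrite -[LHS]det_tr; congr (\det _); apply/matrixP => l m; rewrite mxE alphab3_coords // mxE.
Qed.

Lemma det_alphab3_linear (v : 'I_3 -> M) (w : M) (i : 'I_3) (z : C) :
  \det (alphab3 R j *m coords a (fun l => if l == i then z *: v i + w else v l))
  = z * \det (alphab3 R j *m coords a v)
    + \det (alphab3 R j *m coords a (fun l => if l == i then w else v l)).
Proof.
rewrite !det_alphab3 -[X in _ = _ + X]mul1r.
apply: (@determinant_multilinear _ _ _ _ _ i).
- by apply/rowP => q; rewrite !mxE eqxx mul1r alphab_linear.
- by apply/matrixP => p q; rewrite !mxE eq_sym (negPf (neq_lift i p)).
- by apply/matrixP => p q; rewrite !mxE eq_sym (negPf (neq_lift i p)).
Qed.

Lemma det_alphab3_alternate (v : 'I_3 -> M) (p q : 'I_3) : p != q -> v p = v q ->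
  \det (alphab3 R j *m coords a v) = 0.
Proof.
move=> pq vpq; rewrite det_alphab3; apply: (determinant_alternate pq) => m.
by rewrite !mxE vpq.
Qed.

Lemma up_torus_conj m (h X : M) : torus h ->
  up m (invmx h *m X *m h) = conjc (h (m + 1) (m + 1)) * h (m + 2) (m + 2) * up m X.
Proof. by move=> th; rewrite /up torus_conj // mulrAC. Qed.

(** The three forms are scaled by characters of T^2 whose product is 1. *)
Lemma det_alphab3_torus (v : 'I_3 -> M) (h : M) : torus h ->
  \det (alphab3 R j *m coords a (fun l => invmx h *m v l *m h))
  = \det (alphab3 R j *m coords a v).
Proof.
move=> th; pose s : 'rV[C]_3 := \row_m (conjc (h (j + m + 1) (j + m + 1)) * h (j + m + 2)
  (j + m + 2)).
have -> : alphab3 R j *m coords a (fun l => invmx h *m v l *m h)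
    = diag_mx s *m (alphab3 R j *m coords a v).
  apply/matrixP => m l; rewrite mul_diag_mx [RHS]mxE !alphab3_coords // !mxE.
  by rewrite !alphab_up up_torus_conj // mulrCA.
rewrite det_mulmx det_diag -[RHS]mul1r; congr (_ * _).
rewrite (eq_bigr (fun m => conjc (h (j + m + 1) (j + m + 1)) * h (j + m + 2) (j + m + 2)));
  last by move=> m _; rewrite mxE.
have norm p := torus_norm p th.
rewrite !big_ord_recl big_ord0 mulr1.
have -> : lift ord0 ord0 = 1 :> 'I_3 by apply/val_inj.
have -> : lift ord0 (lift ord0 ord0) = 2 :> 'I_3 by apply/val_inj.
rewrite -[ord0]/(0 : 'I_3); move: (norm 0) (norm 1) (norm 2).
rewrite !addr0; move: j; apply: I3_ind; rewrite !add3E => n0 n1 n2;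
  transitivity ((h 0 0 * conjc (h 0 0)) * (h 1 1 * conjc (h 1 1)) * (h 2 2 * conjc (h 2 2)));
  by [ring|rewrite n0 n1 n2 !mulr1].
Qed.

Definition u_form (w : C) : dform R M 3 := detform a (alphab3 R j) (w *: J3 R).

Lemma is_adj_form_u_form k l (w : C) : is_adj_form k l (u_form w).
Proof.
rewrite /u_form /detform; split.
- split=> [g _ i z v X|g _ p q v pq vpq].
    by rewrite det_alphab3_linear; move: (w *: J3 R) => Y; rewrite scalerDl scalerA.
  by rewrite (det_alphab3_alternate pq vpq) scale0r.
- by move=> g v _; rewrite trmx3Z trmx3Z J3_tr !scalerN.
- move=> g v i _ /is_diag_mxP vi; rewrite (@det_alphab3_eq0 _ a j v i) ?scale0r // => m.
  have [_ _ ne] := neq3 m; apply: vi.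
  by rewrite (inj_eq val_inj) ne.
- move=> g h v _ th; rewrite det_alphab3_torus // /lambda.
  have zz := weight_hom_unit k l th.
  have [ru _] := mulmx1_unit (rot_conj zz); have [JE _ _] := rot_J zz.
  move: (\det _) JE ru => d; move: (J3 R) (rot _) => P T JE ru.
  by rewrite -!scalemxAr -!scalemxAl -mulmxA JE mulKmx.
- by move=> v p q; exact: smooth_cst.
Qed.

Lemma type_part0_u_form w : eq_form (type_part 0 (u_form w)) (u_form w).
Proof.
move=> g v _; rewrite type_part0 /u_form /detform; congr (_ *: _).
by apply: det_alphab3_up => // l m; exact: up_proj01.
Qed.

Lemma bracket_u_form_eq0 w g v :
  hodge a (p := 6) (q := 0) (V := M) erefl
    (wedge (V3 := M) (@lieb R) (u_form w) (conj_form (u_form w))) g v = 0.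
Proof.
rewrite /hodge big1 ?scaler0 // => f _.
rewrite /wedge [X in _ *: (_ *: X)]big1 ?scaler0 // => s _.
rewrite /conj_form /u_form /detform !conjmx_scale J3_real !lieb_scalel !lieb_scaler lieb_id.
by rewrite !scaler0.
Qed.

End UForm.

(** By [type_part0_curvature] and [dbar_adj_conn] the two sides of the
    (0,2)-equation are multiples of the same 2-form, and [bracket_u_form_eq0] makes
    the other equation independent of u. *)
Lemma exists_DT_instanton (a : 'I_3 -> R) (j : 'I_3) (k l : int) (c : R) :
    (forall m, 0 < a m) -> root_of R k l j -> c != 0 ->
    \sum_m curv11 a j k l c%:C m = 0 ->
  exists2 u : dform R M 3, DT_instanton a k l (fun=> conn k l j c%:C) u /\ SU3_invariant_form u
    & ~ eq_form (dbar_adj a (fun=> conn k l j c%:C) u) (fun _ _ => 0).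
Proof.
move=> a_gt0 rt c0 sum0; have [r r0 rE] := dbar_adj_conn j a_gt0.
have a1 := aC_neq0 a_gt0 (j + 1); have a2 := aC_neq0 a_gt0 (j + 2).
(* With this scale the coefficient r * c * w is that of F^(0,2). *)
pose w := - (2 * (a (j + 1))%:C * (a (j + 2))%:C * r)^-1.
have dE g v : dbar_adj a (fun=> conn k l j c%:C) (u_form a j w) g v
    = detform a (col_mx (alphab_row R (j + 1)) (alphab_row R (j + 2)))
       ((- c%:C / (2 * (a (j + 1))%:C * (a (j + 2))%:C)) *: Jp R) g v.
  rewrite rE /detform; congr (_ *: (_ *: _)); rewrite /w.
  by have two := two_neq0 R; field; rewrite r0 a1 a2.
exists (u_form a j w).
  split; last by move=> x g v _ _.
  split; first by apply: is_connection_conn; right.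
  - by split; [exact: is_adj_form_u_form|exact: type_part0_u_form].
  - by move=> g v _; rewrite dE (@type_part0_curvature _ a j).
  - by move=> g v _; rewrite Lambda_curvature_eq0 // bracket_u_form_eq0.
(* Matrix units dual to conj(alpha_(j+1)) and conj(alpha_(j+2)), up to scalars. *)
pose v (i : 'I_2) : M := if i == 0 then delta_mx (j + 2) j else delta_mx j (j + 1).
move=> /(_ 1%:M v (SU3_1 R)); rewrite dE /detform.
rewrite (det_col2 (alphab_coords a v (j + 1)) (alphab_coords a v (j + 2))) !alphab_up /v /=.
have [-> -> ->] : [/\ up (j + 1) (delta_mx (j + 2) j) = 1 :> C,
    up (j + 2) (delta_mx j (j + 1)) = 1 :> C & up (j + 1) (delta_mx j (j + 1)) = 0 :> C].
  rewrite /up !mxE; move: j {rt sum0 rE a1 a2 w dE v}.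
  by apply: I3_ind; rewrite !add3E.
rewrite !mulr1 mulr0 mul0r subr0 scalerA => /eqP; rewrite scaler_eq0; apply/negP.
rewrite negb_or; apply/andP; split.
  have i0 := i_neq0 R; have cC : c%:C != 0 :> C by rewrite eq_complex /= eqxx andbT.
  have two := two_neq0 R; rewrite !mulf_neq0 ?oppr_eq0 ?invr_eq0 //.
  by rewrite !mulf_neq0.
apply/eqP => /matrixP/(_ 2 1); rewrite /Jp J1E J2E mx3_scale mx3_add !mxE /=.
by rewrite mulr0 addr0 => /eqP; rewrite oner_eq0.
Qed.
End Instantons.

(** * Velocities of curves of matrices *)

Section Velocities.
Variable R : realType.
Notation C := R[i].
Notation M := 'M[C]_3.

Lemma normc_realE (x : R) : `|x%:C : C| = `|x|%:C.
Proof. by rewrite normc_def /= expr0n /= addr0 sqrtr_sqr. Qed.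

Lemma normc_le_ReIm (z : C) : `|z| <= (`|complex.Re z| + `|complex.Im z|)%:C.
Proof.
rewrite {1}[z]complexRI (le_trans (ler_normD _ _)) // normrM normCi mul1r.
by rewrite !normc_realE rmorphD.
Qed.

Section Filter.
Context {T : Type} {F : set_system T} {FF : Filter F}.

Lemma cvg_ReIm (f : T -> Cx R) (z : Cx R) :
  (fun t => complex.Re (f t)) @ F --> complex.Re z ->
  (fun t => complex.Im (f t)) @ F --> complex.Im z -> f @ F --> z.
Proof.
move=> fR fI; apply/cvgrPdist_lt => e e0.
have eE : e = (complex.Re e)%:C.
  by move: e0; case: (e) => x y; rewrite ltcE /= => /andP[/eqP -> _].
have e'0 : 0 < complex.Re e / 2.
  by rewrite divr_gt0 //; move: e0; rewrite ltcE => /andP[].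
move/cvgrPdist_lt : fR => /(_ _ e'0) fR; move/cvgrPdist_lt : fI => /(_ _ e'0) fI.
near=> t.
apply: le_lt_trans (normc_le_ReIm _) _; rewrite [ltRHS]eE ltcR [ltRHS]splitr.
by apply: ltrD; [rewrite raddfB; near: t | rewrite raddfB; near: t].
Unshelve. all: by end_near. Qed.

Lemma cvg_Re (f : T -> Cx R) (z : Cx R) :
  f @ F --> z -> (fun t => complex.Re (f t)) @ F --> complex.Re z.
Proof.
move=> /cvgrPdist_lt fz; apply/cvgrPdist_lt => e e0.
have e'0 : 0 < e%:C :> Cx R by rewrite ltcR.
near=> t; rewrite -ltcR; apply: le_lt_trans (_ : `|z - f t| < _); last first.
  by near: t; exact: fz.
by rewrite -raddfB normc_ge_Re.
Unshelve. all: by end_near. Qed.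

Lemma cvg_conjc (f : T -> Cx R) (z : Cx R) :
  f @ F --> z -> (fun t => conjc (f t) : Cx R) @ F --> (conjc z : Cx R).
Proof.
move=> /cvgrPdist_lt fz; apply/cvgrPdist_lt => e e0; near=> t.
have -> : conjc z - conjc (f t) = conjc (z - f t) by rewrite conjcD conjcN.
by rewrite normcJ; near: t; exact: fz.
Unshelve. all: by end_near. Qed.

Lemma cvg_mx (f : T -> 'M[Cx R]_3) (A : 'M[Cx R]_3) :
  (forall p q, (fun t => f t p q) @ F --> A p q) -> f @ F --> A.
Proof.
move=> fA; apply/cvg_ballP => e e0; near=> t; split => //; near: t.
by apply: filter_forall => p; apply: filter_forall => q; exact: cvg_ball.
Unshelve. all: by end_near. Qed.

End Filter.

Definition cderiv (f : R -> C) (t : R) (z : C) :=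
  is_derive t 1 (fun s => complex.Re (f s)) (complex.Re z) /\
  is_derive t 1 (fun s => complex.Im (f s)) (complex.Im z).

Lemma velocityP (c : R -> M) (V : M) :
  velocity c V <-> forall p q, cderiv (fun t => c t p q) 0 (V p q).
Proof.
split=> cV p q; have := cV p q.
  move=> [[dR dI]] /eqP; rewrite /derive_C eq_complex /= !derive1E.
  by move=> /andP[/eqP eR /eqP eI]; split; apply: DeriveDef.
move=> [dR dI]; split; first by split; exact: ex_derive.
apply/eqP; rewrite /derive_C eq_complex /= !derive1E.
by apply/andP; split; apply/eqP; exact: derive_val.
Qed.

Lemma cderiv_cst (z : C) t : cderiv (fun=> z) t 0.
Proof. by split; exact: is_derive_cst. Qed.

Lemma cderivD f g t z w : cderiv f t z -> cderiv g t w -> cderiv (fun s => f s + g s) t (z + w).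
Proof.
move=> [fR fI] [gR gI]; split; rewrite raddfD.
- rewrite (_ : (fun s => _) = (fun s => complex.Re (f s)) + (fun s => complex.Re (g s))).
    exact: is_deriveD.
  by apply/funext => s; rewrite raddfD.
- rewrite (_ : (fun s => _) = (fun s => complex.Im (f s)) + (fun s => complex.Im (g s))).
    exact: is_deriveD.
  by apply/funext => s; rewrite raddfD.
Qed.

Lemma ReD (z w : C) : complex.Re (z + w) = complex.Re z + complex.Re w.
Proof. by case: z w => [x y] [x' y']. Qed.
Lemma ImD (z w : C) : complex.Im (z + w) = complex.Im z + complex.Im w.
Proof. by case: z w => [x y] [x' y']. Qed.
Lemma ReM (z w : C) : complex.Re (z * w) =
  complex.Re z * complex.Re w - complex.Im z * complex.Im w.
Proof. by case: z w => [x y] [x' y']. Qed.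
Lemma ImM (z w : C) : complex.Im (z * w) =
  complex.Re z * complex.Im w + complex.Im z * complex.Re w.
Proof. by case: z w => [x y] [x' y']. Qed.

Lemma cderivM f g t z w : cderiv f t z -> cderiv g t w ->
  cderiv (fun s => f s * g s) t (z * g t + f t * w).
Proof.
move=> [fR fI] [gR gI]; split.
- rewrite (_ : (fun s => _) = (fun s => complex.Re (f s)) * (fun s => complex.Re (g s))
      - (fun s => complex.Im (f s)) * (fun s => complex.Im (g s))); last first.
    by apply/funext => s; rewrite ReM.
  apply: (is_derive_eq (is_deriveB (is_deriveM fR gR) (is_deriveM fI gI))).
  rewrite ReD !ReM /GRing.scale /=.
  move: (complex.Re (f t)) (complex.Im (f t)) (complex.Re (g t)) (complex.Im (g t)).
  by move: (complex.Re z) (complex.Im z) (complex.Re w) (complex.Im w) => *; ring.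
- rewrite (_ : (fun s => _) = (fun s => complex.Re (f s)) * (fun s => complex.Im (g s))
      + (fun s => complex.Im (f s)) * (fun s => complex.Re (g s))); last first.
    by apply/funext => s; rewrite ImM.
  apply: (is_derive_eq (is_deriveD (is_deriveM fR gI) (is_deriveM fI gR))).
  rewrite ImD !ImM /GRing.scale /=.
  move: (complex.Re (f t)) (complex.Im (f t)) (complex.Re (g t)) (complex.Im (g t)).
  by move: (complex.Re z) (complex.Im z) (complex.Re w) (complex.Im w) => *; ring.
Qed.

Lemma cderiv_eq f t z w : cderiv f t z -> z = w -> cderiv f t w.
Proof. by move=> + <-. Qed.

Lemma velocity_cst (A : M) : velocity (fun=> A) 0.
Proof. by apply/velocityP => p q; rewrite mxE; exact: cderiv_cst. Qed.

Lemma velocity_mul (c d : R -> M) V W : velocity c V -> velocity d W ->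
  velocity (fun t => c t *m d t) (V *m d 0 + c 0 *m W).
Proof.
move=> /velocityP cV /velocityP dW; apply/velocityP => p q.
rewrite (_ : (fun t => _) = (fun t => c t p 0 * d t 0 q + c t p 1 * d t 1 q + c t p 2 * d t 2 q)).
  have dd := cderivD (cderivD (cderivM (cV p 0) (dW 0 q)) (cderivM (cV p 1) (dW 1 q)))
    (cderivM (cV p 2) (dW 2 q)).
  by apply: (cderiv_eq dd); rewrite mxE !mulmx3E; ring.
by apply/funext => t; rewrite mulmx3E.
Qed.

Lemma velocity_mull (A : M) (c : R -> M) V : velocity c V -> velocity (fun t => A *m c t) (A *m V).
Proof. by move=> cV; have := velocity_mul (velocity_cst A) cV; rewrite mul0mx add0r. Qed.

Lemma velocity_mulr (A : M) (c : R -> M) V : velocity c V -> velocity (fun t => c t *m A) (V *m A).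
Proof. by move=> cV; have := velocity_mul cV (velocity_cst A); rewrite mulmx0 addr0. Qed.

(** Rodrigues' formula: this is exp(tZ) when Z^3 = - Z.  The one-parameter
    groups of SU(3) and SO(3) used below are of this kind. *)
Definition rodrigues (Z : M) (t : R) : M :=
  1%:M + (sin t)%:C *: Z + (1 - cos t)%:C *: (Z *m Z).

Lemma add_entry (A B : M) p q : (A + B) p q = A p q + B p q.
Proof. by rewrite mxE. Qed.
Lemma scale_entry (z : C) (A : M) p q : (z *: A) p q = z * A p q.
Proof. by rewrite mxE. Qed.
Lemma opp_entry (A : M) p q : (- A) p q = - A p q.
Proof. by rewrite mxE. Qed.
Definition entryE := (add_entry, scale_entry, opp_entry).

Lemma rodriguesD (Z : M) : Z *m Z *m Z = - Z ->
  forall s t, rodrigues Z (s + t) = rodrigues Z s *m rodrigues Z t.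
Proof.
move=> Z3 s t; rewrite /rodrigues sinD cosD.
rewrite !(rmorphB, rmorphD, rmorphM, rmorph1) /=.
move: (sin s)%:C (cos s)%:C (sin t)%:C (cos t)%:C => s1 c1 s2 c2.
rewrite !(mulmxDl, mulmxDr) !mul1mx !mulmx1 -!scalemxAl -!scalemxAr.
have Z3' : Z *m (Z *m Z) = - Z by rewrite mulmxA.
have -> : Z *m Z *m (Z *m Z) = - (Z *m Z) by rewrite mulmxA Z3 mulNmx.
rewrite Z3 Z3'; move: (Z *m Z) (1%:M : M) => Z2 I.
by apply/matrixP => p q; rewrite !entryE; ring.
Qed.

Lemma rodrigues0 Z : rodrigues Z 0 = 1%:M.
Proof. by rewrite /rodrigues sin0 cos0 subrr !scale0r !addr0. Qed.

Lemma velocity_rodrigues (Z : M) (c : R) :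
  velocity (fun t => rodrigues Z (c * t)) (c%:C *: Z).
Proof.
apply/velocityP => p q.
have lin : is_derive (0 : R) 1 (fun t : R => c * t) c.
  rewrite (_ : (fun t => _) = c \*: id); last by apply/funext.
  by apply: is_derive_eq; rewrite /GRing.scale /= mulr1.
have ds : cderiv (fun t => (sin (c * t))%:C) 0 c%:C.
  split; last exact: is_derive_cst.
  have := is_derive1_comp (is_derive_sin (c * 0)) lin.
  by rewrite mulr0 cos0 mul1r.
have dc : cderiv (fun t => (1 - cos (c * t))%:C) 0 0.
  split; last exact: is_derive_cst.
  have /(is_deriveB (is_derive_cst (1 : R) (0 : R) 1)) :=
    is_derive1_comp (is_derive_cos (c * 0)) lin.
  by rewrite mulr0 sin0 oppr0 mul0r subr0.
have dd := cderivD (cderivD (cderiv_cst ((1%:M : M) p q) 0)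
  (cderivM ds (cderiv_cst (Z p q) 0))) (cderivM dc (cderiv_cst ((Z *m Z) p q) 0)).
rewrite (_ : (fun t => _) = (fun t => (1%:M : M) p q + (sin (c * t))%:C * Z p q
    + (1 - cos (c * t))%:C * (Z *m Z) p q)).
  by apply: (cderiv_eq dd); rewrite scale_entry; ring.
by apply/funext => t; rewrite /rodrigues; rewrite !entryE.
Qed.

End Velocities.

(** * Entrywise convergence and the Frobenius norm *)

Section Frobenius.
Variable R : realType.
Notation C := R[i].
Notation M := 'M[C]_3.

(** Convergence of the entries in the topology of R[i]; products and determinants
    converge as polynomials in the entries. *)
Definition ccvg (T : Type) (F : set_system T) (f : T -> M) (A : M) :=
  forall p q, (fun t => f t p q : Cx R) @ F --> (A p q : Cx R).

Section Ccvg.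
Context {T : Type} {F : set_system T} {FF : Filter F}.
Implicit Types (f g : T -> M) (A B : M).

Lemma ccvg_cst A : ccvg F (fun=> A) A. Proof. by move=> p q; exact: cvg_cst. Qed.

Lemma ccvgD f g A B : ccvg F f A -> ccvg F g B -> ccvg F (fun t => f t + g t) (A + B).
Proof.
move=> fA gB p q; rewrite mxE; under eq_fun => t do rewrite mxE.
exact: (cvgD (fA p q) (gB p q)).
Qed.

Lemma ccvgN f A : ccvg F f A -> ccvg F (fun t => - f t) (- A).
Proof.
move=> fA p q; rewrite mxE; under eq_fun => t do rewrite mxE.
exact: (cvgN (fA p q)).
Qed.

Lemma ccvgM f g A B : ccvg F f A -> ccvg F g B -> ccvg F (fun t => f t *m g t) (A *m B).
Proof.
move=> fA gB p q; rewrite mulmx3E; under eq_fun => t do rewrite mulmx3E.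
by apply: cvgD; [apply: cvgD|]; exact: (cvgM (fA _ _) (gB _ _)).
Qed.

Lemma ccvg_conj f A : ccvg F f A -> ccvg F (fun t => conjmx (f t)) (conjmx A).
Proof.
move=> fA p q; rewrite mxE; under eq_fun => t do rewrite mxE.
by apply: cvg_conjc; exact: fA.
Qed.

Lemma ccvg_tr f A : ccvg F f A -> ccvg F (fun t => (f t)^T) A^T.
Proof.
by move=> fA p q; rewrite mxE; under eq_fun => t do rewrite mxE; exact: fA.
Qed.

Lemma ccvg_dag f A : ccvg F f A -> ccvg F (fun t => dag (f t)) (dag A).
Proof. by move=> fA; apply: ccvg_tr; exact: ccvg_conj. Qed.

Lemma ccvg_det f A : ccvg F f A -> (fun t => \det (f t) : Cx R) @ F --> (\det A : Cx R).
Proof.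
move=> fA; rewrite det3E; under eq_fun => t do rewrite det3E.
have m2 p q r s : (fun t => f t p q * f t r s : Cx R) @ F --> (A p q * A r s : Cx R).
  exact: (cvgM (fA _ _) (fA _ _)).
by apply: cvgD; [apply: cvgB|]; apply: (cvgM (fA _ _)); apply: cvgB; exact: m2.
Qed.
End Ccvg.

Definition nrm2 (A : M) : R := complex.Re (\tr (A *m dag A)).

Lemma nrm2E (A : M) : nrm2 A = \sum_p \sum_q (complex.Re (A p q) ^+ 2 + complex.Im (A p q) ^+ 2).
Proof.
rewrite /nrm2 /mxtrace raddf_sum; apply: eq_bigr => p _; rewrite mxE raddf_sum.
apply: eq_bigr => q _; rewrite !mxE; case: (A p q) => x y /=.
by rewrite mulrN opprK !expr2.
Qed.

Lemma nrm2_ge0 (A : M) : 0 <= nrm2 A.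
Proof. by rewrite nrm2E; do 2![apply: sumr_ge0 => ? _]; rewrite addr_ge0 ?sqr_ge0. Qed.

Lemma nrm2_entry (A : M) p q : complex.Re (A p q) ^+ 2 + complex.Im (A p q) ^+ 2 <= nrm2 A.
Proof.
rewrite nrm2E (bigD1 p) //= (bigD1 q) //= -addrA lerDl addr_ge0 //.
  by apply: sumr_ge0 => ? _; rewrite addr_ge0 ?sqr_ge0.
by do 2![apply: sumr_ge0 => ? _]; rewrite addr_ge0 ?sqr_ge0.
Qed.

Lemma nrm2_eq0 (A : M) : nrm2 A = 0 -> A = 0.
Proof.
move=> A0; apply/matrixP => p q; have := nrm2_entry A p q.
rewrite A0 mxE => le0.
have : complex.Re (A p q) ^+ 2 + complex.Im (A p q) ^+ 2 == 0.
  by rewrite eq_le le0 addr_ge0 ?sqr_ge0.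
rewrite paddr_eq0 ?sqr_ge0 // !sqrf_eq0 => z0.
by apply/eqP; rewrite eq_complex.
Qed.

Lemma cvg_nrm2 (T : Type) (F : set_system T) {FF : Filter F} (f : T -> M) A :
  ccvg F f A -> (fun t => nrm2 (f t)) @ F --> nrm2 A.
Proof.
move=> fA; have fd := ccvgM fA (ccvg_dag fA).
apply: cvg_Re; rewrite /mxtrace sum3; under eq_fun => t do rewrite sum3.
by apply: cvgD; [apply: cvgD|]; exact: fd.
Qed.

Lemma velocity_dag (c : R -> M) V : velocity c V -> velocity (fun t => dag (c t)) (dag V).
Proof.
move=> /velocityP cV; apply/velocityP => p q; rewrite !mxE.
rewrite (_ : (fun t => _) = (fun t => conjc (c t q p))); last by apply/funext => t; rewrite !mxE.
have [cR cI] := cV q p; split.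
  rewrite (_ : complex.Re (conjc (V q p)) = complex.Re (V q p)); last by case: (V q p).
  by rewrite (_ : (fun s => _) = (fun s => complex.Re (c s q p))) //; apply/funext => s; case:
    (c s q p).
rewrite (_ : complex.Im (conjc (V q p)) = - complex.Im (V q p)); last by case: (V q p).
rewrite (_ : (fun s => _) = - (fun s => complex.Im (c s q p))); first exact: is_deriveN.
by apply/funext => s; rewrite [RHS]/(- complex.Im (c s q p)); case: (c s q p).
Qed.

Lemma velocityB (c d : R -> M) V W : velocity c V -> velocity d W ->
  velocity (fun t => c t - d t) (V - W).
Proof.
move=> /velocityP cV /velocityP dW; apply/velocityP => p q.
have dd := cderivD (cV p q) (cderivM (cderiv_cst (-1) 0) (dW p q)).
rewrite (_ : (fun t => _) = (fun t => c t p q + -1 * d t p q)).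
  by apply: (cderiv_eq dd); rewrite !mxE; ring.
by apply/funext => t; rewrite !mxE mulN1r.
Qed.

Lemma is_derive_nrm2 (c : R -> M) V : velocity c V ->
  is_derive (0 : R) 1 (fun t => nrm2 (c t))
    (complex.Re (\tr (V *m dag (c 0) + c 0 *m dag V))).
Proof.
move=> cV; have /velocityP cc := velocity_mul cV (velocity_dag cV).
have [dd _] := cderivD (cderivD (cc 0 0) (cc 1 1)) (cc 2 2).
have -> : (fun t => nrm2 (c t)) = (fun s => complex.Re ((c s *m dag (c s)) 0 0
   + (c s *m dag (c s)) 1 1 + (c s *m dag (c s)) 2 2)).
  by apply/funext => t; rewrite /nrm2 /mxtrace sum3.
by rewrite /mxtrace sum3; exact: dd.
Qed.

(** Unitary flows preserve the norm. *)
Lemma derive_nrm2_skewr (d X : M) : dag X = - X ->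
  \tr ((d *m X) *m dag d + d *m dag (d *m X)) = 0.
Proof. by move=> sX; rewrite dagM sX mulNmx mulmxN mulmxA subrr mxtrace0. Qed.

Lemma derive_nrm2_skewl (d Y : M) : dag Y = - Y ->
  \tr ((Y *m d) *m dag d + d *m dag (Y *m d)) = 0.
Proof.
move=> sY; rewrite dagM sY mulmxN mulmxN mulmxA.
by rewrite raddfB /= -mulmxA mxtrace_mulC subrr.
Qed.

End Frobenius.

(** * Compact sets of triples (t, g, x) *)

Section Coordinates.
Variable R : realType.
Notation C := R[i].
Notation M := 'M[C]_3.

(** Indices of the real coordinates of a triple (t, g, x): the time, and for each
    matrix, entry, and real or imaginary part.  In a space of real row vectors
    bounded closed sets are compact. *)
Definition cidx := option ('I_3 * 'I_3 * bool * bool).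
Notation E := 'rV[R]_#|{: cidx}|.

Definition coord (w : E) (k : cidx) : R := w 0 (enum_rank k).
Definition time (w : E) : R := coord w None.
Definition decodeM (b : bool) (w : E) : M :=
  \matrix_(p, q) (coord w (Some (p, q, true, b)) +i* coord w (Some (p, q, false, b))).
Definition encodeM (t : R) (g x : M) : E := \row_i
  match enum_val i with
  | None => t
  | Some (p, q, re, b) =>
      let z := (if b then g else x) p q in if re then complex.Re z else complex.Im z
  end.

Lemma time_encodeM t g x : time (encodeM t g x) = t.
Proof. by rewrite /time /coord mxE enum_rankK. Qed.

Lemma decodeM_encodeM t g x b : decodeM b (encodeM t g x) = if b then g else x.
Proof.
apply/matrixP => p q; rewrite mxE /coord !mxE !enum_rankK.
by case: b; case: (_ p q).
Qed.

Lemma cvg_coord (w : E) k : (fun v => coord v k) @ w --> coord w k.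
Proof. exact: coord_continuous. Qed.

Lemma ccvg_decodeM b (w : E) : ccvg (nbhs w) (decodeM b) (decodeM b w).
Proof.
move=> p q; apply: cvg_ReIm.
  rewrite (_ : (fun t => _) = fun v => coord v (Some (p, q, true, b))); last first.
    by apply/funext => v; rewrite mxE.
  by rewrite mxE; exact: cvg_coord.
rewrite (_ : (fun t => _) = fun v => coord v (Some (p, q, false, b))); last first.
  by apply/funext => v; rewrite mxE.
by rewrite mxE; exact: cvg_coord.
Qed.

(** Closedness in the form in which compactness arguments use it, with filters on
    the space of triples. *)
Definition filter_closed (Q : M -> M -> Prop) :=
  forall (F : set_system E) (FF : ProperFilter F) (f h : E -> M) g x,
    ccvg F f g -> ccvg F h x -> (\forall w \near F, Q (f w) (h w)) -> Q g x.

Lemma unitary_entry (A : M) p q : A *m dag A = 1%:M ->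
  `|complex.Re (A p q)| <= 1 /\ `|complex.Im (A p q)| <= 1.
Proof.
move=> AA; have sum1 : \sum_r (complex.Re (A p r) ^+ 2 + complex.Im (A p r) ^+ 2) = 1.
  move/matrixP: AA => /(_ p p); rewrite !mxE eqxx => /(congr1 (@complex.Re R)) /= <-.
  rewrite raddf_sum; apply: eq_bigr => r _; rewrite !mxE; case: (A p r) => x y /=.
  by rewrite mulrN opprK !expr2.
have le1 : complex.Re (A p q) ^+ 2 + complex.Im (A p q) ^+ 2 <= 1.
  rewrite -sum1 (bigD1 q) //= lerDl; apply: sumr_ge0 => r _.
  by rewrite addr_ge0 ?sqr_ge0.
by split; rewrite -(@ler_pXn2r _ 2) ?nnegrE // expr1n real_normK ?num_real //;
  apply: le_trans le1; rewrite ?lerDl ?lerDr sqr_ge0.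
Qed.

Section Invariance.
Variable Q : M -> M -> Prop.
Hypothesis Q_closed : filter_closed Q.
Hypothesis Q_unitary : forall g x, Q g x -> g *m dag g = 1%:M /\ x *m dag x = 1%:M.

(** Times and points competing in the minimisations of [small_gap] and
    [flow_invariant]. *)
Definition track (T : R) : set E :=
  [set w | 0 <= time w <= T /\ Q (decodeM true w) (decodeM false w)].

Lemma compact_track T : 0 <= T -> compact (track T).
Proof.
move=> T0; pose box := [set v : E | forall i, v ord0 i \in `[- (T + 1), (T + 1)] ].
have cbox : compact box.
  apply: (@rV_compact _ _ (fun=> `[- (T + 1), (T + 1)]%classic)) => _.
  exact: segment_compact.
apply: subclosed_compact cbox _.
  move=> w clw; pose F := within (track T) (nbhs w).
  have FF : ProperFilter F by exact: within_nbhs_proper.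
  have Fw : F --> w by exact: cvg_within.
  have Ftrack : \forall v \near F, track T v by exact: withinT.
  split.
    have : `[0, T]%classic (time w).
      apply: (@closed_cvg _ _ F _ time) => //; first exact: interval_closed.
        by apply: filterS Ftrack => v [tv _]; rewrite /= in_itv.
      by apply: cvg_trans (@cvg_coord w None); exact: cvg_app.
    by rewrite /= in_itv.
  apply: (Q_closed FF (f := decodeM true) (h := decodeM false)).
  - move=> p q; apply: cvg_trans (@ccvg_decodeM true w p q); exact: cvg_app.
  - move=> p q; apply: cvg_trans (@ccvg_decodeM false w p q); exact: cvg_app.
  - by apply: filterS Ftrack => v [].
move=> w [tw Qw] i; have [ug ux] := Q_unitary Qw.
have inbox (r : R) : `|r| <= 1 -> r \in `[- (T + 1), T + 1].
  move=> r1; rewrite in_itv /= -ler_norml (le_trans r1) // lerDr //.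
rewrite -(enum_valK i); case: (enum_val i) => [[[[p q] re] b]|]; last first.
  rewrite -[w _ _]/(time w) in_itv /=; case/andP: tw => t0 tT.
  rewrite (le_trans tT) ?lerDl // andbT (le_trans _ t0) // oppr_le0 addr_ge0 //.
have [] := @unitary_entry (decodeM b w) p q; first by case: (b).
rewrite mxE /= => Re1 Im1; case: re; apply: inbox; [exact: Re1|exact: Im1].
Qed.

End Invariance.
End Coordinates.

(** * Closed sets are invariant under flows tangent to them *)

Section Nagumo.
Variable R : realType.
Notation C := R[i].
Notation M := 'M[C]_3.
Notation E := 'rV[R]_#|{: cidx}|.

Lemma decrease_of_derive (h : R -> R) (d e : R) :
  is_derive (0 : R) 1 h d -> d < 0 -> 0 < e -> exists s, 0 < s < e /\ h s < h 0.
Proof.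
move=> [dh hd] d0 e0.
have : \forall t \near (0 : R)^', t^-1 *: (h (t *: 1 + 0) - h 0) < 0.
  by move: d0; rewrite -hd; exact: cvgr_lt.
rewrite near_withinE => /nbhs_ballP[r /= r0 hr].
have m0 : 0 < Num.min r e by rewrite lt_min r0 e0.
exists (Num.min r e / 2); split.
  rewrite divr_gt0 //= (@lt_le_trans _ _ (Num.min r e)) ?ge_min ?lexx ?orbT //.
  by rewrite ltr_pdivrMr // ltr_pMr // ltr1n.
have s0 : 0 < Num.min r e / 2 by rewrite divr_gt0.
have := hr (Num.min r e / 2); rewrite /ball /= sub0r normrN gtr0_norm // => /(_ _ (lt0r_neq0 s0)).
rewrite [_ *: 1]mulr1 addr0 [_ *: _]/(_ * _) pmulr_rlt0 ?invr_gt0 // subr_lt0; apply.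
rewrite (@lt_le_trans _ _ (Num.min r e)) ?ge_min ?lexx //.
by rewrite ltr_pdivrMr // ltr_pMr // ltr1n.
Qed.

Section Flow.
Variables (Q : M -> M -> Prop) (X Y : M) (U V : R -> M).
Hypothesis Q_closed : filter_closed Q.
Hypothesis Q_unitary : forall g x, Q g x -> g *m dag g = 1%:M /\ x *m dag x = 1%:M.
Hypothesis X_skew : dag X = - X.
Hypothesis Y_skew : dag Y = - Y.
Hypothesis Q_tangent : forall g x, Q g x -> exists c y : R -> M,
  [/\ forall t, Q (c t) (y t), c 0 = g, y 0 = x,
      velocity c (g *m X) & velocity y (Y *m x)].
Hypothesis UD : forall s t, U (s + t) = U s *m U t.
Hypothesis VD : forall s t, V (s + t) = V s *m V t.
Hypothesis U0 : U 0 = 1%:M.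
Hypothesis V0 : V 0 = 1%:M.
Hypothesis Uv : velocity U X.
Hypothesis Vv : velocity V Y.
Hypothesis Uc : forall t : R, ccvg (nbhs t) U (U t).
Hypothesis Vc : forall t : R, ccvg (nbhs t) V (V t).
Variables (g0 x0 : M) (T : R).
Hypothesis Q0 : Q g0 x0.
Hypothesis T0 : 0 <= T.

Definition gap (t : R) (g x : M) : R := nrm2 (g0 *m U t - g) + nrm2 (V t *m x0 - x).

Lemma continuous_gap (f : E -> R) : continuous f ->
  continuous (fun w => gap (f w) (decodeM true w) (decodeM false w)).
Proof.
move=> fc w; have Uf : ccvg (nbhs w) (fun v => U (f v)) (U (f w)).
  by move=> p q; exact: (@cvg_comp _ _ _ f (fun s => U s p q : Cx R) _ _ _ (fc w) (@Uc _ p q)).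
have Vf : ccvg (nbhs w) (fun v => V (f v)) (V (f w)).
  by move=> p q; exact: (@cvg_comp _ _ _ f (fun s => V s p q : Cx R) _ _ _ (fc w) (@Vc _ p q)).
have FF : Filter (nbhs w) by exact: nbhs_filter.
have c1 := @ccvgD _ _ _ FF _ _ _ _ (@ccvgM _ _ _ FF _ _ _ _ (@ccvg_cst _ _ _ FF g0) Uf)
  (@ccvgN _ _ _ FF _ _ (@ccvg_decodeM _ true w)).
have c2 := @ccvgD _ _ _ FF _ _ _ _ (@ccvgM _ _ _ FF _ _ _ _ Vf (@ccvg_cst _ _ _ FF x0))
  (@ccvgN _ _ _ FF _ _ (@ccvg_decodeM _ false w)).
have n1 := @cvg_nrm2 _ _ _ FF _ _ c1; have n2 := @cvg_nrm2 _ _ _ FF _ _ c2.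
exact: (@cvgD _ _ _ _ FF _ _ _ _ n1 n2).
Qed.

Lemma continuous_time : continuous (@time R).
Proof. by move=> w; exact: cvg_coord. Qed.

(** A curve tangent to the vector field and the flow itself differ, to first order,
    by a motion by the flow, which is an isometry since X and Y are skew. *)
Lemma derive_gap (t : R) g x (c y : R -> M) : c 0 = g -> y 0 = x ->
  velocity c (g *m X) -> velocity y (Y *m x) ->
  is_derive (0 : R) 1 (fun s => gap (t + s) (c s) (y s)) 0.
Proof.
move=> c0 y0 cv yv.
have v1 : velocity (fun s => g0 *m U (t + s) - c s) ((g0 *m U t - g) *m X).
  rewrite mulmxBl; apply: velocityB cv.
  rewrite (_ : (fun s => _) = fun s => (g0 *m U t) *m U s); last first.
    by apply/funext => s; rewrite UD mulmxA.
  exact: velocity_mull.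
have v2 : velocity (fun s => V (t + s) *m x0 - y s) (Y *m (V t *m x0 - x)).
  rewrite mulmxBr; apply: velocityB yv.
  rewrite (_ : (fun s => _) = fun s => V s *m (V t *m x0)); last first.
    by apply/funext => s; rewrite addrC VD mulmxA.
  exact: velocity_mulr.
have := is_deriveD (is_derive_nrm2 v1) (is_derive_nrm2 v2).
by rewrite addr0 c0 y0 derive_nrm2_skewr // derive_nrm2_skewl // addr0.
Qed.

(** Minimise the gap plus the penalty mu (T - t) over the times t and the points of
    Q.  If t < T at the minimum, then following for a short while the curve in Q
    that is tangent to the vector field lowers the penalty at unit rate and keeps
    the gap to first order.  So t = T there, and the minimum is at most the value
    mu T at the initial point. *)
Lemma small_gap (mu : R) : 0 < mu ->
  exists g x, Q g x /\ gap T g x <= mu * T.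
Proof.
move=> mu0; pose psi w := gap (time w) (decodeM true w) (decodeM false w) + mu * (T - time w).
have start : track Q T (encodeM 0 g0 x0).
  by split; rewrite ?time_encodeM ?decodeM_encodeM ?lexx.
have psi_c : continuous psi.
  move=> w; have FF : Filter (nbhs w) by exact: nbhs_filter.
  have g1 := @continuous_gap (@time R) continuous_time w.
  have g2 : (fun v => mu * (T - time v)) @ w --> mu * (T - time w).
    apply: cvgMr; apply: cvgB; first exact: cvg_cst.
    exact: continuous_time.
  exact: (@cvgD _ _ _ _ FF _ _ _ _ g1 g2).
have [w wS wmin] := compact_EVT_min (ex_intro _ _ start) (compact_track Q_closed Q_unitary T0)
  (continuous_subspaceT psi_c).
rewrite inE in wS; case: (wS) => /andP[t0 tT] Qw.
have [tE|tlt] := eqVneq (time w) T.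
  exists (decodeM true w), (decodeM false w); split=> //.
  have := wmin _ (mem_set start); rewrite /psi tE subrr mulr0 addr0 => /le_trans; apply.
  rewrite !decodeM_encodeM time_encodeM subr0 /gap U0 V0 mulmx1 mul1mx !subrr.
  by rewrite /nrm2 !mul0mx mxtrace0 !add0r.
(* The minimum is attained at a time before T: follow the tangent curve. *)
have {}tT : time w < T by rewrite lt_neqAle tlt.
have [c [y [Qcy c0 y0 cv yv]]] := Q_tangent Qw.
pose h s := gap (time w + s) (c s) (y s) + mu * (T - (time w + s)).
have dh : is_derive (0 : R) 1 h (- mu).
  have d1 := derive_gap (time w) c0 y0 cv yv.
  have d2 : is_derive (0 : R) 1 (fun s : R => mu * (T - (time w + s))) (- mu).
    rewrite (_ : (fun s => _) = cst (mu * (T - time w)) - mu \*: id); last first.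
      by apply/funext => s; transitivity (mu * (T - time w) - mu * s); [ring|].
    by apply: is_derive_eq; rewrite /GRing.scale /= mulr1 sub0r.
  by have := is_deriveD d1 d2; rewrite add0r.
have [s [/andP[s0 sT] hs]] := decrease_of_derive dh (etrans (oppr_lt0 mu) mu0)
  (etrans (subr_gt0 _ _) tT).
have ws : track Q T (encodeM (time w + s) (c s) (y s)).
  split; last by rewrite !decodeM_encodeM.
  rewrite time_encodeM; apply/andP; split; first by rewrite addr_ge0 // ltW.
  by rewrite -lerBrDl ltW.
have := wmin _ (mem_set ws); rewrite /psi !decodeM_encodeM time_encodeM.
by rewrite leNgt; move: hs; rewrite /h addr0 c0 y0 => ->.
Qed.

(** Nagumo's theorem for the vector field (g X, Y x): a closed set to which it is
    tangent at each point contains its integral curves.  By [small_gap] the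
    distance of the integral curve to Q is 0 at time T, and it is attained. *)
Lemma flow_invariant : Q (g0 *m U T) (V T *m x0).
Proof.
have start : track Q T (encodeM 0 g0 x0).
  by split; rewrite ?time_encodeM ?decodeM_encodeM ?lexx.
have [w wS wmin] := compact_EVT_min (ex_intro _ _ start) (compact_track Q_closed Q_unitary T0)
  (continuous_subspaceT (continuous_gap (fun w => @cst_continuous _ _ T _))).
rewrite inE in wS; case: wS => tw Qw; set m := gap _ _ _ in wmin.
have [m0|m_gt0] := leP m 0.
  have : (nrm2 (g0 *m U T - decodeM true w) == 0) && (nrm2 (V T *m x0 - decodeM false w) == 0).
    by rewrite -paddr_eq0 ?nrm2_ge0 // eq_le m0 addr_ge0 ?nrm2_ge0.
  case/andP=> /eqP/nrm2_eq0/eqP + /eqP/nrm2_eq0/eqP.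
  by rewrite !subr_eq0 => /eqP -> /eqP ->.
have [|g [x [Qgx]]] := @small_gap (m / (T + 1)).
  by rewrite divr_gt0 // ltr_pwDr.
move=> small; have stop : track Q T (encodeM T g x).
  by split; rewrite ?time_encodeM ?decodeM_encodeM ?T0 ?lexx.
have := wmin _ (mem_set stop); rewrite !decodeM_encodeM => mgap.
have := le_trans mgap small; rewrite leNgt; case/negP.
by rewrite mulrAC ltr_pdivrMr ?ltr_pwDr // ltr_pM2l // ltrDl.
Qed.

End Flow.
End Nagumo.

(** * Euler angles *)

Section Rotations.
Variable R : realType.
Notation C := R[i].
Notation M := 'M[C]_3.

Lemma circle_param (x y : R) : x ^+ 2 + y ^+ 2 = 1 -> exists t, x = cos t /\ y = sin t.
Proof.
move=> xy; have x1 : -1 <= x <= 1.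
  rewrite -ler_norml -(@ler_pXn2r _ 2) ?nnegrE // expr1n real_normK ?num_real //.
  by rewrite -xy lerDl sqr_ge0.
have yE : Num.sqrt (1 - x ^+ 2) = `|y| by rewrite -xy addrC addKr sqrtr_sqr.
have [y0|y0] := leP 0 y.
  exists (acos x); rewrite acosK ?in_itv //; split => //.
  by rewrite sin_acos // yE ger0_norm.
exists (- acos x); rewrite cosN sinN acosK ?in_itv //; split => //.
by rewrite sin_acos // yE ltr0_norm // opprK.
Qed.

Lemma polar (x y : R) : exists r t, x = r * cos t /\ y = r * sin t.
Proof.
have [xy0|xy0] := eqVneq (x ^+ 2 + y ^+ 2) 0.
  exists 0, 0; move/eqP: xy0; rewrite paddr_eq0 ?sqr_ge0 // !sqrf_eq0 !mul0r.
  by move=> /andP[/eqP -> /eqP ->].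
have r0 : 0 < Num.sqrt (x ^+ 2 + y ^+ 2).
  by rewrite sqrtr_gt0 lt_neqAle eq_sym xy0 addr_ge0 ?sqr_ge0.
set r := Num.sqrt _ in r0; have rr : r ^+ 2 = x ^+ 2 + y ^+ 2.
  by rewrite sqr_sqrtr // addr_ge0 ?sqr_ge0.
have [|t [xt yt]] := @circle_param (x / r) (y / r).
  by rewrite !expr_div_n -mulrDl -rr mulfV // expf_neq0 // gt_eqF.
by exists r, t; rewrite -xt -yt ![r * _]mulrC !divfK ?gt_eqF.
Qed.

Lemma rodrigues_J1 t : rodrigues (J1 R) t = mx3 1 0 0 0 (cos t)%:C (- (sin t)%:C)
  0 (sin t)%:C (cos t)%:C.
Proof.
rewrite /rodrigues J1E mx3_1 !(mx3_mul, mx3_scale, mx3_add) rmorphB rmorph1 /=.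
by move: (sin t)%:C (cos t)%:C => s c; congr mx3; ring.
Qed.

Lemma rodrigues_J2 t : rodrigues (J2 R) t = mx3 (cos t)%:C 0 (sin t)%:C 0 1 0 (- (sin t)%:C)
  0 (cos t)%:C.
Proof.
rewrite /rodrigues J2E mx3_1 !(mx3_mul, mx3_scale, mx3_add) rmorphB rmorph1 /=.
by move: (sin t)%:C (cos t)%:C => s c; congr mx3; ring.
Qed.

Lemma rodrigues_J3 t : rodrigues (J3 R) t = mx3 (cos t)%:C (- (sin t)%:C)
  0 (sin t)%:C (cos t)%:C 0 0 0 1.
Proof.
rewrite /rodrigues J3E mx3_1 !(mx3_mul, mx3_scale, mx3_add) rmorphB rmorph1 /=.
by move: (sin t)%:C (cos t)%:C => s c; congr mx3; ring.
Qed.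

Lemma J1_cube : J1 R *m J1 R *m J1 R = - J1 R.
Proof. by rewrite J1E !mx3_mul mx3_opp; congr mx3; ring. Qed.
Lemma J2_cube : J2 R *m J2 R *m J2 R = - J2 R.
Proof. by rewrite J2E !mx3_mul mx3_opp; congr mx3; ring. Qed.
Lemma sincos2C (t : R) : (sin t)%:C * (sin t)%:C = 1 - (cos t)%:C * (cos t)%:C :> C.
Proof. by rewrite -!rmorphM -[1](rmorph1 (real_complex R)) -rmorphB -!expr2 sin2cos2. Qed.

Lemma SO3_unitary (k : M) : SO3 k -> k *m dag k = 1%:M.
Proof. by move=> [kr kk _]; rewrite /dag kr. Qed.

Lemma SO3_invmx (k : M) : SO3 k -> invmx k = k^T.
Proof.
move=> [_ kk _]; have [ku _] := mulmx1_unit kk.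
by rewrite -[LHS]mulmx1 -kk mulmxA mulVmx // mul1mx.
Qed.

Lemma SO3M (k h : M) : SO3 k -> SO3 h -> SO3 (k *m h).
Proof.
move=> [kr kk kd] [hr hh hd]; split.
- by rewrite conjmx_mul kr hr.
- by rewrite trmx_mul mulmxA -(mulmxA k) hh mulmx1.
- by rewrite det_mulmx kd hd mul1r.
Qed.

Lemma SO3_tr (k : M) : SO3 k -> SO3 k^T.
Proof.
move=> [kr kk kd]; split; last by rewrite det_tr.
  by apply/matrixP => p q; move/matrixP: kr => /(_ q p); rewrite !mxE.
by rewrite trmxK; apply: mulmx1C.
Qed.

Lemma SO3_rodrigues (Z : M) t : Z = J1 R \/ Z = J2 R -> SO3 (rodrigues Z t).
Proof.
have sc := sincos2C t; have sr := conjc_real (sin t); have cr := conjc_real (cos t).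
case=> ->; rewrite ?rodrigues_J1 ?rodrigues_J2; move:
  (sin t)%:C (cos t)%:C sc sr cr => s c sc sr cr; split.
- by rewrite /conjmx mx3_map ?conjcN ?sr ?cr ?conjc0 ?conjc1.
- by rewrite mx3_tr mx3_mul mx3_1; congr mx3; ring: sc.
- by rewrite det3E !mxE /=; ring: sc.
- by rewrite /conjmx mx3_map ?conjcN ?sr ?cr ?conjc0 ?conjc1.
- by rewrite mx3_tr mx3_mul mx3_1; congr mx3; ring: sc.
- by rewrite det3E !mxE /=; ring: sc.
Qed.

Lemma SO3_entry (k : M) p q : SO3 k -> k p q = (complex.Re (k p q))%:C.
Proof. by move=> [/matrixP/(_ p q) kr _ _]; apply: conjc_fixed; rewrite mxE in kr. Qed.

(** Two rotations, about the first and the second axis, bring the first column of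
    the matrix to the first basis vector; what is left is a rotation about the
    first axis. *)
Lemma SO3_euler (G : M -> Prop) : (forall k h, G k -> G h -> G (k *m h)) ->
  (forall t, G (rodrigues (J1 R) t)) -> (forall t, G (rodrigues (J2 R) t)) ->
  forall k, SO3 k -> G k.
Proof.
move=> GM G1 G2.
have cancel Z t (k : M) : Z *m Z *m Z = - Z -> G (rodrigues Z (- t)) ->
    G (rodrigues Z t *m k) -> G k.
  move=> Z3 Gt Gk; have := GM _ _ Gt Gk.
  by rewrite mulmxA -rodriguesD // addNr rodrigues0 mul1mx.
move=> k sk.
(* A rotation about the first axis clears the entry (1, 0). *)
have [r [t [u v]]] := polar (complex.Re (k 2 0)) (complex.Re (k 1 0)).
apply: (cancel (J1 R) t) => //; first exact: J1_cube.
have s1 : SO3 (rodrigues (J1 R) t *m k) by apply: SO3M => //; apply: SO3_rodrigues; left.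
have e10 : (rodrigues (J1 R) t *m k) 1 0 = 0.
  rewrite mulmx3E rodrigues_J1 !mxE /= (@SO3_entry k 1 0) // (@SO3_entry k 2 0) // u v.
  by rewrite !rmorphM /=; ring.
move: (rodrigues _ t *m k) s1 e10 => {sk u v}k sk k10 {r t}.
have orth (h : M) p q : SO3 h ->
    h 0 p * h 0 q + h 1 p * h 1 q + h 2 p * h 2 q = (p == q)%:R.
  move=> sh; have [_ /mulmx1C hh _] := sh.
  by move/matrixP: hh => /(_ p q); rewrite mulmx3E !mxE.
(* One about the second axis clears the entry (2, 0). *)
have [t [u v]] : exists t, complex.Re (k 0 0) = cos t /\ complex.Re (k 2 0) = sin t.
  apply: circle_param; have := orth k 0 0 sk; rewrite k10 (@SO3_entry k 0 0)
    // (@SO3_entry k 2 0) //.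
  rewrite mulr0 addr0 -!rmorphM -rmorphD /= -!expr2 => /(congr1 (@complex.Re R)).
  by [].
apply: (cancel (J2 R) t) => //; first exact: J2_cube.
have s1 : SO3 (rodrigues (J2 R) t *m k) by apply: SO3M => //; apply: SO3_rodrigues; right.
have sc := sincos2C t.
have [e00 e10 e20] : [/\ (rodrigues (J2 R) t *m k) 0 0 = 1,
    (rodrigues (J2 R) t *m k) 1 0 = 0 & (rodrigues (J2 R) t *m k) 2 0 = 0].
  rewrite !mulmx3E rodrigues_J2 !mxE /= k10 (@SO3_entry k 0 0) // (@SO3_entry k 2 0) // u v.
  by move: (sin t)%:C (cos t)%:C sc => s c sc; split; ring: sc.
move: (rodrigues _ t *m k) s1 e00 e10 e20 => {sk u v k10}k sk k00 k10 k20 {sc t}.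
have k01 : k 0 1 = 0 by have := orth k 0 1 sk; rewrite k00 k10 k20 mul1r !mul0r !addr0.
have k02 : k 0 2 = 0 by have := orth k 0 2 sk; rewrite k00 k10 k20 mul1r !mul0r !addr0.
have o11 : k 1 1 * k 1 1 = 1 - k 2 1 * k 2 1.
  by have : _ = 1 := orth k 1 1 sk; rewrite k01 mul0r add0r => <-; rewrite addrK.
have o12 : k 2 1 * k 2 2 = - (k 1 1 * k 1 2).
  have /eqP : _ = 0 := orth k 1 2 sk.
  by rewrite k01 mul0r add0r addr_eq0 => /eqP ->; rewrite opprK.
have d : k 1 1 * k 2 2 = 1 + k 1 2 * k 2 1.
  by have [_ _] := sk; rewrite det3E k00 k01 k02 mul1r !mul0r subr0 addr0 => <-; rewrite subrK.
have [t [u v]] : exists t, complex.Re (k 1 1) = cos t /\ complex.Re (k 2 1) = sin t.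
  apply: circle_param; have : k 1 1 * k 1 1 + k 2 1 * k 2 1 = 1 by rewrite o11 subrK.
  rewrite (@SO3_entry k 1 1) // (@SO3_entry k 2 1) // -!rmorphM -rmorphD /= -!expr2.
  by move=> /(congr1 (@complex.Re R)).
have e22 : k 2 2 = k 1 1.
  transitivity (k 1 1 * (k 1 1 * k 2 2) + k 2 1 * (k 2 1 * k 2 2)).
    by transitivity ((k 1 1 * k 1 1 + k 2 1 * k 2 1) * k 2 2); [rewrite o11|]; ring.
  by rewrite d o12; ring.
have e12 : k 1 2 = - k 2 1.
  transitivity (k 2 1 * (k 1 2 * k 2 1) + k 1 1 * (k 1 1 * k 1 2)).
    by transitivity ((k 1 1 * k 1 1 + k 2 1 * k 2 1) * k 1 2); [rewrite o11|]; ring.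
  have -> : k 1 1 * k 1 2 = - (k 2 1 * k 2 2) by rewrite o12 opprK.
  have -> : k 1 2 * k 2 1 = k 1 1 * k 2 2 - 1 by rewrite d addrC addKr.
  by ring.
have -> : k = rodrigues (J1 R) t.
  rewrite rodrigues_J1 [k]mx3_eta k00 k10 k20 k01 k02 e22 e12 (@SO3_entry k 1 1)
    // (@SO3_entry k 2 1) // u v.
  by [].
exact: G1.
Qed.
End Rotations.

(** * Reductions are closed *)

Section Closedness.
Variable R : realType.
Notation C := R[i].
Notation M := 'M[C]_3.

Lemma ccvg_unique (T : Type) (F : set_system T) {FF : ProperFilter F} (f : T -> M) A B :
  ccvg F f A -> (\forall t \near F, f t = B) -> A = B.
Proof.
move=> fA fB; apply/matrixP => p q.
have fB' : (fun t => f t p q : Cx R) @ F --> (B p q : Cx R).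
  by apply: cvg_near_cst; apply: filterS fB => t ->.
exact: (cvg_unique (@norm_hausdorff _ (Cx R)) (fA p q) fB').
Qed.

Lemma SU3_closed (T : Type) (F : set_system T) {FF : ProperFilter F} (f : T -> M) A :
  ccvg F f A -> (\forall t \near F, SU3 (f t)) -> SU3 A.
Proof.
move=> fA fS; split.
  have c1 : ccvg F (fun t => f t *m dag (f t)) (A *m dag A).
    by exact: (ccvgM fA (ccvg_dag fA)).
  by apply: (ccvg_unique c1); apply: filterS fS => t [].
have fD : (fun t => \det (f t) : Cx R) @ F --> (1 : Cx R).
  by apply: cvg_near_cst; apply: filterS fS => t [].
exact: (cvg_unique (@norm_hausdorff _ (Cx R)) (ccvg_det fA) fD).
Qed.

Lemma SO3_closed (T : Type) (F : set_system T) {FF : ProperFilter F} (f : T -> M) A :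
  ccvg F f A -> (\forall t \near F, SO3 (f t)) -> SO3 A.
Proof.
move=> fA fS.
have AA : A *m A^T = 1%:M.
  have c1 : ccvg F (fun t => f t *m (f t)^T) (A *m A^T).
    by exact: (ccvgM fA (ccvg_tr fA)).
  by apply: (ccvg_unique c1); apply: filterS fS => t [].
split => //.
  have c1 : ccvg F (fun t => conjmx (f t) - f t) (conjmx A - A).
    by exact: (ccvgD (ccvg_conj fA) (ccvgN fA)).
  apply/eqP; rewrite -subr_eq0; apply/eqP.
  by apply: (ccvg_unique c1); apply: filterS fS => t [-> _ _]; rewrite subrr.
have fD : (fun t => \det (f t) : Cx R) @ F --> (1 : Cx R).
  by apply: cvg_near_cst; apply: filterS fS => t [].
exact: (cvg_unique (@norm_hausdorff _ (Cx R)) (ccvg_det fA) fD).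
Qed.

(** Near g a local section s identifies Q with the product of the base and K, by
    (g, x) |-> s(g)^T x, and K is closed. *)
Lemma subbundle_closed k l (K : set M) (Q : M -> M -> Prop) :
  closed_subgroup K -> principal_subbundle k l K Q -> filter_closed Q.
Proof.
move=> [_ _ _ Kcl] [Qsub _ Qfib Qsec] F FF f h g x fg hx fhQ.
have sg : SU3 g by apply: (SU3_closed fg); apply: filterS fhQ => w /Qsub[].
have sx : SO3 x by apply: (SO3_closed hx); apply: filterS fhQ => w /Qsub[].
have [W [s [Wop Wg ssm sQ]]] := Qsec g sg.
have fS : \forall w \near F, SU3 (f w) by apply: filterS fhQ => w /Qsub[].
have f_g : (f : _ -> 'M[Cx R]_3) @ F --> (g : 'M[Cx R]_3) by apply: cvg_mx fg.
have fW : \forall w \near F, (W `&` @SU3 R) (f w).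
  have Wn : nbhs (g : 'M[Cx R]_3) W by apply: open_nbhs_nbhs; split.
  by apply: filterS2 (f_g W Wn) fS => w Ww Sw.
have fwithin : (f : _ -> 'M[Cx R]_3) @ F --> within (W `&` @SU3 R) (nbhs (g : 'M[Cx R]_3)).
  move=> B Bw; have fB := f_g _ Bw.
  by apply: filterS2 fB fW => w; apply.
have Qgs := sQ g (conj Wg sg); have [_ ssg] := Qsub _ _ Qgs.
have sf : ccvg F (fun w => s (f w)) (s g).
  move=> p q; have [/subspace_continuousP/(_ g (conj Wg sg)) sc _] := ssm p q 0%N.
  exact: (@cvg_comp _ _ _ (f : _ -> 'M[Cx R]_3) (fun y => s y p q : Cx R) _ _ _ fwithin sc).
apply/(Qfib g (s g) x Qgs sx); rewrite SO3_invmx //.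
have lim : ccvg F (fun w => (s (f w))^T *m h w) ((s g)^T *m x).
  exact: (ccvgM (ccvg_tr sf) hx).
have lim' : (fun w => (s (f w))^T *m h w : 'M[Cx R]_3) @ F --> ((s g)^T *m x : 'M[Cx R]_3).
  by apply: cvg_mx lim.
apply: (@closed_cvg _ 'M[Cx R]_3 F _ (fun w => (s (f w))^T *m h w) K Kcl _ _ lim').
apply: filterS2 fW fhQ => w fWw Qfh; have Qs := sQ _ fWw.
have [_ ss] := Qsub _ _ Qs; have [_ hh] := Qsub _ _ Qfh.
by rewrite -SO3_invmx //; apply/(Qfib _ _ _ Qs hh).
Qed.

Lemma dag_so3 (Y : M) : so3 Y -> dag Y = - Y.
Proof. by move=> [Yr Yt]; rewrite /dag Yr. Qed.

Lemma continuous_rodrigues (Z : M) (r t : R) :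
  ccvg (nbhs t) (fun s => rodrigues Z (r * s)) (rodrigues Z (r * t)).
Proof.
have lin : (fun s : R => r * s) @ t --> r * t by apply: cvgMr; exact: cvg_id.
have sc : (fun s => (sin (r * s))%:C : Cx R) @ t --> ((sin (r * t))%:C : Cx R).
  apply: cvg_ReIm; last exact: cvg_cst.
  by apply: (cvg_comp _ _ lin); exact: continuous_sin.
have cc : (fun s => (1 - cos (r * s))%:C : Cx R) @ t --> ((1 - cos (r * t))%:C : Cx R).
  apply: cvg_ReIm; last exact: cvg_cst.
  apply: cvgB; first exact: cvg_cst.
  by apply: (cvg_comp _ _ lin); exact: continuous_cos.
move=> p q; rewrite (_ : (fun s => _) = fun s => (1%:M : M) p q + (sin (r * s))%:C * Z p q
   + (1 - cos (r * s))%:C * (Z *m Z) p q); last first.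
  by apply/funext => s; rewrite /rodrigues !entryE.
rewrite /rodrigues !entryE.
apply: cvgD; last by apply: (cvgM cc); exact: cvg_cst.
by apply: cvgD; [exact: cvg_cst|apply: (cvgM sc); exact: cvg_cst].
Qed.

End Closedness.

(** * Irreducibility *)

Section Irreducibility.
Variable R : realType.
Notation C := R[i].
Notation M := 'M[C]_3.

Lemma rodriguesN (Z : M) t : rodrigues (- Z) (- t) = rodrigues Z t.
Proof.
rewrite /rodrigues sinN cosN rmorphN scaleNr scalerN opprK.
by rewrite mulNmx mulmxN opprK.
Qed.

Lemma rodrigues_intertwine (P Z Z' : M) t : P *m Z = Z' *m P ->
  P *m rodrigues Z t = rodrigues Z' t *m P.
Proof.
move=> PZ; rewrite /rodrigues !mulmxDr !mulmxDl mulmx1 mul1mx -!scalemxAr -!scalemxAl.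
by rewrite PZ mulmxA PZ -!mulmxA PZ.
Qed.

Lemma conj_right (g p h h' q : M) : p *m h = h' *m p -> p *m q = 1%:M ->
  g *m h' = g *m p *m h *m q.
Proof. by move=> ph pq; rewrite -(mulmxA g) ph -!mulmxA pq mulmx1. Qed.

Lemma eta_dualE (m : 'I_3) : eta_dual R m = nth 0 [:: mx3 0 0 0 0 0 'i 0 'i 0;
  mx3 0 0 'i 0 0 0 'i 0 0; mx3 0 'i 0 'i 0 0 0 0 0] m.
Proof.
rewrite /eta_dual; move: m; apply: I3_ind; rewrite !add3E !mx3_delta !eqE /= mx3_add mx3_scale;
  by congr mx3; rewrite ?addr0 ?add0r ?mulr0 ?mulr1.
Qed.

Lemma theta_dualE (m : 'I_3) : theta_dual R m = nth 0 [:: mx3 0 0 0 0 0 1 0 (-1) 0;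
  mx3 0 0 (-1) 0 0 0 1 0 0; mx3 0 1 0 (-1) 0 0 0 0 0] m.
Proof.
rewrite /theta_dual; move: m; apply: I3_ind; rewrite !add3E !mx3_delta !eqE /= mx3_opp mx3_add;
  by congr mx3; rewrite ?oppr0 ?addr0 ?add0r.
Qed.

Lemma eta_dual_cube m : eta_dual R m *m eta_dual R m *m eta_dual R m = - eta_dual R m.
Proof.
rewrite eta_dualE; move: m; apply: I3_ind; rewrite /= !mx3_mul mx3_opp;
  by congr mx3; ring: (mul_ii R).
Qed.

Lemma theta_dual_cube m : theta_dual R m *m theta_dual R m *m theta_dual R m = - theta_dual R m.
Proof.
rewrite theta_dualE; move: m; apply: I3_ind; rewrite /= !mx3_mul mx3_opp;
  by congr mx3; ring.
Qed.

Lemma su3_eta_dual m : su3 (eta_dual R m).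
Proof.
rewrite eta_dualE; move: m; apply: I3_ind; split; rewrite /= ?/mxtrace ?sum3 ?mxE /= ?addr0 //;
  by rewrite /dag /Defs.conjmx mx3_map mx3_tr mx3_opp; congr mx3; rewrite ?conjc_i ?conjc0 ?oppr0.
Qed.

Lemma su3_theta_dual m : su3 (theta_dual R m).
Proof.
rewrite theta_dualE; move: m; apply: I3_ind; split; rewrite /= ?/mxtrace ?sum3 ?mxE /= ?addr0 //;
  by rewrite /dag /Defs.conjmx mx3_map mx3_tr mx3_opp; congr mx3;
    rewrite ?conjcN ?conjc1 ?conjc0 ?opprK ?oppr0.
Qed.

Definition quarter (j : 'I_3) : M := rodrigues (theta_dual R (j + 1)) (pi / 2).

(** The adjoint action of exp((pi / 2) theta_dual (j+1)) maps the plane of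
    eta_dual (j+2) and theta_dual (j+2) to that of eta_dual j and theta_dual j. *)
Lemma quarter_turn (j : 'I_3) :
  quarter j *m eta_dual R (j + 2) = eta_dual R j *m quarter j /\
  quarter j *m theta_dual R (j + 2) = - theta_dual R j *m quarter j.
Proof.
rewrite /quarter /rodrigues sin_pihalf cos_pihalf subr0 mx3_1 (rmorph1 (real_complex R)) !scale1r.
rewrite !theta_dualE !eta_dualE.
move: j; apply: I3_ind; rewrite !add3E /= !(mx3_mul, mx3_add, mx3_opp);
  by split; congr mx3; ring.
Qed.

Lemma conn_eta_dual k l j c m : conn k l j c (eta_dual R m) = (c * (j == m)%:R) *: J2 R.
Proof.
have d0 p : eta_dual R m p p = 0.
  by rewrite eta_dualE; move: p; elim/I3_ind: m; apply: I3_ind; rewrite mxE.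
rewrite /conn theta_eta eta_eta /weight_form /beta !d0 !mulr0 addr0 !scale0r !add0r.
by rewrite scalerA.
Qed.

Lemma conn_theta_dual k l j c m : conn k l j c (theta_dual R m) = (c * (j == m)%:R) *: J1 R.
Proof.
have d0 p : theta_dual R m p p = 0.
  by rewrite theta_dualE; move: p; elim/I3_ind: m; apply: I3_ind; rewrite mxE.
rewrite /conn theta_theta eta_theta /weight_form /beta !d0 !mulr0 addr0 !scale0r addr0 add0r.
by rewrite scalerA.
Qed.

Lemma conn_opp k l j c (X : M) : conn k l j c (- X) = - conn k l j c X.
Proof.
have := conn_linear k l j c (-1) X 0; rewrite addr0 !scaleN1r => ->.
suff -> : conn k l j c (0 : M) = 0 by rewrite addr0.
by have := conn_linear k l j c (-1) (0 : M) 0; rewrite scaler0 addr0 scaleN1r addNr.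
Qed.

Section Reduction.
Variables (k l : int) (j : 'I_3) (c : R) (K : set M) (Q : M -> M -> Prop).
Hypothesis c_neq0 : c != 0.
Hypothesis red : reduces_to k l (fun=> conn k l j c%:C) K Q.

(** The horizontal flow of X, for which [rodrigues] gives the two one-parameter
    groups. *)
Lemma Q_flow (X Y : M) (r : R) g x : su3 X -> X *m X *m X = - X ->
    Y *m Y *m Y = - Y -> dag Y = - Y -> conn k l j c%:C X = - (r%:C *: Y) ->
    Q g x ->
  forall t, Q (g *m rodrigues X t) (rodrigues Y (r * t) *m x).
Proof.
move=> sX X3 Y3 sY cX Qgx.
have [Kg Qb Qt] := red; have [Qsub _ _ _] := Qb.
have Quni g' x' : Q g' x' -> g' *m dag g' = 1%:M /\ x' *m dag x' = 1%:M.
  by move=> /Qsub[[gg _] sx]; split=> //; exact: SO3_unitary.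
have pos (X' : M) (r' t : R) : su3 X' -> X' *m X' *m X' = - X' ->
    conn k l j c%:C X' = - (r'%:C *: Y) -> 0 <= t ->
    Q (g *m rodrigues X' t) (rodrigues Y (r' * t) *m x).
  move=> sX' X'3 cX' t0; rewrite -[t in rodrigues X' t]mul1r.
  apply: (@flow_invariant R Q X' (r'%:C *: Y) (fun s => rodrigues X' (1 * s))
    (fun s => rodrigues Y (r' * s))) => //.
  - exact: subbundle_closed Kg Qb.
  - by case: sX'.
  - rewrite /dag conjmx_scale conjc_real trmx3Z -/(dag Y) sY scalerN.
    by [].
  - move=> g' x' /Qt/(_ sX')[c' [y' [q1 q2 q3 q4 q5]]].
    by exists c', y'; split=> //; move: q5; rewrite cX' mulNmx opprK.
  - by move=> s s'; rewrite mulrDr rodriguesD.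
  - by move=> s s'; rewrite mulrDr rodriguesD.
  - by rewrite mulr0 rodrigues0.
  - by rewrite mulr0 rodrigues0.
  - by have := velocity_rodrigues X' 1; rewrite scale1r.
  - exact: velocity_rodrigues.
  - by move=> s; exact: continuous_rodrigues.
  - by move=> s; exact: continuous_rodrigues.
move=> t; have [t0|t0] := leP 0 t; first exact: pos.
(* Negative times are positive times for - X. *)
rewrite -rodriguesN -[r * t]mulrNN.
apply: pos; last by rewrite oppr_ge0 ltW.
- case: sX => sX tX; split; last by rewrite raddfN /= tX oppr0.
  by apply/matrixP => p q; move/matrixP: sX => /(_ p q); rewrite !mxE conjcN => ->.
- by rewrite !mulNmx !mulmxN mulNmx !opprK X3 opprK.
- by rewrite conn_opp cX rmorphN scaleNr.
Qed.

Lemma rodrigues_scale0 (Y : M) t : rodrigues Y (0 * t) = 1%:M.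
Proof. by rewrite mul0r rodrigues0. Qed.

Lemma Q_flow_eta m g x : Q g x ->
  forall t, Q (g *m rodrigues (eta_dual R m) t) (rodrigues (J2 R) (- (c * (j == m)%:R) * t) *m x).
Proof.
move=> Qgx; apply: Q_flow => //.
- exact: su3_eta_dual.
- exact: eta_dual_cube.
- exact: J2_cube.
- by apply: dag_so3; split; [exact: J2_real|exact: J2_tr].
- by rewrite conn_eta_dual rmorphN rmorphM rmorph_nat scaleNr opprK.
Qed.

Lemma Q_flow_theta m g x : Q g x ->
  forall t, Q (g *m rodrigues (theta_dual R m) t) (rodrigues (J1 R) (- (c * (j == m)%:R) * t) *m x).
Proof.
move=> Qgx; apply: Q_flow => //.
- exact: su3_theta_dual.
- exact: theta_dual_cube.
- exact: J1_cube.
- by apply: dag_so3; split; [exact: J1_real|exact: J1_tr].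
- by rewrite conn_theta_dual rmorphN rmorphM rmorph_nat scaleNr opprK.
Qed.

Lemma Q_translate_eta m g x : j != m -> Q g x -> forall t, Q (g *m rodrigues (eta_dual R m) t) x.
Proof.
move=> /negPf jm Qgx t; have := Q_flow_eta m Qgx t.
by rewrite jm mulr0 oppr0 rodrigues_scale0 mul1mx.
Qed.

Lemma Q_translate_theta m g x : j != m -> Q g x -> forall t, Q (g *m rodrigues (theta_dual R m)
  t) x.
Proof.
move=> /negPf jm Qgx t; have := Q_flow_theta m Qgx t.
by rewrite jm mulr0 oppr0 rodrigues_scale0 mul1mx.
Qed.

(** The translation by exp(tZ') is the composite of three translations by
    one-parameter groups on which the connection vanishes. *)
Lemma Q_translate_j (Z Z' : M) g x : quarter j *m Z = Z' *m quarter j ->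
    (forall g t, Q g x -> Q (g *m rodrigues Z t) x) ->
  Q g x -> forall t, Q (g *m rodrigues Z' t) x.
Proof.
move=> PZ QZ Qgx t; have [e1 e2 _] := neq3 j.
have th (g' : M) s : Q g' x -> Q (g' *m rodrigues (theta_dual R (j + 1)) s) x.
  by move=> Qg'; apply: Q_translate_theta => //; rewrite e1.
have -> : g *m rodrigues Z' t = g *m rodrigues (theta_dual R (j + 1)) (pi / 2)
    *m rodrigues Z t *m rodrigues (theta_dual R (j + 1)) (- (pi / 2)).
  apply: conj_right; first exact: rodrigues_intertwine.
  by rewrite -rodriguesD ?addrN ?rodrigues0 //; exact: theta_dual_cube.
by apply: (th); apply: QZ; exact: th.
Qed.

Lemma Q_translate_eta_j g x : Q g x -> forall t, Q (g *m rodrigues (eta_dual R j) t) x.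
Proof.
have [e1 e2 _] := neq3 j; have [qe _] := quarter_turn j.
apply: Q_translate_j qe _ => g' t Qg'.
by apply: Q_translate_eta => //; rewrite e2.
Qed.

Lemma Q_translate_theta_j g x : Q g x -> forall t, Q (g *m rodrigues (theta_dual R j) t) x.
Proof.
have [e1 e2 _] := neq3 j; have [_ qt] := quarter_turn j.
move=> Qgx t; rewrite -rodriguesN; move: (- t) => {}t; move: t.
apply: Q_translate_j qt _ Qgx => g' t Qg'.
by apply: Q_translate_theta => //; rewrite e2.
Qed.

(** Composing the horizontal flow of eta_dual j with the translation back gives a
    point of the same fibre, rotated about the second axis; likewise for
    theta_dual j and the first axis.  So K contains conjugates by x of all these
    rotations. *)
Lemma reduction_trivial : K = @SO3 R.
Proof.
have [[Ksub K1 Kdiv Kcl] [Qsub _ Qfib Qsec] _] := red.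
have [W [s [_ W1 _ sQ]]] := Qsec _ (SU3_1 R).
have := sQ _ (conj W1 (SU3_1 R)); move: (s 1%:M) => x {W s W1 sQ} Q1x.
have [_ sx] := Qsub _ _ Q1x.
have KM y z : K y -> K z -> K (y *m z).
  move=> Ky Kz; have := Kdiv _ _ Ky (Kdiv _ _ K1 Kz).
  by rewrite mul1mx invmxK.
have conjM (y z : M) : invmx x *m (y *m z) *m x = (invmx x *m y *m x) *m (invmx x *m z *m x).
  have [xu _] := mulmx1_unit (SO3_unitary sx).
  by rewrite !mulmxA mulmxK.
have KQ (g y : M) : Q g x -> SO3 y -> Q g (y *m x) -> K (invmx x *m y *m x).
  move=> Qgx sy; rewrite -mulmxA; move/(Qfib _ _ _ Qgx); apply.
  exact: SO3M.
(* The flow of eta_dual j turns by the angle t in time - t / c. *)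
have K2 t : K (invmx x *m rodrigues (J2 R) t *m x).
  pose t' := - t / c; apply: (@KQ (1%:M *m rodrigues (eta_dual R j) t')).
  - exact: Q_translate_eta_j.
  - by apply: SO3_rodrigues; right.
  - have := Q_flow_eta j Q1x t'.
    by rewrite eqxx mulr1 (_ : - c * t' = t) // /t'; field.
have K1' t : K (invmx x *m rodrigues (J1 R) t *m x).
  pose t' := - t / c; apply: (@KQ (1%:M *m rodrigues (theta_dual R j) t')).
  - exact: Q_translate_theta_j.
  - by apply: SO3_rodrigues; left.
  - have := Q_flow_theta j Q1x t'.
    by rewrite eqxx mulr1 (_ : - c * t' = t) // /t'; field.
apply/seteqP; split=> [y /Ksub //|y sy].
have KG : forall y, SO3 y -> K (invmx x *m y *m x).
  apply: (SO3_euler (G := fun y => K (invmx x *m y *m x))) => // y1 y2 k1 k2.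
  by rewrite conjM; exact: KM.
have := KG (x *m y *m invmx x); have [xu _] := mulmx1_unit (SO3_unitary sx).
rewrite !mulmxA mulVmx // mul1mx mulmxKV //; apply.
by rewrite SO3_invmx //; apply: SO3M; [exact: SO3M|exact: SO3_tr].
Qed.

End Reduction.

Lemma conn_irreducible k l j (c : R) : c != 0 -> ~ reducible k l (fun=> conn k l j c%:C).
Proof. by move=> c0 [K [Q [KS red]]]; apply: KS; exact: reduction_trivial red. Qed.

End Irreducibility.

(** * Curves in SU(3) with a given velocity *)

Section TangentCurves.
Variable R : realType.
Notation C := R[i].
Notation M := 'M[C]_3.

(** X is the velocity at 1 of a curve in SU(3); all of su(3) is of this kind by
    [su3_curvable]. *)
Definition curvable (X : M) := exists c : R -> M,
  [/\ forall t, SU3 (c t), c 0 = 1%:M & velocity c X].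

Lemma curvableD (X Y : M) : curvable X -> curvable Y -> curvable (X + Y).
Proof.
move=> [c [cS c0 cX]] [d [dS d0 dY]]; exists (fun t => c t *m d t); split.
- by move=> t; exact: SU3M.
- by rewrite c0 d0 mul1mx.
- by have := velocity_mul cX dY; rewrite c0 d0 mulmx1 mul1mx.
Qed.

Lemma dag_rodrigues (Z : M) t : dag Z = - Z -> dag (rodrigues Z t) = rodrigues Z (- t).
Proof.
move=> sZ; have sZ2 : dag (Z *m Z) = Z *m Z by rewrite dagM sZ mulNmx mulmxN opprK.
rewrite /rodrigues sinN cosN; move: (dag1 R) sZ2; rewrite /dag => s1 sZ2.
rewrite 2!conjmx_add !conjmx_scale !conjc_real 2!trmx3D !trmx3Z s1 sZ2.
by rewrite -/(dag Z) sZ rmorphN scaleNr scalerN.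
Qed.

Lemma curvable_scale (Z : M) (z : C) : conjc z = z -> dag Z = - Z -> Z *m Z *m Z = - Z ->
  (forall t, \det (rodrigues Z t) = 1) -> curvable (z *: Z).
Proof.
move=> /conjc_fixed -> sZ Z3 dZ; set r := complex.Re z.
exists (fun t => rodrigues Z (r * t)); split.
- by move=> t; split; rewrite // dag_rodrigues // -rodriguesD // addrN rodrigues0.
- by rewrite mulr0 rodrigues0.
- exact: velocity_rodrigues.
Qed.

Definition tau01 : M := mx3 'i 0 0 0 (- 'i) 0 0 0 0.
Definition tau12 : M := mx3 0 0 0 0 'i 0 0 0 (- 'i).

Lemma curvable_eta_dual m z : conjc z = z -> curvable (z *: eta_dual R m).
Proof.
move=> zr; apply: curvable_scale => //; first by case: (su3_eta_dual R m).
  exact: eta_dual_cube.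
move=> t; rewrite eta_dualE /rodrigues mx3_1 rmorphB (rmorph1 (real_complex R)) /=.
have := sincos2C t; move: (sin t)%:C (cos t)%:C => s c sc.
by move: m; apply: I3_ind; rewrite /= !(mx3_mul, mx3_scale, mx3_add) det3E !mxE /=; ring:
  (mul_ii R) sc.
Qed.

Lemma curvable_theta_dual m z : conjc z = z -> curvable (z *: theta_dual R m).
Proof.
move=> zr; apply: curvable_scale => //; first by case: (su3_theta_dual R m).
  exact: theta_dual_cube.
move=> t; rewrite theta_dualE /rodrigues mx3_1 rmorphB (rmorph1 (real_complex R)) /=.
have := sincos2C t; move: (sin t)%:C (cos t)%:C => s c sc.
by move: m; apply: I3_ind; rewrite /= !(mx3_mul, mx3_scale, mx3_add) det3E !mxE /=; ring:
  (mul_ii R) sc.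
Qed.

Lemma curvable_tau01 z : conjc z = z -> curvable (z *: tau01).
Proof.
move=> zr; apply: curvable_scale => //; rewrite /tau01.
- rewrite /dag /Defs.conjmx mx3_map mx3_tr mx3_opp conjcN conjc_i conjc0.
  by congr mx3; rewrite ?oppr0.
- by rewrite !mx3_mul mx3_opp; congr mx3; ring: (mul_ii R).
move=> t; rewrite /rodrigues mx3_1 rmorphB (rmorph1 (real_complex R)) /=.
have := sincos2C t; move: (sin t)%:C (cos t)%:C => s c sc.
by rewrite !(mx3_mul, mx3_scale, mx3_add) det3E !mxE /=; ring: (mul_ii R) sc.
Qed.

Lemma curvable_tau12 z : conjc z = z -> curvable (z *: tau12).
Proof.
move=> zr; apply: curvable_scale => //; rewrite /tau12.
- rewrite /dag /Defs.conjmx mx3_map mx3_tr mx3_opp conjcN conjc_i conjc0.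
  by congr mx3; rewrite ?oppr0.
- by rewrite !mx3_mul mx3_opp; congr mx3; ring: (mul_ii R).
move=> t; rewrite /rodrigues mx3_1 rmorphB (rmorph1 (real_complex R)) /=.
have := sincos2C t; move: (sin t)%:C (cos t)%:C => s c sc.
by rewrite !(mx3_mul, mx3_scale, mx3_add) det3E !mxE /=; ring: (mul_ii R) sc.
Qed.

(** A basis of su(3) whose members satisfy Z^3 = - Z, so that [rodrigues] gives
    their one-parameter groups. *)
Lemma su3_decomp (X : M) : \tr X = 0 -> X =
  eta 0 X *: eta_dual R 0 + theta 0 X *: theta_dual R 0
  + (eta 1 X *: eta_dual R 1 + theta 1 X *: theta_dual R 1)
  + (eta 2 X *: eta_dual R 2 + theta 2 X *: theta_dual R 2)
  + (beta 0 X *: tau01 + (beta 0 X + beta 1 X) *: tau12).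
Proof.
rewrite /mxtrace sum3 => /eqP; rewrite addr_eq0 => /eqP tX.
rewrite !eta_dualE !theta_dualE /= /tau01 /tau12 /eta /theta /beta !add3E.
rewrite {1}[X]mx3_eta !(mx3_scale, mx3_add).
have t2 := two_neq0 R.
have X22 : X 2 2 = - (X 0 0 + X 1 1) by rewrite tX opprK.
by rewrite !invfM inv_i X22; congr mx3; field: (mul_ii R).
Qed.

Lemma su3_curvable (X : M) : su3 X -> curvable X.
Proof.
move=> sX; have [_ tX] := sX; rewrite [X]su3_decomp //.
have e m := su3_eta_real m sX; have t m := su3_theta_real m sX.
have b m := su3_diag_real m sX.
do ![apply: curvableD]; try exact: curvable_eta_dual; try exact: curvable_theta_dual.
- exact: curvable_tau01.
- by apply: curvable_tau12; rewrite conjcD !b.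
Qed.
End TangentCurves.

(** * The reduction to the maximal torus *)

Section MaxTorus.
Variable R : realType.
Notation C := R[i].
Notation M := 'M[C]_3.

Lemma SO3_rot (z : C) : z * conjc z = 1 -> SO3 (rot z).
Proof.
move=> /unit_circle zz; rewrite rotE rotCE.
have xr := conjc_real (complex.Re z); have yr := conjc_real (complex.Im z).
move: (complex.Re z)%:C (complex.Im z)%:C zz xr yr => x y.
move=> /eqP; rewrite eq_sym -subr_eq => /eqP/esym xy xr yr; split.
- by rewrite /Defs.conjmx mx3_map ?(@conjcN R) ?xr ?yr ?conjc0 ?conjc1.
- by rewrite mx3_tr mx3_mul mx3_1; congr mx3; ring: xy.
- by rewrite det3E !mxE /=; ring: xy.
Qed.

(** A centraliser is visibly a closed subgroup. *)
Lemma max_torusP (k : M) : max_torus k <-> SO3 k /\ k *m J3 R = J3 R *m k.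
Proof.
split=> [[z zz <-]|[sk]].
  by split; [exact: SO3_rot|have [-> _ _] := rot_J zz].
have [_ kk kd] := sk; have re p q := @SO3_entry R k p q sk.
rewrite {1 2}[k]mx3_eta J3E !mx3_mul => /matrixP e.
move: (e 0 0) (e 0 1) (e 0 2) (e 1 2) (e 2 0) (e 2 1); rewrite !mxE /=.
rewrite !(mulr0, mul0r, addr0, add0r, mulr1, mul1r, mulrN1, mulN1r).
move=> e01 /oppr_inj e00 /eqP; rewrite eq_sym oppr_eq0 => /eqP k12 /esym k02 k21.
move=> /eqP; rewrite oppr_eq0 => /eqP k20.
have /matrixP/(_ 0 0) := kk; rewrite mulmx3E !mxE k02 mulr0 addr0 e01 mulrNN => n1.
have k22 : k 2 2 = 1.
  rewrite -kd det3E k20 k21 k02 -e00 e01 !mulr0 !subr0 mulNr opprK mul0r addr0.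
  by rewrite !mulrA -mulrDl n1 mul1r.
pose z := complex.Re (k 0 0) +i* complex.Re (k 1 0).
have zz : z * conjc z = 1.
  move: n1; rewrite (re 0 0) (re 1 0) => n1; rewrite -[RHS]n1.
  by apply/eqP; rewrite eq_complex /=; apply/andP; split; apply/eqP; ring.
exists z => //.
rewrite rotE rotCE /= -!re [RHS]mx3_eta k02 k12 k20 k21 k22 -e00 e01.
by [].
Qed.

Lemma max_torus1 : @max_torus R 1%:M.
Proof.
apply/max_torusP; split; last by rewrite mul1mx mulmx1.
by split; [rewrite /Defs.conjmx map_mx1|rewrite trmx1 mulmx1|exact: det1].
Qed.

Lemma max_torusM (k h : M) : max_torus k -> max_torus h -> max_torus (k *m h).
Proof.
move=> /max_torusP[sk kJ] /max_torusP[sh hJ]; apply/max_torusP; split; first exact: SO3M.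
by rewrite -mulmxA hJ !mulmxA kJ.
Qed.

Lemma max_torusV (k : M) : max_torus k -> max_torus (invmx k).
Proof.
move=> /max_torusP[sk kJ]; rewrite SO3_invmx //; apply/max_torusP; split; first exact: SO3_tr.
move/(congr1 trmx): kJ; rewrite !trmx_mul J3_tr; move: (J3 R) => J.
by rewrite mulNmx mulmxN => /oppr_inj.
Qed.

Lemma closed_subgroup_max_torus : closed_subgroup (@max_torus R).
Proof.
split.
- by move=> k /max_torusP[].
- exact: max_torus1.
- by move=> x y mx my; apply: max_torusM => //; exact: max_torusV.
move=> k clk; apply/max_torusP.
set F := within (@max_torus R : set 'M[Cx R]_3) (nbhs (k : 'M[Cx R]_3)).
have FF : ProperFilter F by exact: within_nbhs_proper.
have idk : ccvg F id k.
  move=> p q; apply: cvg_within_filter.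
  exact: (@coord_continuous (Cx R) 3 3 p q (k : 'M[Cx R]_3)).
have near_mt : \forall h \near F, max_torus h by exact: withinT.
split; first by apply: (SO3_closed idk); apply: filterS near_mt => h /max_torusP[].
have c1 (J : M) : ccvg F (fun h => h *m J - J *m h) (k *m J - J *m k).
  have cJ : ccvg F (fun=> J) J by exact: ccvg_cst.
  have cl := @ccvgM R M F FF id (fun=> J) _ _ idk cJ.
  have cr := @ccvgM R M F FF (fun=> J) id _ _ cJ idk.
  exact: (@ccvgD R M F FF _ _ _ _ cl (@ccvgN R M F FF _ _ cr)).
apply/eqP; rewrite -subr_eq0; apply/eqP; apply: (ccvg_unique (c1 _)).
by apply: filterS near_mt => h /max_torusP[_ ->]; rewrite subrr.
Qed.

Lemma max_torus_proper : @max_torus R <> @SO3 R.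
Proof.
move=> e; have : max_torus (rodrigues (J1 R) (pi / 2)).
  by rewrite e; apply: SO3_rodrigues; left.
move=> /max_torusP[_]; rewrite rodrigues_J1 sin_pihalf cos_pihalf J3E !mx3_mul.
move=> /matrixP/(_ 2 0); rewrite !mxE /=.
rewrite !(mulr0, mul0r, addr0, add0r, mulr1) => /eqP.
by rewrite (rmorph1 (real_complex R)) oner_eq0.
Qed.

Lemma max_torus_rodrigues t : max_torus (rodrigues (J3 R) t).
Proof.
exists (cos t +i* sin t).
  apply/eqP; rewrite eq_complex /=; apply/andP; split; apply/eqP; last by ring.
  by rewrite mulrN opprK -!expr2 cos2Dsin2.
by rewrite rotE rotCE rodrigues_J3.
Qed.

Lemma lambda_max_torus k l (h : M) : torus h -> max_torus (lambda k l h).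
Proof. by move=> th; exists (weight_hom k l h) => //; exact: weight_hom_unit. Qed.

(** The constant map 1 is a global section. *)
Lemma principal_L_bundle k l : principal_subbundle k l (@max_torus R) (@L_bundle R).
Proof.
split.
- by move=> g x [sg /max_torusP[]].
- move=> g h x sg th sx; have sl := lambda_max_torus k l th.
  have [sh _] := th; have [/SO3_unitary/mulmx1_unit[lu _] _] := (max_torusP (lambda k l h)).1 sl.
  split=> -[_ mx]; split => //; [exact: max_torusM|exact: SU3M|].
  by rewrite -(mulKmx lu x); apply: max_torusM mx; exact: max_torusV.
- move=> g x y [sg mx] sy; have [/SO3_unitary/mulmx1_unit[xu _] _] := (max_torusP x).1 mx.
  split=> [[_ my]|mxy]; first by apply: max_torusM my; exact: max_torusV.
  by split; rewrite // -(mulKVmx xu y); exact: max_torusM.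
- move=> g0 _; exists setT, (fun=> 1%:M); split => //.
  + exact: openT.
  + by move=> p q; exact: smooth_cst.
  + by move=> g [_ sg]; split => //; exact: max_torus1.
Qed.

(** Horizontal curves move the second factor by rotations about the third axis. *)
Lemma conn0_reduces k l j : reduces_to k l (fun=> conn k l j 0%:C) (@max_torus R) (@L_bundle R).
Proof.
split; [exact: closed_subgroup_max_torus|exact: principal_L_bundle|].
move=> g x X [sg mx] sX; have [c [cS c0 cX]] := su3_curvable sX.
pose w := complex.Re (weight_form k l X).
exists (fun t => g *m c t), (fun t => rodrigues (J3 R) (- w * t) *m x); split.
- move=> t; split; first exact: SU3M.
  by apply: max_torusM => //; exact: max_torus_rodrigues.
- by rewrite c0 mulmx1.
- by rewrite mulr0 rodrigues0 mul1mx.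
- exact: velocity_mull.
- have -> : - (conn k l j 0%:C X *m x) = ((- w)%:C *: J3 R) *m x.
    have wE := conjc_fixed (weight_form_real k l sX).
    by rewrite /conn scale0r addr0 wE rmorphN scaleNr mulNmx.
  by apply: velocity_mulr; exact: velocity_rodrigues.
Qed.

Lemma conn0_reducible k l j : reducible k l (fun=> conn k l j 0%:C : M -> M).
Proof.
exists (@max_torus R), (@L_bundle R).
by split; [exact: max_torus_proper|exact: conn0_reduces].
Qed.

Lemma conn0_pHYM (a : 'I_3 -> R) k l j : (forall m, 0 < a m) -> (forall m, a m = a 0) ->
  pHYM a k l (fun=> conn k l j 0%:C).
Proof.
move=> a_gt0 aE; split; first by apply: is_connection_conn; left.
  by move=> g v _; rewrite (@type_part0_curvature _ a j) // oppr0 mul0r scale0r /detform scaler0.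
move=> g v _; apply: Lambda_curvature_eq0 => //.
rewrite sum3 /curv11 /= !aE expr0n /= !mul0r !subr0 -!mulrDl.
by rewrite (_ : _ + _ + _ = 0) ?mul0r //; ring.
Qed.

End MaxTorus.

(** * The dichotomy *)

Section Dichotomy.
Variables (R : realType) (a : 'I_3 -> R).
Hypothesis a_gt0 : forall m, 0 < a m.

(** Multiplied by A_j^2, the equation reads
    c^2 = 4 - 2 (A_j / A_(j+1))^2 - 2 (A_j / A_(j+2))^2.  If A_j is minimal the right
    side is at least 0, with equality only if A_j = A_(j+1) = A_(j+2). *)
Lemma exists_balancing_scale j : (forall m, a j <= a m) -> (forall m, a m = a 0) \/
  exists2 c : R, c != 0 & (4 - c ^+ 2) / a j ^+ 2 - 2 / a (j + 1) ^+ 2 - 2 / a (j + 2) ^+ 2 = 0.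
Proof.
move=> jmin; have an0 m : a m != 0 by rewrite gt_eqF.
(* The right side is 4 - 2 r_(j+1) - 2 r_(j+2), where each r_m is at most 1. *)
pose r m := (a j / a m) ^+ 2.
have r_le1 m : r m <= 1 by rewrite exprn_ile1 ?divr_ge0 ?(ltW (a_gt0 _)) // ler_pdivrMr ?mul1r.
have r_eq1 m : r m = 1 -> a m = a j.
  move/eqP; rewrite /r sqrp_eq1 ?divr_ge0 ?(ltW (a_gt0 _)) // => /eqP e.
  by rewrite -[RHS](divfK (an0 m)) e mul1r.
have s_ge0 : 0 <= 4 - 2 * r (j + 1) - 2 * r (j + 2).
  by have := r_le1 (j + 1); have := r_le1 (j + 2); lra.
have [s0|s0] := eqVneq (4 - 2 * r (j + 1) - 2 * r (j + 2)) 0.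
  left; have e1 : a (j + 1) = a j.
    by apply: r_eq1; have := r_le1 (j + 1); have := r_le1 (j + 2); lra.
  have e2 : a (j + 2) = a j.
    by apply: r_eq1; have := r_le1 (j + 1); have := r_le1 (j + 2); lra.
  have aj m : a m = a j.
    by move: e1 e2; move: j {jmin r r_le1 r_eq1 s_ge0 s0} m;
      do 2![apply: I3_ind]; rewrite !add3E // => -> // ->.
  by move=> m; rewrite !aj.
right; exists (Num.sqrt (4 - 2 * r (j + 1) - 2 * r (j + 2))).
  by rewrite gt_eqF // sqrtr_gt0 lt_neqAle eq_sym s0.
by rewrite sqr_sqrtr // /r; field; rewrite !an0.
Qed.
End Dichotomy.

Theorem corollary1 (R : realType) (a : 'I_3 -> R) (a_gt0 : forall j, 0 < a j) :
  (exists k l : int, is_root k l /\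
     exists (A : 'M[R[i]]_3 -> 'M[R[i]]_3 -> 'M[R[i]]_3) (u : @dform R 'M[R[i]]_3 3),
       [/\ irreducible_DT_instanton a k l A u,
           SU3_invariant_connection A & SU3_invariant_form u])
  \/
  ((exists c : R, 0 < c /\
      forall X Y : 'M[R[i]]_3, su3 X -> su3 Y ->
        metric a X Y = c%:C * metric (fun=> 1) X Y) /\
   forall k l : int, exists A : 'M[R[i]]_3 -> 'M[R[i]]_3 -> 'M[R[i]]_3,
     [/\ pHYM a k l A, reducible k l A
       & reduces_to k l A (@max_torus R) (@L_bundle R)]).
Proof.
have [j jmin] : exists j, forall m, a j <= a m.
  by have [j _ jm] := @Order.TotalTheory.arg_minP _ _ _ (ord0 : 'I_3) xpredT a isT;
    exists j => m; exact: jm.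
have [aE|[c c0 sum0]] := exists_balancing_scale a_gt0 jmin; [right; split|left].
- exists (a 0 ^+ 2); split=> [|X Y _ _]; first by rewrite exprn_gt0.
  rewrite /metric mulr_sumr; apply: eq_bigr => m _.
  by rewrite aE (rmorph1 (real_complex R)) expr1n mul1r rmorphXn.
- move=> k l; exists (fun=> conn k l 0 0%:C).
  by split; [exact: conn0_pHYM|exact: conn0_reducible|exact: conn0_reduces].
have [k [l [rkl rt sumE]]] := exists_root R j; exists k, l; split=> //.
have [|u [DT inv] du] := exists_DT_instanton a_gt0 rt c0.
  rewrite sumE // -[RHS](rmorph0 (real_complex R)) -sum0.
  by rewrite !(rmorphB, rmorphM, fmorphV, rmorphXn, rmorph_nat).
exists (fun=> conn k l j c%:C), u; split=> //.
by split=> //; exact: conn_irreducible.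
Qed.
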